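(* Let $p(z)=z^m(z^n-1)$ with integers $m\ge 0$ and $n\ge 2$, and let $h\in\mathbb{C}$ with $|h-1|<1$. If the Julia set $\mathcal{J}(N_{h,p})$ of the relaxed Newton map $N_{h,p}(z)=z-h\,p(z)/p'(z)$ is not a line, then $\Sigma p=\Sigma N_{h,p}$.
   Context: For a rational map (or polynomial) $R$ of degree at least two with Julia set $\mathcal{J}(R)$, the symmetry group of $R$ is $\Sigma R=\{\sigma(z)=az+b:\ |a|=1,\ \sigma(\mathcal{J}(R))=\mathcal{J}(R)\}$, the group of Euclidean isometries preserving the Julia set. $N_{h,p}$ is viewed as a rational map of the Riemann sphere. *)

(* Defs.v *)
From HB Require Import structures.
From mathcomp Require Import all_boot all_order all_algebra.
From mathcomp Require Import complex.
From mathcomp Require Import reals.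
Set Implicit Arguments. Unset Strict Implicit. Unset Printing Implicit Defensive.
Import Order.TTheory GRing.Theory Num.Theory.
Local Open Scope ring_scope.

Section Defs.
Variable R : realType.
Local Notation C := R[i].

Definition cmod (z : C) : R := ComplexField.Normc.normc z.

(* The Riemann sphere: Some z is the point z of C, None is infinity. *)
Definition sphere := option C.

Definition chord (x y : sphere) : R :=
  match x, y with
  | Some z, Some w =>
      2 * cmod (z - w) / Num.sqrt ((1 + cmod z ^+ 2) * (1 + cmod w ^+ 2))
  | Some z, None | None, Some z => 2 / Num.sqrt (1 + cmod z ^+ 2)
  | None, None => 0
  end.

Definition cball (x : sphere) (r : R) : sphere -> Prop :=
  fun y => chord x y < r.

(* The rational map of the Riemann sphere induced by the rational
   function P/Q (Q <> 0), after cancelling the common factor gcd(P,Q). *)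
Definition ratmap (P Q : {poly C}) : sphere -> sphere :=
  let g := gcdp P Q in
  let P1 := P %/ g in
  let Q1 := Q %/ g in
  fun x => match x with
  | Some z => if Q1.[z] != 0 then Some (P1.[z] / Q1.[z]) else None
  | None =>
      if (size Q1 < size P1)%N then None
      else if size P1 == size Q1 then Some (lead_coef P1 / lead_coef Q1)
      else Some 0
  end.

Definition polymap (P : {poly C}) : sphere -> sphere := ratmap P 1.

Definition loc_unif_cvg (U : sphere -> Prop) (F : nat -> sphere -> sphere)
    (g : sphere -> sphere) : Prop :=
  forall w, U w -> exists2 d : R, 0 < d &
    (forall v, cball w d v -> U v) /\
    forall eps : R, 0 < eps -> exists K : nat, forall k : nat, (K <= k)%N ->
      forall v, cball w d v -> chord (F k v) (g v) < eps.

Definition normal_iterates (f : sphere -> sphere) (U : sphere -> Prop) : Prop :=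
  forall n : nat -> nat, exists (s : nat -> nat) (g : sphere -> sphere),
    (forall k, (s k < s k.+1)%N) /\
    loc_unif_cvg U (fun k => iter (n (s k)) f) g.

Definition fatou (f : sphere -> sphere) (x : sphere) : Prop :=
  exists2 r : R, 0 < r & normal_iterates f (cball x r).

Definition julia (f : sphere -> sphere) (x : sphere) : Prop := ~ fatou f x.

Definition isom (a b : C) (x : sphere) : sphere :=
  match x with Some z => Some (a * z + b) | None => None end.

Definition symgroup (f : sphere -> sphere) : C * C -> Prop :=
  fun ab => cmod ab.1 = 1 /\
    (forall y, julia f y <-> exists2 x, julia f x & isom ab.1 ab.2 x = y).

Definition julia_is_line (f : sphere -> sphere) : Prop :=
  exists c d : C, d != 0 /\
    forall z : C, julia f (Some z) <-> exists t : R, z = c + (t%:C)%C * d.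

Definition pmn (m n : nat) : {poly C} := 'X^m * ('X^n - 1).

(* relaxed Newton map N_{h,p}(z) = z - h p(z)/p'(z) = (z p' - h p)/p' *)
Definition relaxed_newton (h : C) (p : {poly C}) : sphere -> sphere :=
  ratmap ('X * p^`() - h *: p) (p^`()).

End Defs.

(* Main.v *)
(** Both symmetry groups are the group of rotations by the n-th roots of unity.

    For the polynomial p of degree d: if z |-> a z + b preserves J(p), the mean
    of p(a r + b) over the fibre p(r) = w is a^d w + k with k independent of w,
    and it is a mean of points of J(p).  At a point w of J(p) farthest from the
    centre of the rotation w |-> a^d w + k, strict convexity forces
    p(a r + b) = a^d w + k on the fibre; two such fibres have more than d points,
    so p(a z + b) = a^d p(z) + k identically.

    For the Newton map N, infinity is a repelling fixed point with
    N(z) = lam z + O(z^(1-n)), and the basin of the root 1 is unbounded: otherwise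
    the iterates of N near infinity would omit a disc, which contradicts the
    Cauchy estimate because their derivatives in the coordinate 1/z blow up.
    A symmetry of J(N) that is not a rotation by an n-th root of unity gives,
    after conjugation by N^k, arbitrarily short displacements g lam^(qk) z^(1-q)
    that preserve J(N) near infinity (q = 1 for a translation, q = n for the
    commutator of N with a rotation).  Displacements in two independent directions
    move a point of J(N) closer to a nearest Fatou point, which is absurd.  In the
    remaining cases h is real and J(N) would contain a real or imaginary ray near
    infinity, which contradicts the real dynamics of N, unless m = 0 and n = 2,
    where J(N) is the imaginary axis. *)
From mathcomp Require Import all_boot all_order all_algebra.
From mathcomp Require Import complex reals ring lra boolp classical_sets.
From mathcomp Require Import separable cyclotomic.
Require Import Defs.
Import Order.TTheory GRing.Theory Num.Theory.
Set Implicit Arguments. Unset Strict Implicit. Unset Printing Implicit Defensive.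
Local Open Scope ring_scope.
Local Notation re := complex.Re.
Local Notation im := complex.Im.

Arguments cmod {R} z : simpl never.

(** Two elementary facts carry the analysis. First, the sum of E over a fibre P = w does not depend
    on w when deg E < deg P. Taken with E = p(a z + b) - a^d p(z), whose leading terms cancel, it
    computes the fibre means; taken with P = z^L it gives the maximum principle behind the Cauchy
    estimate. Second, a polynomial that is small at z has a root near z, which gives openness of
    rational maps and preimages under N near infinity. The factor lam^(qk) arises because N^(-k)
    multiplies z by about lam^(-k), so the displacement there is g lam^(-k(1-q)) z^(1-q), and N^k
    multiplies it by lam^k. A second direction comes from multiplying g by a^q for a rotational
    symmetry a of J, or by lam^q. The unbounded basin is needed because its images under the n-th
    roots of unity are disjoint: segments between them meet J at points that are arbitrarily far out
    and border the Fatou set, and there the displacements are nearly constant. The point d lam lies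
    in the unit disc about d - 1, which is seen from 0 under so small an angle that lam^n is real
    only if lam is; this is how h becomes real. *)

Section ComplexModulus.
Variable R : realType.
Local Notation C := R[i].
Implicit Types (x y z : C) (P Q : {poly C}).

(** * Complex moduli and growth of polynomials *)

Lemma reD x y : re (x + y) = re x + re y. Proof. by case: x y => [a b] [c d]. Qed.
Lemma imD x y : im (x + y) = im x + im y. Proof. by case: x y => [a b] [c d]. Qed.
Lemma reN x : re (- x) = - re x. Proof. by case: x. Qed.
Lemma imN x : im (- x) = - im x. Proof. by case: x. Qed.
Lemma reM x y : re (x * y) = re x * re y - im x * im y.
Proof. by case: x y => [a b] [c d]. Qed.
Lemma imM x y : im (x * y) = re x * im y + im x * re y.
Proof. by case: x y => [a b] [c d]. Qed.
Lemma reJ x : re (conjc x) = re x. Proof. by case: x. Qed.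
Lemma imJ x : im (conjc x) = - im x. Proof. by case: x. Qed.

Definition ReImE := (reD, imD, reN, imN, reM, imM, reJ, imJ).

Lemma complex_eq x y : re x = re y -> im x = im y -> x = y.
Proof. by case: x y => [a b] [c d] /= -> ->. Qed.

Lemma cmod_sq z : cmod z ^+ 2 = re z ^+ 2 + im z ^+ 2.
Proof. by case: z => a b; rewrite /cmod /= sqr_sqrtr // addr_ge0 ?sqr_ge0. Qed.

Lemma mulJ_cmod z : z * conjc z = ((cmod z ^+ 2)%:C)%C.
Proof. by apply: complex_eq; rewrite !ReImE /= ?cmod_sq; ring. Qed.

Lemma cmod_ge0 z : 0 <= cmod z.
Proof. by case: z => a b; rewrite /cmod /= sqrtr_ge0. Qed.

Lemma cmod0 : cmod (0 : C) = 0. Proof. exact: ComplexField.Normc.normc0. Qed.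
Lemma cmod1 : cmod (1 : C) = 1. Proof. exact: ComplexField.Normc.normc1. Qed.

Lemma cmodM x y : cmod (x * y) = cmod x * cmod y.
Proof. exact: ComplexField.Normc.normcM. Qed.

Lemma cmodV x : cmod x^-1 = (cmod x)^-1.
Proof. exact: ComplexField.Normc.normcV. Qed.

Lemma cmod_div x y : cmod (x / y) = cmod x / cmod y.
Proof. by rewrite cmodM cmodV. Qed.

Lemma cmodD x y : cmod (x + y) <= cmod x + cmod y.
Proof. exact: le_normcD. Qed.

Lemma cmodN x : cmod (- x) = cmod x.
Proof. exact: normcN. Qed.

Lemma cmodB x y : cmod (x - y) <= cmod x + cmod y.
Proof. by rewrite -(cmodN y) cmodD. Qed.

Lemma cmodBC x y : cmod (x - y) = cmod (y - x).
Proof. by rewrite -cmodN opprB. Qed.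

Lemma cmod_sub_ge x y : cmod x - cmod y <= cmod (x - y).
Proof. by have := cmodD (x - y) y; rewrite subrK; lra. Qed.

Lemma cmod_add_ge x y : cmod x - cmod y <= cmod (x + y).
Proof. by have := cmod_sub_ge x (- y); rewrite cmodN opprK. Qed.

Lemma cmod_tri y x z : cmod (x - z) <= cmod (x - y) + cmod (y - z).
Proof. by have := cmodD (x - y) (y - z); rewrite addrA subrK. Qed.

Lemma cmodX x n : cmod (x ^+ n) = cmod x ^+ n.
Proof. by elim: n => [|n IH]; rewrite ?expr0 ?cmod1 // !exprS cmodM IH. Qed.

Lemma cmod_eq0 x : (cmod x == 0) = (x == 0).
Proof.
apply/eqP/eqP => [|->]; last exact: cmod0.
exact: ComplexField.Normc.eq0_normc.
Qed.

Lemma cmod_gt0 x : (0 < cmod x) = (x != 0).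
Proof. by rewrite lt_neqAle cmod_ge0 andbT eq_sym cmod_eq0. Qed.

Lemma cmod_le0 x : cmod x <= 0 -> x = 0.
Proof.
by move=> h; apply/eqP; rewrite -cmod_eq0 eq_le h cmod_ge0.
Qed.

Lemma cmod_real (a : R) : cmod (a%:C)%C = `|a|.
Proof. by rewrite /cmod /= expr0n addr0 sqrtr_sqr. Qed.

Lemma cmod_nat k : cmod (k%:R : C) = k%:R.
Proof. by rewrite -(rmorph_nat (real_complex R)) cmod_real normr_nat. Qed.

Lemma cmodJ x : cmod (conjc x) = cmod x.
Proof. by case: x => a b; rewrite /cmod /= sqrrN. Qed.

Lemma cmod_sum (I : Type) (s : seq I) (F : I -> C) :
  cmod (\sum_(i <- s) F i) <= \sum_(i <- s) cmod (F i).
Proof.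
elim/big_ind2: _ => [|x a y b hx hy|//]; first by rewrite cmod0.
by apply: le_trans (cmodD _ _) _; apply: lerD.
Qed.

Lemma cmod_prod (I : Type) (s : seq I) (F : I -> C) :
  cmod (\prod_(i <- s) F i) = \prod_(i <- s) cmod (F i).
Proof. by elim/big_ind2: _ => [|x a y b <- <-|//]; rewrite ?cmod1 ?cmodM. Qed.

Lemma Re_le_cmod z : `|re z| <= cmod z.
Proof.
rewrite -(@ler_pXn2r _ 2) ?nnegrE ?cmod_ge0 // cmod_sq real_normK ?num_real //.
by rewrite lerDl sqr_ge0.
Qed.

Lemma Im_le_cmod z : `|im z| <= cmod z.
Proof.
rewrite -(@ler_pXn2r _ 2) ?nnegrE ?cmod_ge0 // cmod_sq real_normK ?num_real //.
by rewrite lerDr sqr_ge0.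
Qed.

Lemma cmod_le_ReIm z : cmod z <= `|re z| + `|im z|.
Proof.
rewrite -(@ler_pXn2r _ 2) ?nnegrE ?cmod_ge0 ?addr_ge0 // cmod_sq.
rewrite -(real_normK (num_real (re z))) -(real_normK (num_real (im z))).
have := mulr_ge0 (normr_ge0 (re z)) (normr_ge0 (im z)); nra.
Qed.

Lemma poly_bounded P (r : R) :
  exists2 K : R, 0 < K & forall z, cmod z <= r -> cmod P.[z] <= K.
Proof.
elim/poly_ind: P => [|P c [K K0 IH]].
  by exists 1 => // z _; rewrite horner0 cmod0.
exists (K * `|r| + cmod c + 1) => [|z hz].
  by have := cmod_ge0 c; have := mulr_ge0 (ltW K0) (normr_ge0 r); lra.
rewrite hornerMXaddC; have h := cmodD (P.[z] * z) c; rewrite cmodM in h.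
have h1 := IH z hz; have h2 := cmod_ge0 z; have h3 := cmod_ge0 P.[z].
have h4 : cmod z <= `|r| by apply: le_trans hz (ler_norm _).
have : cmod P.[z] * cmod z <= K * `|r| by apply: ler_pM.
lra.
Qed.

Lemma poly_lipschitz P (r : R) :
  exists2 K : R, 0 < K & forall x y, cmod x <= r -> cmod y <= r ->
    cmod (P.[x] - P.[y]) <= K * cmod (x - y).
Proof.
elim/poly_ind: P => [|P c [K K0 IH]].
  by exists 1 => // x y _ _; rewrite !horner0 subr0 cmod0 mul1r cmod_ge0.
have [B B0 hB] := poly_bounded P r.
exists (K * `|r| + B) => [|x y hx hy].
  by have := mulr_ge0 (ltW K0) (normr_ge0 r); lra.
rewrite !hornerMXaddC.
have -> : P.[x] * x + c - (P.[y] * y + c) = (P.[x] - P.[y]) * x + P.[y] * (x - y).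
  by ring.
apply: le_trans (cmodD _ _) _; rewrite !cmodM mulrDl lerD //.
  rewrite mulrAC ler_pM ?cmod_ge0 ?IH //.
  exact: le_trans hx (ler_norm _).
by rewrite ler_wpM2r ?cmod_ge0 ?hB.
Qed.

Lemma poly_near P z (e : R) : 0 < e ->
  exists2 d : R, 0 < d & forall y, cmod (y - z) < d -> cmod (P.[y] - P.[z]) < e.
Proof.
move=> e0; have [K K0 hK] := poly_lipschitz P (cmod z + 1).
exists (Num.min 1 (e / K)) => [|y].
  by rewrite lt_min ltr01 divr_gt0.
rewrite lt_min => /andP[h1 h2].
have hy : cmod y <= cmod z + 1 by have := cmodD (y - z) z; rewrite subrK; lra.
apply: le_lt_trans (hK _ _ hy _) _; first by lra.
by rewrite mulrC -ltr_pdivlMr.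
Qed.

Lemma poly_upper P :
  exists2 K : R, 0 < K &
    forall z, 1 <= cmod z -> cmod P.[z] <= K * cmod z ^+ (size P).-1.
Proof.
exists (1 + \sum_(i < size P) cmod P`_i) => [|z hz].
  by have := @sumr_ge0 _ _ (index_enum _) xpredT (fun i : 'I_(size P) => cmod P`_i)
    (fun i _ => cmod_ge0 _); lra.
rewrite horner_coef; apply: le_trans (cmod_sum _ _) _.
have hle : \sum_(i < size P) cmod (P`_i * z ^+ i) <=
    (\sum_(i < size P) cmod P`_i) * cmod z ^+ (size P).-1.
  rewrite mulr_suml ler_sum // => i _; rewrite cmodM cmodX ler_wpM2l ?cmod_ge0 //.
  rewrite ler_weXn2l // -ltnS prednK ?ltn_ord //.
  exact: leq_ltn_trans (leq0n _) (ltn_ord i).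
apply: le_trans hle _; rewrite ler_wpM2r ?exprn_ge0 ?cmod_ge0 //; lra.
Qed.

Lemma poly_factor P : P != 0 -> exists s : seq C,
  [/\ size P = (size s).+1, (forall r, r \in s -> root P r) &
      forall z, P.[z] = lead_coef P * \prod_(r <- s) (z - r)].
Proof.
move=> P0; have [s hs] := closed_field_poly_normal P.
exists s; split.
- by rewrite {1}hs size_scale ?lead_coef_eq0 // size_prod_XsubC.
- by move=> r hr; rewrite hs rootZ ?lead_coef_eq0 // root_prod_XsubC.
- move=> z; rewrite {1}hs hornerZ horner_prod.
  by congr (_ * _); apply: eq_bigr => r _; rewrite hornerXsubC.
Qed.

Lemma poly_lower P : P != 0 ->
  exists2 c : R, 0 < c & exists r : R,
    forall z, r <= cmod z -> c * cmod z ^+ (size P).-1 <= cmod P.[z].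
Proof.
move=> P0; have [s [hs _ hP]] := poly_factor P0.
exists (cmod (lead_coef P) * (2^-1) ^+ size s).
  by rewrite mulr_gt0 ?cmod_gt0 ?lead_coef_eq0 // exprn_gt0 // invr_gt0.
(* Beyond twice the sum of the root moduli every factor satisfies |z - r| >= |z| / 2. *)
exists (2 * \sum_(r <- s) cmod r) => z hz.
rewrite hs /= hP cmodM -mulrA ler_wpM2l ?cmod_ge0 // -exprMn cmod_prod.
elim: {hs hP} s hz => [|a s IH] hz; first by rewrite big_nil expr0.
rewrite big_cons /= exprS; rewrite big_cons in hz.
have h0 : 0 <= \sum_(j <- s) cmod j by rewrite sumr_ge0 // => *; apply: cmod_ge0.
have h1 := cmod_ge0 a; have h2 := cmod_ge0 z.
have h3 := cmod_sub_ge z a.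
apply: ler_pM; rewrite ?exprn_ge0 ?mulr_ge0 ?invr_ge0 //; first by lra.
by apply: IH; lra.
Qed.

Lemma min_pow_le_prod (T : eqType) (f : T -> R) (s : seq T) :
  (forall t, 0 <= f t) -> s != [::] ->
  exists2 t, t \in s & f t ^+ size s <= \prod_(u <- s) f u.
Proof.
move=> f0; elim: s => [//|a s IH] _.
case: (eqVneq s [::]) => [->|sn].
  by exists a; rewrite ?inE // big_seq1.
have [x xs hx] := IH sn; rewrite big_cons /=.
case: (leP (f a) (f x)) => h.
  exists a; first by rewrite inE eqxx.
  rewrite exprS ler_wpM2l //; apply: le_trans hx.
  by rewrite lerXn2r ?nnegrE.
exists x; first by rewrite inE xs orbT.
by rewrite exprS ler_pM ?exprn_ge0 // ltW.
Qed.

(** The smallest factor |z - r| has its power below the product of all factors. This quantitative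
    root location serves as an open mapping theorem below. *)
Lemma root_near P z : (1 < size P)%N ->
  exists2 r, root P r &
    cmod (lead_coef P) * cmod (z - r) ^+ (size P).-1 <= cmod P.[z].
Proof.
move=> hP; have P0 : P != 0 by rewrite -size_poly_gt0 ltnW.
have [s [hs hr hv]] := poly_factor P0.
have sn : s != [::] by apply/eqP => se; rewrite hs se in hP.
have [r rs hle] := @min_pow_le_prod _ (fun r => cmod (z - r)) s (fun=> cmod_ge0 _) sn.
exists r; first exact: hr.
by rewrite hs hv cmodM cmod_prod ler_wpM2l ?cmod_ge0.
Qed.

Lemma expr_ge1_bernoulli (x : R) k : 0 <= x -> 1 + k%:R * x <= (1 + x) ^+ k.
Proof.
move=> x0; elim: k => [|k IH]; first by rewrite mul0r addr0 expr0.
rewrite exprS -natr1.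
have : (1 + x) * (1 + k%:R * x) <= (1 + x) * (1 + x) ^+ k by rewrite ler_wpM2l; lra.
have := mulr_ge0 (ler0n R k) (sqr_ge0 x); rewrite expr2; nra.
Qed.

Lemma pow_unbounded (x K : R) : 1 < x -> exists k, K < x ^+ k.
Proof.
move=> x1; exists (Num.bound (`|K| / (x - 1))).
have h := archi_boundP (divr_ge0 (normr_ge0 K) (_ : 0 <= x - 1)).
have {}h := h ltac:(lra); set k := Num.bound _ in h *.
rewrite ltr_pdivrMr in h; last by lra.
have := @expr_ge1_bernoulli (x - 1) k ltac:(lra).
have := ler_norm K; have -> : 1 + (x - 1) = x by ring.
lra.
Qed.

Lemma pow_small (x e : R) : 0 <= x < 1 -> 0 < e ->
  exists K, forall k, (K <= k)%N -> x ^+ k < e.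
Proof.
move=> /andP[x0 x1] e0.
have [K hK] : exists K, x ^+ K < e.
  case: (eqVneq x 0) => [->|xn]; first by exists 1%N; rewrite expr1.
  have xp : 0 < x by rewrite lt_neqAle eq_sym xn.
  have [K hK] := @pow_unbounded x^-1 e^-1 ltac:(by rewrite invf_gt1).
  exists K; rewrite exprVn in hK.
  by rewrite ltf_pV2 ?posrE ?exprn_gt0 in hK.
exists K => k hk; apply: le_lt_trans hK.
by rewrite ler_wiXn2l // ltW.
Qed.

End ComplexModulus.

(** * The chordal metric *)

Arguments chord {R} x y : simpl never.

Section ChordalMetric.
Variable R : realType.
Local Notation C := R[i].
Local Notation sphere := (sphere R).
Implicit Types (x y : sphere) (z w : C).

(** Homogeneous coordinates [z : 1] and [1 : 0]. With them the four cases of [chord] become one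
    formula: twice the modulus of the determinant over the product of the norms. *)
Definition hnum x : C := if x is Some z then z else 1.
Definition hden x : C := if x is Some _ then 1 else 0.
Definition hnorm x : R := Num.sqrt (cmod (hnum x) ^+ 2 + cmod (hden x) ^+ 2).

Lemma hnorm_sq x : hnorm x ^+ 2 = cmod (hnum x) ^+ 2 + cmod (hden x) ^+ 2.
Proof. by rewrite sqr_sqrtr // addr_ge0 ?sqr_ge0. Qed.

Lemma hnorm_gt0 x : 0 < hnorm x.
Proof.
rewrite sqrtr_gt0; case: x => [z|] /=; rewrite ?cmod1 ?cmod0 expr1n.
  by have := sqr_ge0 (cmod z); lra.
by rewrite expr0n addr0.
Qed.

Lemma hnorm_ge0 x : 0 <= hnorm x.
Proof. exact: ltW (hnorm_gt0 x). Qed.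

Lemma chordE x y :
  chord x y = 2 * cmod (hnum x * hden y - hnum y * hden x) / (hnorm x * hnorm y).
Proof.
rewrite /hnorm /chord; case: x y => [z|] [w|] /=;
  rewrite ?mulr1 ?mulr0 ?cmod1 ?cmod0 ?expr0n ?expr1n ?addr0 ?sqrtr1 ?mulr1 ?mul1r ?sub0r ?subr0 ?cmodN ?cmod1 ?mulr1.
- rewrite sqrtrM ?addr_ge0 ?sqr_ge0 //; by rewrite ![1 + _]addrC.
- by rewrite addrC.
- by rewrite addrC.
- by rewrite cmod0 mulr0 mul0r.
Qed.

Lemma chordC x y : chord x y = chord y x.
Proof. by rewrite !chordE cmodBC [hnorm x * _]mulrC. Qed.

Lemma chordxx x : chord x x = 0.
Proof. by rewrite chordE subrr cmod0 mulr0 mul0r. Qed.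

Lemma lagrange_cmod (a b c d : C) :
  cmod (a * conjc c + b * conjc d) ^+ 2 + cmod (a * d - b * c) ^+ 2 =
  (cmod a ^+ 2 + cmod b ^+ 2) * (cmod c ^+ 2 + cmod d ^+ 2).
Proof. by rewrite !cmod_sq !ReImE; ring. Qed.

Lemma hinner_le x y :
  cmod (hnum x * conjc (hnum y) + hden x * conjc (hden y)) <= hnorm x * hnorm y.
Proof.
rewrite -(@ler_pXn2r _ 2) ?nnegrE ?cmod_ge0 ?mulr_ge0 ?hnorm_ge0 //.
by rewrite exprMn !hnorm_sq -lagrange_cmod lerDl sqr_ge0.
Qed.

Lemma chord_tri y x (z : sphere) : chord x z <= chord x y + chord y z.
Proof.
rewrite !chordE; set X := hnorm x; set Y := hnorm y; set Z := hnorm z.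
have [X0 Y0 Z0] : [/\ 0 < X, 0 < Y & 0 < Z] by rewrite !hnorm_gt0.
set dxz := cmod (hnum x * hden z - _).
set dxy := cmod (hnum x * hden y - _).
set dyz := cmod (hnum y * hden z - _).
suff h : dxz * Y ^+ 2 <= dxy * (Y * Z) + dyz * (X * Y).
  have -> : 2 * dxy / (X * Y) + 2 * dyz / (Y * Z) =
      2 * (dxy * (Y * Z) + dyz * (X * Y)) / (X * Z * Y ^+ 2).
    by field; rewrite !gt_eqF.
  rewrite ler_pdivlMr; last by rewrite !mulr_gt0.
  have -> : 2 * dxz / (X * Z) * (X * Z * Y ^+ 2) = 2 * (dxz * Y ^+ 2).
    by field; rewrite !gt_eqF.
  lra.
(* Determinant identity det(x,z) <y,y> = det(x,y) <z,y> + det(y,z) <x,y>; Cauchy-Schwarz then bounds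
   the inner products on the right. *)
have e : (hnum x * hden z - hnum z * hden x) * (hnum y * conjc (hnum y) + hden y * conjc (hden y))
  = (hnum x * hden y - hnum y * hden x) * (hnum z * conjc (hnum y) + hden z * conjc (hden y))
  + (hnum y * hden z - hnum z * hden y) * (hnum x * conjc (hnum y) + hden x * conjc (hden y)).
  by ring.
have yy : cmod (hnum y * conjc (hnum y) + hden y * conjc (hden y)) = Y ^+ 2.
  have l := lagrange_cmod (hnum y) (hden y) (hnum y) (hden y).
  rewrite [hden y * hnum y]mulrC subrr cmod0 expr0n addr0 -hnorm_sq -expr2 in l.
  by apply/eqP; rewrite -(@eqrXn2 _ 2) ?cmod_ge0 ?sqr_ge0 //; apply/eqP; rewrite l.
rewrite -yy /dxz -cmodM e; apply: le_trans (cmodD _ _) _; rewrite !cmodM.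
apply: lerD; rewrite ler_wpM2l ?cmod_ge0 //.
  by rewrite [Y * Z]mulrC; apply: hinner_le.
exact: hinner_le.
Qed.

Lemma hnorm_Some_ge1 z : 1 <= hnorm (Some z).
Proof.
rewrite -[leLHS]sqrtr1 ler_sqrt ?addr_ge0 ?sqr_ge0 //= cmod1 expr1n lerDr sqr_ge0 //.
Qed.

Lemma hnorm_Some_ge z : cmod z <= hnorm (Some z).
Proof.
rewrite -(@ler_pXn2r _ 2) ?nnegrE ?cmod_ge0 ?hnorm_ge0 // hnorm_sq /=.
by rewrite lerDl sqr_ge0.
Qed.

Lemma hnorm_Some_le z w : hnorm (Some w) <= hnorm (Some z) + cmod (w - z).
Proof.
rewrite -(@ler_pXn2r _ 2) ?nnegrE ?addr_ge0 ?cmod_ge0 ?hnorm_ge0 //.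
rewrite sqrrD !hnorm_sq /=.
have h1 := hnorm_Some_ge z; have h2 := cmod_ge0 (w - z).
have h3 : cmod w <= cmod z + cmod (w - z) by have := cmodD z (w - z); rewrite addrC subrK.
have h4 := cmod_ge0 w; have h5 := cmod_ge0 z.
have : cmod w ^+ 2 <= (cmod z + cmod (w - z)) ^+ 2 by rewrite lerXn2r ?nnegrE ?addr_ge0.
have := ler_wpM2r h2 h1; rewrite sqrrD; lra.
Qed.

Lemma hnorm_Some0 : hnorm (Some 0) = 1.
Proof. by rewrite /hnorm /= cmod0 cmod1 expr0n expr1n add0r sqrtr1. Qed.

Lemma chord_Some_le z w : chord (Some z) (Some w) <= 2 * cmod (z - w).
Proof.
rewrite chordE /= !mulr1 ler_pdivrMr ?mulr_gt0 ?hnorm_gt0 //.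
have h1 : 1 <= hnorm (Some z) * hnorm (Some w).
  by rewrite -[leLHS]mulr1 ler_pM // ?hnorm_Some_ge1.
by rewrite ler_peMr // mulr_ge0 ?cmod_ge0.
Qed.

Lemma chord_Some_near z (e : R) : 0 < e -> exists2 d : R, 0 < d &
  forall v, chord (Some z) v < d -> exists2 w, v = Some w & cmod (w - z) < e.
Proof.
move=> e0; set A := hnorm (Some z).
have A0 : 0 < A := hnorm_gt0 _.
(* The bound [A^-1] excludes infinity, at distance 2/A, and forces |w - z| < A, hence
   [hnorm (Some w)] <= 2A; the second bound then gives |w - z| < e. *)
exists (Num.min A^-1 (e / A ^+ 2)) => [|[w|]].
- by rewrite lt_min invr_gt0 A0 divr_gt0 // exprn_gt0.
- rewrite lt_min chordE /= !mulr1 => /andP[h1 h2]; exists w => //.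
  set t := cmod (z - w) in h1 h2; rewrite cmodBC -/t.
  have t0 : 0 <= t := cmod_ge0 _.
  have hW := hnorm_Some_le z w; rewrite cmodBC -/t -/A in hW.
  set W := hnorm (Some w) in h1 h2 hW; have W0 : 0 < W := hnorm_gt0 _.
  rewrite ltr_pdivrMr ?mulr_gt0 // mulrA mulVf ?gt_eqF // mul1r in h1.
  rewrite ltr_pdivrMr ?mulr_gt0 // in h2.
  have h3 : t < A by lra.
  have h4 : e / A ^+ 2 * (A * W) = e * (W / A) by field; rewrite gt_eqF.
  rewrite h4 in h2.
  have h5 : W / A <= 2 by rewrite ler_pdivrMr //; lra.
  have : e * (W / A) <= e * 2 by rewrite ler_wpM2l // ltW.
  lra.
- rewrite lt_min => /andP[+ _]; rewrite chordE /= mulr0 mulr1 sub0r cmodN cmod1 mulr1.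
  have -> : hnorm None = 1 by rewrite /hnorm /= cmod1 cmod0 expr1n expr0n addr0 sqrtr1.
  by rewrite mulr1 -/A ltr_pdivrMr // mulVf ?gt_eqF //; lra.
Qed.

Lemma hnorm_None : hnorm None = 1.
Proof. by rewrite /hnorm /= cmod1 cmod0 expr1n expr0n addr0 sqrtr1. Qed.

Lemma chord_None_Some z : chord None (Some z) = 2 / hnorm (Some z).
Proof.
by rewrite chordE /= mulr0 mulr1 subr0 cmod1 mulr1 hnorm_None mul1r.
Qed.

Lemma chord_None_near (r : R) : exists2 d : R, 0 < d &
  forall v, chord None v < d -> v = None \/ exists2 w, v = Some w & r < cmod w.
Proof.
exists (2 / (2 + `|r|)) => [|[w|] h]; last by left.
  by rewrite divr_gt0 // ltr_pwDl.
right; exists w => //; rewrite chord_None_Some in h.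
have p0 : 0 < 2 + `|r| by rewrite ltr_pwDl.
rewrite ltr_pM2l // ltf_pV2 ?posrE ?hnorm_gt0 // in h.
have := hnorm_Some_le 0 w; rewrite subr0 hnorm_Some0.
have := ler_norm r; lra.
Qed.

Lemma chord_None_small (e : R) z : 0 < e -> 2 / e < cmod z -> chord None (Some z) < e.
Proof.
move=> e0; rewrite ltr_pdivrMr // mulrC => h.
rewrite chord_None_Some ltr_pdivrMr ?hnorm_gt0 //.
by have := ler_wpM2l (ltW e0) (hnorm_Some_ge z); lra.
Qed.

Lemma cball_open x (r : R) y : cball x r y ->
  exists2 d : R, 0 < d & forall v, cball y d v -> cball x r v.
Proof.
rewrite /cball => h; exists (r - chord x y); first by rewrite subr_gt0.
by move=> v hv; apply: le_lt_trans (chord_tri y _ _) _; lra.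
Qed.

End ChordalMetric.

(** * Extraction of subsequences *)

Section Subsequences.

Lemma extract (P : nat -> Prop) : (forall N, exists2 k, (N <= k)%N & P k) ->
  exists2 s : nat -> nat, (forall k, (s k < s k.+1)%N) & forall k, P (s k).
Proof.
move=> h; have [g hg] : {g : nat -> nat & forall N, (N <= g N)%N /\ P (g N)}.
  apply: (@choice _ _ (fun N k => (N <= k)%N /\ P k)) => N.
  by have [k h1 h2] := h N; exists k.
pose s k := iter k (fun i => g i.+1) (g 0%N).
exists s => [k|[|k]]; rewrite /s /=.
- by have [] := hg (s k).+1.
- by have [] := hg 0%N.
- by have [] := hg (iter k (fun i => g i.+1) (g 0%N)).+1.
Qed.

Lemma incr_ge (s : nat -> nat) : (forall k, (s k < s k.+1)%N) -> forall k, (k <= s k)%N.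
Proof. by move=> h; elim=> [//|k IH]; apply: leq_ltn_trans IH (h k). Qed.

Lemma incr_comp (s t : nat -> nat) : (forall k, (s k < s k.+1)%N) ->
  (forall k, (t k < t k.+1)%N) -> forall k, (s (t k) < s (t k.+1))%N.
Proof.
move=> hs ht k; have hm : forall i j, (i < j)%N -> (s i < s j)%N.
  move=> i; elim=> [//|j IH]; rewrite ltnS leq_eqVlt => /orP[/eqP->|/IH] //.
  by move=> h; apply: ltn_trans h (hs j).
exact: hm.
Qed.

Lemma pigeonhole (I : finType) (u : nat -> I) :
  exists j, forall N, exists2 k, (N <= k)%N & u k = j.
Proof.
apply: contrapT => hn.
have h j : exists N, forall k, (N <= k)%N -> u k <> j.
  apply: contrapT => hj; apply: hn; exists j => N; apply: contrapT => hN.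
  by apply: hj; exists N => k hk e; apply: hN; exists k.
have [g hg] := choice h.
by apply: (hg (u (\max_j g j)) (\max_j g j)) => //; apply: leq_bigmax.
Qed.

End Subsequences.

(** * Fatou sets and attracting basins of maps of the sphere *)

Section Dynamics.
Variable R : realType.
Local Notation C := R[i].
Local Notation sphere := (sphere R).
Implicit Types (x y v w : sphere) (f : sphere -> sphere) (U V : sphere -> Prop).

Definition ccont f x := forall e : R, 0 < e -> exists2 d : R, 0 < d &
  forall v, chord x v < d -> chord (f x) (f v) < e.

Definition copen f x := forall e : R, 0 < e -> exists2 d : R, 0 < d &
  forall w, chord (f x) w < d -> exists2 v, chord x v < e & f v = w.

Definition oset U := forall w, U w -> exists2 d : R, 0 < d & forall v, cball w d v -> U v.

Lemma ccont_iter f k : (forall x, ccont f x) -> forall x, ccont (iter k f) x.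
Proof.
move=> hf; elim: k => [|k IH] x e e0; first by exists e.
have [d d0 h] := hf (iter k f x) e e0.
by have [d' d'0 h'] := IH x d d0; exists d' => // v /h' /h.
Qed.

Lemma loc_unif_sub U V F g : oset V -> (forall x, V x -> U x) ->
  loc_unif_cvg U F g -> loc_unif_cvg V F g.
Proof.
move=> oV sub h w Vw; have [d d0 [_ hd]] := h w (sub w Vw).
have [d' d'0 hd'] := oV w Vw.
exists (Num.min d d'); first by rewrite lt_min d0.
split=> [v|eps /hd[K hK]]; first by rewrite /cball lt_min => /andP[_ /hd'].
exists K => k /hK {}hK v; rewrite /cball lt_min => /andP[hv _].
exact: hK.
Qed.

Lemma oset_ball x (r : R) : oset (cball x r).
Proof. by move=> w; apply: cball_open. Qed.

(* [n] need not tend to infinity in [normal_iterates]: a value taken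
   infinitely often gives a constant, hence convergent, subsequence. *)
Lemma normal_criterion f U : oset U ->
  (forall n : nat -> nat, (forall B, exists N, forall k, (N <= k)%N -> (B <= n k)%N) ->
     exists s g, (forall k, (s k < s k.+1)%N) /\
       loc_unif_cvg U (fun k => iter (n (s k)) f) g) ->
  normal_iterates f U.
Proof.
move=> oU h n.
case: (pselect (exists c, forall N, exists2 k, (N <= k)%N & n k = c)).
  move=> [c /extract[s hs hc]]; exists s, (iter c f); split=> // w Uw.
  have [d d0 hd] := oU w Uw; exists d => //; split=> // eps e0; exists 0%N => k _ v _.
  by rewrite hc chordxx.
move=> hn; apply: h; elim=> [|B [N IH]]; first by exists 0%N.
have [N' hN'] : exists N', forall k, (N' <= k)%N -> n k <> B.
  apply: contrapT => hj; apply: hn; exists B => M; apply: contrapT => hM.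
  by apply: hj; exists M => k hk e; apply: hM; exists k.
exists (maxn N N') => k; rewrite geq_max => /andP[/IH h1 /hN' h2].
by rewrite ltn_neqAle h1 andbT eq_sym; apply/eqP.
Qed.

Lemma fatou_ball f x (r : R) : 0 < r -> fatou f x ->
  exists2 r' : R, 0 < r' <= r & normal_iterates f (cball x r').
Proof.
move=> r0 [r1 r10 h]; exists (Num.min r r1).
  by rewrite lt_min r0 r10 ge_min lexx.
move=> n; have [s [g [hs hg]]] := h n; exists s, g; split=> //.
apply: loc_unif_sub hg; first exact: oset_ball.
by move=> v; rewrite /cball lt_min => /andP[].
Qed.

Lemma fatou_open f x : fatou f x ->
  exists2 d : R, 0 < d & forall v, chord x v < d -> fatou f v.
Proof.
move=> [r r0 h]; exists r => // v hv.
have [d d0 hd] := @cball_open R x r v hv; exists d => // n.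
have [s [g [hs hg]]] := h n; exists s, g; split=> //.
by apply: loc_unif_sub hg => //; apply: oset_ball.
Qed.

Lemma fatou_of_image f x : (forall y, ccont f y) -> fatou f (f x) -> fatou f x.
Proof.
move=> hf [r r0 h]; have [d d0 hd] := hf x r r0.
exists d => //; apply: normal_criterion; first exact: oset_ball.
(* The exponents tend to infinity, so the truncated [0.-1] occurs only for finitely many k, which
   [N] below skips. *)
move=> n hn; have [s [g [hs hg]]] := h (fun k => (n k).-1).
exists s, (g \o f); split=> // w Uw.
have [d1 d10 [_ h1]] := hg (f w) (hd w Uw).
have [d2 d20 h2] := hf w d1 d10.
have [d3 d30 h3] := @cball_open R x d w Uw.
exists (Num.min d2 d3); first by rewrite lt_min d20.
split=> [v|eps /h1[K hK]]; first by rewrite /cball lt_min => /andP[_ /h3].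
have [N hN] := hn 1%N.
exists (maxn K N) => k; rewrite geq_max => /andP[/hK {}hK Nk] v.
rewrite /cball lt_min => /andP[/h2 /hK + _].
have n1 : (0 < n (s k))%N by apply: hN; apply: leq_trans Nk _; apply: incr_ge.
by rewrite -[in X in _ -> X](prednK n1) iterSr.
Qed.

(** The limit near f x is [g \o pre] for an arbitrary, possibly discontinuous, choice [pre] of
    preimages. Openness at every point near x lets this choice be replaced locally by preimages
    close to a given one. *)
Lemma fatou_image f x (r0 : R) : 0 < r0 -> (forall y, chord x y < r0 -> copen f y) ->
  fatou f x -> fatou f (f x).
Proof.
move=> r00 ho /(fatou_ball r00)[r /andP[rp rr0] h].
have xr0 : chord x x < r0 by rewrite chordxx.
have [d d0 hd] := ho x xr0 r rp.
exists d => // n; have [s [g [hs hg]]] := h (fun k => (n k).+1).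
have [pre hpre] : {pre : sphere -> sphere &
    forall w, chord (f x) w < d -> chord x (pre w) < r /\ f (pre w) = w}.
  apply: (@choice _ _ (fun w v => chord (f x) w < d -> chord x v < r /\ f v = w)) => w.
  case: (pselect (chord (f x) w < d)) => [/hd[v h1 h2]|hn]; first by exists v.
  by exists w.
exists s, (g \o pre); split=> // w Vw.
have [h1 h2] := hpre w Vw.
have [d1 d10 [_ hd1]] := hg (pre w) h1.
have [d2 d20 hd2] := ho (pre w) (lt_le_trans h1 rr0) d1 d10.
have [d3 d30 hd3] := @cball_open R (f x) d w Vw.
exists (Num.min d2 d3); first by rewrite lt_min d20.
split=> [v|eps e0]; first by rewrite /cball lt_min => /andP[_ /hd3].
have [K hK] := hd1 _ e0.
exists K => k Kk w'; rewrite /cball lt_min => /andP[w'2 w'3].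
rewrite h2 in hd2; have [v' hv' fv'] := hd2 w' w'2.
have [hw1 hw2] := hpre w' (hd3 w' w'3).
(* Both points are preimages of [w'], so their iterates of order at least one coincide and so do the
   limits. *)
have eqg : chord (g v') (g (pre w')) <= 0.
  apply/ler_addgt0Pr => e ep; rewrite add0r.
  have e2 : 0 < e / 2 by lra.
  have [d4 d40 [_ /(_ _ e2)[K4 hK4]]] := hg (pre w') hw1.
  have [K5 hK5] := hd1 _ e2.
  have := hK4 (maxn K4 K5) (leq_maxl _ _) (pre w'); rewrite /cball chordxx => /(_ d40).
  have := hK5 (maxn K4 K5) (leq_maxr _ _) v' hv'.
  rewrite !iterSr hw2 fv' => a1 a2.
  apply: le_trans (chord_tri (iter (n (s (maxn K4 K5))) f w') _ _) _.
  by rewrite chordC; lra.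
have := hK k Kk v' hv'; rewrite iterSr fv' => a1.
by apply: le_lt_trans (chord_tri (g v') _ _) _; rewrite /=; lra.
Qed.

(** The k-th iterate sends S i x to S applied to the k-th iterate of x, with index [iter k t i]. The
    index varies with k, but in a finite type it is constant along a subsequence. *)
Lemma fatou_symmetry (I : finType) (S T : I -> sphere -> sphere) (t : I -> I) f :
  (forall i x y, chord (S i x) (S i y) = chord x y) ->
  (forall i x, S i (T i x) = x) ->
  (forall i x, f (S i x) = S (t i) (f x)) ->
  forall i x, fatou f x -> fatou f (S i x).
Proof.
move=> iS ST fS i x [r r0 h]; exists r => // n.
have [s [g [hs hg]]] := h n.
have itS k y j : iter k f (S j y) = S (iter k t j) (iter k f y).
  by elim: k => [//|k IH]; rewrite !iterS IH fS.
have [j /extract[s' hs' hj]] := pigeonhole (fun k => iter (n (s k)) t i).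
exists (s \o s'), (S j \o g \o T i); split; first by move=> k; apply: (incr_comp hs hs').
move=> w; rewrite /cball -{1}(ST i w) iS => Uw.
have [d d0 [h1 h2]] := hg _ Uw; exists d => //; split=> [v|eps /h2[K hK]].
  by rewrite /cball -{1}(ST i w) -{1}(ST i v) iS => /h1; rewrite /cball -(iS i) ST.
exists K => k Kk v; rewrite /cball -{1}(ST i w) -{1}(ST i v) iS => hv.
rewrite /= -{1}(ST i v) itS hj iS; apply: hK => //.
exact: leq_trans Kk (incr_ge hs' k).
Qed.

Definition basin f x0 x := forall e : R, 0 < e ->
  exists K, forall k, (K <= k)%N -> chord x0 (iter k f x) < e.

Definition attracts f x0 (r : R) := forall e : R, 0 < e ->
  exists K, forall k, (K <= k)%N -> forall v, chord x0 v < r -> chord x0 (iter k f v) < e.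

Lemma basin_hit f x0 (r : R) x k : attracts f x0 r ->
  chord x0 (iter k f x) < r -> basin f x0 x.
Proof.
move=> ha hk e /ha[K hK]; exists (k + K)%N => j hj.
rewrite -(subnK (leq_trans (leq_addr K k) hj)) iterD.
by apply: hK hk; rewrite leq_subRL // (leq_trans (leq_addr K k)).
Qed.

Lemma basin_open f x0 (r : R) x : 0 < r -> (forall y, ccont f y) -> attracts f x0 r ->
  basin f x0 x -> exists2 d : R, 0 < d &
    exists K, forall v, chord x v < d -> chord x0 (iter K f v) < r.
Proof.
move=> r0 hf ha hx; have r2 : 0 < r / 2 by lra.
have [K /(_ K (leqnn _)) hK] := hx _ r2.
have [d d0 hd] := ccont_iter K hf x r2.
exists d => //; exists K => v /hd hv.
by apply: le_lt_trans (chord_tri (iter K f x) _ _) _; lra.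
Qed.

Lemma basin_fatou f x0 (r : R) x : 0 < r -> (forall y, ccont f y) -> attracts f x0 r ->
  basin f x0 x -> fatou f x.
Proof.
move=> r0 hf ha hx; have [d d0 [K hK]] := basin_open r0 hf ha hx.
exists d => //; apply: normal_criterion => [|n hn]; first exact: oset_ball.
exists id, (fun=> x0); split=> // w /cball_open[d' d'0 hd']; exists d' => //; split=> //.
move=> eps /ha[K1 hK1]; have [N hN] := hn (K + K1)%N.
exists N => k /hN hk v /hd' /hK hv; rewrite chordC.
rewrite -(subnK (leq_trans (leq_addr K1 K) hk)) iterD; apply: hK1 => //.
by rewrite leq_subRL // (leq_trans (leq_addr K1 K)).
Qed.

(** Locally uniform convergence makes one iterate of x differ from a late iterate of a nearby basin
    point v by three errors below r/5; a fourth such error separates the latter from x0, so x enters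
    the attracted ball. *)
Lemma basin_closed f x0 (r : R) x : 0 < r -> (forall y, ccont f y) -> attracts f x0 r ->
  fatou f x -> (forall d : R, 0 < d -> exists2 v, chord x v < d & basin f x0 v) ->
  basin f x0 x.
Proof.
move=> r0 hf ha [q q0 hn] hcl.
have [s [g [hs hg]]] := hn id.
have xq : cball x q x by rewrite /cball chordxx.
have [d d0 [_ hd]] := hg x xq.
have r5 : 0 < r / 5 by lra.
have [K hK] := hd _ r5.
have [d1 d10 hd1] := ccont_iter (s K) hf x r5.
have [v] := hcl (Num.min d d1) ltac:(by rewrite lt_min d0 d10).
rewrite lt_min => /andP[vd vd1] bv.
have [K2 hK2] := bv _ r5.
pose k := maxn K K2.
have a1 := hK K (leqnn _) x; rewrite /cball chordxx in a1; have {}a1 := a1 d0.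
have a2 := hK K (leqnn _) v vd.
have a3 := hd1 v vd1.
have a4 := hK k (leq_maxl _ _) v vd.
have a5 := hK2 (s k) (leq_trans (leq_maxr _ _) (incr_ge hs _)).
apply: (@basin_hit _ _ r _ (s K)) => //.
apply: le_lt_trans (chord_tri (iter (s k) f v) _ _) _.
have b1 := chord_tri (g v) (iter (s k) f v) (iter (s K) f x).
have b2 := chord_tri (iter (s K) f v) (g v) (iter (s K) f x).
rewrite (chordC (g v) (iter (s K) f v)) (chordC (iter (s K) f v) (iter (s K) f x)) in b2.
rewrite /= in a1 a2 a4; lra.
Qed.

Definition segpt (p q : C) (t : R) : C := p + (t%:C)%C * (q - p).

Lemma cmod_segpt p q (s t : R) :
  cmod (segpt p q s - segpt p q t) = `|s - t| * cmod (q - p).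
Proof.
by rewrite -cmod_real -cmodM /segpt rmorphB /=; congr cmod; ring.
Qed.

(** The first exit parameter T of the segment works: openness of the basin keeps T outside it, while
    points just before T are inside, so by [basin_closed] the exit point cannot be a Fatou point. *)
Lemma basin_boundary f x0 (r : R) (p q : C) :
  0 < r -> (forall y, ccont f y) -> attracts f x0 r ->
  basin f x0 (Some p) -> ~ basin f x0 (Some q) ->
  exists t : R, [/\ 0 <= t <= 1, julia f (Some (segpt p q t)) &
    forall e : R, 0 < e -> exists2 z, cmod (z - segpt p q t) < e & basin f x0 (Some z)].
Proof.
move=> r0 hf ha bp bq.
pose B t := basin f x0 (Some (segpt p q t)).
have B0 : B 0 by rewrite /B /segpt mul0r addr0.
have B1 : ~ B 1 by rewrite /B /segpt mul1r addrC subrK.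
pose A : set R := fun t => 0 <= t <= 1 /\ forall s, 0 <= s <= t -> B s.
have A0 : A 0.
  by split=> [|s]; rewrite ?lexx ?ler01 // -eq_le => /eqP <-.
have ubA : has_ubound A by exists 1 => t [/andP[]].
have supA : has_sup A by split=> //; exists 0.
set T := sup A.
have T0 : 0 <= T by apply: ub_le_sup.
have T1 : T <= 1 by apply: ge_sup => [|t [/andP[]]//]; exists 0.
have near s : 0 <= s < T -> B s.
  move=> /andP[s0 sT]; have Ts : 0 < T - s by rewrite subr_gt0.
  have [t [_ ht] st] := sup_adherent Ts supA.
  by apply: ht; rewrite s0 ltW //; rewrite -/T in st; lra.
have opB s : B s -> exists2 d : R, 0 < d & forall t, `|t - s| < d -> B t.
  move=> Bs; have [d d0 [K hK]] := basin_open r0 hf ha Bs.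
  exists (d / (2 * (1 + cmod (q - p)))).
    by rewrite divr_gt0 // mulr_gt0 // ltr_pwDl // cmod_ge0.
  move=> t ht; apply: (@basin_hit _ _ r _ K) => //; apply: hK.
  apply: le_lt_trans (chord_Some_le _ _) _; rewrite cmod_segpt.
  have p0 : 0 < 2 * (1 + cmod (q - p)) by rewrite mulr_gt0 // ltr_pwDl // cmod_ge0.
  rewrite ltr_pdivlMr // in ht; rewrite distrC in ht.
  have := normr_ge0 (s - t); nra.
have nT : ~ B T.
  move=> BT; have [d d0 hd] := opB T BT.
  have ext s : 0 <= s -> s < T + d -> B s.
    move=> s0 sd; case: (ltP s T) => h; first by apply: near; rewrite s0.
    by apply: hd; rewrite ger0_norm; lra.
  case: (leP 1 T) => h; first by apply: B1; have <- : T = 1 by lra.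
  have : A (Num.min 1 (T + d / 2)).
    split; first by rewrite le_min ge_min lexx ler01 andbT /=; lra.
    by move=> s /andP[s0]; rewrite le_min => /andP[_ s2]; apply: ext => //; lra.
  move=> /(ub_le_sup ubA); rewrite -/T ge_min => /orP[]; lra.
have approx e : 0 < e -> exists2 s, B s & `|s - T| < e.
  move=> e0; have Tp : 0 < T.
    by rewrite lt_neqAle T0 andbT; apply/eqP => h; apply: nT; rewrite -h.
  exists (Num.max 0 (T - e / 2)).
    by apply: near; rewrite le_max lexx /= gt_max Tp /=; lra.
  by rewrite ltr_norml; case: (leP 0 (T - e / 2)) => h; apply/andP; split; lra.
have hc e : 0 < e -> exists2 z, cmod (z - segpt p q T) < e & basin f x0 (Some z).
  move=> e0; have p0 : 0 < 1 + cmod (q - p) by have := cmod_ge0 (q - p); lra.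
  have [s Bs hs] := approx (e / (1 + cmod (q - p))) (divr_gt0 e0 p0).
  exists (segpt p q s) => //; rewrite cmod_segpt; rewrite ltr_pdivlMr // in hs.
  by have := normr_ge0 (s - T); lra.
exists T; split=> //; first by rewrite T0.
move=> fT; apply: nT; apply: (basin_closed r0 hf ha fT) => e e0.
have [z hz bz] := hc (e / 2) ltac:(lra); exists (Some z) => //.
by apply: le_lt_trans (chord_Some_le _ _) _; rewrite cmodBC; lra.
Qed.

End Dynamics.

(** * Rational maps in reduced form that fix infinity *)

Section RationalMaps.
Variable R : realType.
Local Notation C := R[i].
Local Notation sphere := (sphere R).
Implicit Types (z w : C) (P Q : {poly C}) (f : sphere -> sphere).

(** The form shared by the polynomial and the Newton map: coprimality is stated as absence of common
    zeros, and deg Q < deg P makes infinity a fixed point. *)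
Definition ratform f P Q :=
  [/\ (forall z, Q.[z] = 0 -> P.[z] != 0), (size Q < size P)%N, Q != 0,
      (forall z, f (Some z) = if Q.[z] != 0 then Some (P.[z] / Q.[z]) else None) &
      f None = None].

Lemma ratform_ratmap P Q P' Q' : Q != 0 -> P * Q' = P' * Q ->
  (forall z, Q'.[z] = 0 -> P'.[z] != 0) -> Q' != 0 -> (size Q' < size P')%N ->
  ratform (ratmap P Q) P' Q'.
Proof.
move=> Q0 e cop Q'0 sz; pose g := gcdp P Q.
have g0 : g != 0 by rewrite gcdp_eq0 negb_and Q0 orbT.
set P1 := P %/ g; set Q1 := Q %/ g.
have eP : P1 * g = P by rewrite divpK ?dvdp_gcdl.
have eQ : Q1 * g = Q by rewrite divpK ?dvdp_gcdr.
have e1 : P1 * Q' = P' * Q1.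
  by apply: (mulIf g0); rewrite mulrAC eP e -eQ mulrA.
have cop1 : coprimep P1 Q1 by rewrite coprimep_div_gcd // Q0 orbT.
have cop2 : coprimep Q' P'.
  apply/Pdiv.ClosedField.coprimepP => z; first by rewrite rootE => /eqP /cop.
have d1 : Q1 %| Q'.
  by rewrite coprimep_sym in cop1; rewrite -(Gauss_dvdpr _ cop1) e1 dvdp_mull.
have d2 : Q' %| Q1 by rewrite -(Gauss_dvdpr _ cop2) -e1 dvdp_mull.
have /eqpP[[c1 c2] /= /andP[c10 c20] ec] : Q1 %= Q' by rewrite /eqp d1.
pose c := c1^-1 * c2.
have cn0 : c != 0 by rewrite mulf_neq0 ?invr_eq0.
have eQ1 : Q1 = c *: Q' by rewrite /c -scalerA -ec scalerA mulVf // scale1r.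
have eP1 : P1 = c *: P'.
  by apply: (mulIf Q'0); rewrite e1 eQ1 -scalerAr -scalerAl.
split=> //.
  move=> z; rewrite /ratmap -/g -/P1 -/Q1 eP1 eQ1 !hornerZ mulf_eq0 negb_or cn0 /=.
  by case: ifP => // h; congr Some; field; rewrite h cn0.
by rewrite /ratmap -/g -/P1 -/Q1 eP1 eQ1 !size_scale // sz.
Qed.

Lemma poly_neq0_near Q z : Q.[z] != 0 -> exists2 d : R, 0 < d &
  forall y, cmod (y - z) < d -> cmod Q.[z] / 2 < cmod Q.[y].
Proof.
move=> Qz; have Q0 : 0 < cmod Q.[z] / 2 by rewrite divr_gt0 // cmod_gt0.
have [d d0 hd] := poly_near Q z Q0; exists d => // y /hd h.
have := cmod_sub_ge Q.[z] (Q.[z] - Q.[y]).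
rewrite (cmodBC Q.[z] Q.[y]); have -> : Q.[z] - (Q.[z] - Q.[y]) = Q.[y] by ring.
lra.
Qed.

Lemma ratform_cont f P Q : ratform f P Q -> forall x, ccont f x.
Proof.
move=> [cop sz Q0 fS fN] [z|] e e0.
  case: (eqVneq Q.[z] 0) => Qz.
    have Pz := cop _ Qz.
    have [d1 d10 h1] := poly_neq0_near Pz.
    have c0 : 0 < e * cmod P.[z] / 4 by rewrite divr_gt0 // mulr_gt0 // cmod_gt0.
    have [d2 d20 h2] := poly_near Q z c0.
    have [d d0 hd] := @chord_Some_near R z (Num.min d1 d2) ltac:(by rewrite lt_min d10).
    exists d => // v /hd[y ->]; rewrite lt_min => /andP[/h1 hy1 /h2 hy2].
    rewrite !fS Qz eqxx /=; case: ifP => Qy; last by rewrite chordxx.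
    apply: chord_None_small => //; rewrite cmod_div ltr_pdivlMr ?cmod_gt0 //.
    rewrite Qz subr0 in hy2.
    have : 2 / e * cmod Q.[y] < 2 / e * (e * cmod P.[z] / 4) by rewrite ltr_pM2l // divr_gt0.
    have -> : 2 / e * (e * cmod P.[z] / 4) = cmod P.[z] / 2 by field; rewrite gt_eqF.
    lra.
  have [d1 d10 h1] := poly_neq0_near Qz.
  (* [T] vanishes at z and T(y) = Q(y) Q(z) (f(y) - f(z)), so continuity of f at z reduces to that
     of a polynomial. *)
  pose T := Q.[z] *: P - P.[z] *: Q.
  have Qzp : 0 < cmod Q.[z] by rewrite cmod_gt0.
  have c0 : 0 < e * cmod Q.[z] ^+ 2 / 4 by rewrite divr_gt0 // mulr_gt0 // exprn_gt0.
  have [d2 d20 h2] := poly_near T z c0.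
  have [d d0 hd] := @chord_Some_near R z (Num.min d1 d2) ltac:(by rewrite lt_min d10).
  exists d => // v /hd[y ->]; rewrite lt_min => /andP[/h1 hy1 /h2 hy2].
  have Qy : Q.[y] != 0 by rewrite -cmod_gt0; lra.
  rewrite !fS Qz Qy; apply: le_lt_trans (chord_Some_le _ _) _.
  have ee : P.[z] / Q.[z] - P.[y] / Q.[y] = - (T.[y] - T.[z]) / (Q.[y] * Q.[z]).
    by rewrite /T !hornerE; field; rewrite Qz Qy.
  rewrite ee cmod_div cmodN cmodM mulrA ltr_pdivrMr; last by rewrite mulr_gt0 //; lra.
  have : e * (cmod Q.[z] / 2 * cmod Q.[z]) < e * (cmod Q.[y] * cmod Q.[z]).
    by rewrite ltr_pM2l // ltr_pM2r.
  by rewrite expr2 in hy2; lra.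
have P0 : P != 0 by rewrite -size_poly_gt0; apply: leq_ltn_trans sz.
have [c cp [r1 h1]] := poly_lower P0.
have [K Kp h2] := poly_upper Q.
pose r := Num.max 1 (Num.max r1 (2 * K / (e * c))).
have [d d0 hd] := chord_None_near r.
exists d => // v /hd [->|[w -> hw]]; first by rewrite chordxx.
rewrite fN fS; case: ifP => Qw; last by rewrite chordxx.
move: hw; rewrite !gt_max => /andP[w1 /andP[wr1 w2]].
apply: chord_None_small => //; rewrite cmod_div ltr_pdivlMr ?cmod_gt0 //.
apply: lt_le_trans (h1 w (ltW wr1)).
apply: le_lt_trans (_ : 2 / e * (K * cmod w ^+ (size Q).-1) < _).
  by rewrite ler_wpM2l ?h2 ?divr_ge0 // ltW.
have hpow : cmod w * cmod w ^+ (size Q).-1 <= cmod w ^+ (size P).-1.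
  rewrite -exprS ler_weXn2l ?(ltW w1) //.
  rewrite prednK ?size_poly_gt0 // -ltnS prednK //.
  exact: leq_ltn_trans sz.
have wp : 0 < cmod w ^+ (size Q).-1 by rewrite exprn_gt0 //; lra.
apply: lt_le_trans (_ : c * (cmod w * cmod w ^+ (size Q).-1) <= _); last first.
  by rewrite ler_pM2l.
have -> : 2 / e * (K * cmod w ^+ (size Q).-1) = (2 * K / (e * c)) * (c * cmod w ^+ (size Q).-1).
  by field; rewrite !gt_eqF.
by rewrite [ltRHS]mulrCA ltr_pM2r // mulr_gt0.
Qed.

(** For w' near f(u) the polynomial P - w' Q is small at u and keeps the degree and leading
    coefficient of P, so it has a root near u by [root_near]. *)
Lemma ratform_open f P Q u : ratform f P Q -> Q.[u] != 0 -> copen f (Some u).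
Proof.
move=> [cop sz Q0 fS fN] Qu e e0.
have [d1 d10 h1] := poly_neq0_near Qu.
pose eps := Num.min (e / 2) d1.
have eps0 : 0 < eps by rewrite lt_min d10 divr_gt0.
have P0 : P != 0 by rewrite -size_poly_gt0; apply: leq_ltn_trans sz.
have lc0 : 0 < cmod (lead_coef P) by rewrite cmod_gt0 lead_coef_eq0.
have Qp : 0 < cmod Q.[u] by rewrite cmod_gt0.
pose eps2 := cmod (lead_coef P) * eps ^+ (size P).-1 / cmod Q.[u].
have eps20 : 0 < eps2 by rewrite divr_gt0 // mulr_gt0 // exprn_gt0.
have [d d0 hd] := chord_Some_near (P.[u] / Q.[u]) eps20.
exists d => // w; rewrite fS Qu => /hd[w' -> hw].
have sz' : (size (- (w' *: Q)) < size P)%N.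
  by rewrite size_polyN; apply: leq_ltn_trans (size_scale_leq _ _) sz.
have szE : size (P - w' *: Q) = size P by rewrite size_polyDl.
have lcE : lead_coef (P - w' *: Q) = lead_coef P by rewrite lead_coefDl.
have s1 : (1 < size (P - w' *: Q)%R)%N.
  by rewrite szE; apply: leq_ltn_trans sz; rewrite size_poly_gt0.
have [r rr hr] := root_near u s1.
rewrite szE lcE !hornerE in hr.
have ru : cmod (u - r) < eps.
  rewrite ltNge; apply/negP => h.
  have a1 : cmod (lead_coef P) * eps ^+ (size P).-1 <=
            cmod (lead_coef P) * cmod (u - r) ^+ (size P).-1.
    by rewrite ler_pM2l // lerXn2r ?nnegrE ?cmod_ge0 // ltW.
  have a2 : P.[u] - w' * Q.[u] = - ((w' - P.[u] / Q.[u]) * Q.[u]) by field.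
  rewrite a2 cmodN cmodM in hr.
  rewrite /eps2 ltr_pdivlMr // in hw.
  by have := le_lt_trans (le_trans a1 hr) hw; rewrite ltxx.
move: ru; rewrite lt_min => /andP[r1 r2].
have Qr : Q.[r] != 0.
  by rewrite -cmod_gt0; have := h1 r; rewrite cmodBC => /(_ r2); lra.
exists (Some r).
  by apply: le_lt_trans (chord_Some_le _ _) _; lra.
rewrite fS Qr; congr Some.
have /eqP := rr; rewrite !hornerE => /eqP; rewrite subr_eq0 => /eqP ->.
by rewrite mulfK.
Qed.

Lemma ratform_fatou f P Q u w : ratform f P Q -> f (Some u) = Some w ->
  fatou f (Some u) <-> fatou f (Some w).
Proof.
move=> hf fu; have hc := ratform_cont hf; rewrite -fu; split; last exact: fatou_of_image.
have [_ _ _ fS _] := hf.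
have Qu : Q.[u] != 0 by move: fu; rewrite fS; case: ifP.
have [d1 d10 h1] := poly_neq0_near Qu.
have [d d0 hd] := chord_Some_near u d10.
apply: (fatou_image d0) => y /hd[v -> /h1 hv].
apply: ratform_open hf _; rewrite -cmod_gt0.
by have := cmod_ge0 Q.[u]; lra.
Qed.

Lemma ratform_julia f P Q u w : ratform f P Q -> f (Some u) = Some w ->
  julia f (Some u) <-> julia f (Some w).
Proof. by move=> hf /(ratform_fatou hf) e; rewrite /julia e. Qed.

Lemma fatou_near f z : fatou f (Some z) ->
  exists2 d : R, 0 < d & forall y, cmod (y - z) < d -> fatou f (Some y).
Proof.
move=> /fatou_open[d d0 hd]; exists (d / 2); first by rewrite divr_gt0.
by move=> y hy; apply: hd; apply: le_lt_trans (chord_Some_le _ _) _; rewrite cmodBC; lra.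
Qed.

Lemma attracts_contraction f (z0 : C) (r th : R) : 0 < r -> 0 <= th < 1 ->
  (forall z, cmod (z - z0) < r ->
     exists2 w, f (Some z) = Some w & cmod (w - z0) <= th * cmod (z - z0)) ->
  exists2 d : R, 0 < d & attracts f (Some z0) d.
Proof.
move=> r0 /andP[th0 th1] hf.
have [d d0 hd] := chord_Some_near z0 r0.
exists d => // e e0.
have thI : 0 <= th < 1 by rewrite th0.
have r20 : 0 < 2 * r by lra.
have [K hK] := pow_small thI (divr_gt0 e0 r20).
exists K => k /hK hk v /hd[z -> hz].
have [w [-> hw]] : exists w, iter k f (Some z) = Some w /\ cmod (w - z0) <= th ^+ k * cmod (z - z0).
  elim: k {hk} => [|k [w [hw1 hw2]]]; first by exists z; rewrite expr0 mul1r.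
  have wr : cmod (w - z0) < r.
    apply: le_lt_trans hw2 _; apply: le_lt_trans hz.
    by rewrite ler_piMl ?cmod_ge0 // exprn_ile1 // ltW.
  have [w' fw hw'] := hf w wr; exists w'; rewrite iterS hw1 fw; split=> //.
  by apply: le_trans hw' _; rewrite exprS -mulrA ler_wpM2l.
apply: le_lt_trans (chord_Some_le _ _) _; rewrite cmodBC.
have h1 : th ^+ k * cmod (z - z0) <= th ^+ k * r.
  by rewrite ler_wpM2l ?exprn_ge0 // ltW.
rewrite ltr_pdivlMr in hk; last by lra.
lra.
Qed.

End RationalMaps.

(** * Fibres of a polynomial *)

Section FibreSums.
Variable R : realType.
Local Notation C := R[i].
Implicit Types (z w : C) (P E : {poly C}) (s : seq C).

(** Logarithmic derivative: with S the product, E S'/S is the sum of E/(X - r), with polynomial part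
    B and remainder T = sum of E(r) S/(X - r). The sum of the E(r) is thus the coefficient of T in
    degree [size s] minus one; the factor ['X] avoids a predecessor when s is empty. Repeated roots
    are allowed. *)
Lemma interpolation_step E s :
  exists B T : {poly C}, [/\ E * (\prod_(r <- s) ('X - r%:P))^`() =
      (\prod_(r <- s) ('X - r%:P)) * B + T, (size T <= size s)%N,
      ('X * T)`_(size s) = \sum_(r <- s) E.[r] &
      (forall r, r \in s -> E.[r] = 0) -> T = 0].
Proof.
elim: s => [|a s [B [T [e sT cT zT]]]].
  by exists 0, 0; rewrite !big_nil derivC !mulr0 add0r size_poly0 coef0.
have /factor_theorem[G eG] : root (E - E.[a]%:P) a by rewrite /root !hornerE subrr.
set S := \prod_(r <- s) _ in e *.
exists (B + G), (E.[a] *: S + ('X - a%:P) * T); rewrite !big_cons -/S; split.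
- rewrite derivM derivXsubC mul1r mulrDr.
  have -> : E * (('X - a%:P) * S^`()) = ('X - a%:P) * (S * B + T) by rewrite -e; ring.
  have -> : E * S = (G * ('X - a%:P) + E.[a]%:P) * S by rewrite -eG subrK.
  by rewrite -mul_polyC; ring.
- apply: leq_trans (size_polyD _ _) _; rewrite geq_max; apply/andP; split.
    by apply: leq_trans (size_scale_leq _ _) _; rewrite size_prod_XsubC.
  by apply: leq_trans (size_polyMleq _ _) _; rewrite size_XsubC.
- rewrite coefXM /= coefD coefZ.
  have -> : S`_(size s) = 1.
    have := monic_prod_XsubC s xpredT id; rewrite -/S monicE lead_coefE => /eqP.
    by rewrite size_prod_XsubC.
  rewrite mulr1; congr (_ + _).
  by rewrite mulrBl coefB cT mul_polyC coefZ (nth_default _ sT) mulr0 subr0.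
- move=> h; rewrite (h a) ?mem_head // scale0r add0r zT ?mulr0 // => r rs.
  by apply: h; rewrite inE rs orbT.
Qed.

Lemma monic_factor P : P \is monic -> exists s, P = \prod_(r <- s) ('X - r%:P).
Proof.
move=> /monicP mP; have [s hs] := closed_field_poly_normal P.
by exists s; rewrite hs mP scale1r.
Qed.

(** Passing to P' costs each root of P one order of vanishing, and G restores it. *)
Lemma dvdp_deriv P G : P \is monic -> (forall z, P.[z] = 0 -> G.[z] = 0) -> P %| G * P^`().
Proof.
move=> /monic_factor[s eP] h.
have [B [T [e _ _ zT]]] := interpolation_step G s.
rewrite eP e zT ?addr0 ?dvdp_mulr // => r rs; apply: h; apply/eqP.
by rewrite -/(root P r) eP root_prod_XsubC.
Qed.

Lemma size_deriv_monic P d : size P = d.+2 -> size P^`() = d.+1.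
Proof.
move=> sP; apply/eqP; rewrite eqn_leq; apply/andP; split.
  have := lt_size_deriv (_ : P != 0); rewrite sP => h; apply: h.
  by rewrite -size_poly_gt0 sP.
rewrite ltnNge; apply/negP => /leq_sizeP /(_ d (leqnn d)).
rewrite coef_deriv => /eqP; rewrite mulrn_eq0 /=.
have -> : P`_d.+1 = lead_coef P by rewrite lead_coefE sP.
by rewrite lead_coef_eq0 -size_poly_eq0 sP.
Qed.

Lemma fibre_shift P w d : P \is monic -> size P = d.+2 ->
  (P - w%:P \is monic) /\ size (P - w%:P) = d.+2.
Proof.
move=> mP sP; have h : (size (- w%:P : {poly C})%R < size P)%N.
  by rewrite size_polyN sP; apply: leq_ltn_trans (size_polyC_leq1 _) _.
by rewrite monicE lead_coefDl // size_polyDl // sP; split=> //; rewrite -monicE.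
Qed.

(* In E P' = (P - w) A + rem the quotient A does not depend on w, and the
   sum of E over the fibre is the coefficient of degree d in rem. *)
Lemma fibre_sum_constant P E d : P \is monic -> size P = d.+2 -> (size E <= d.+1)%N ->
  exists k, forall w s, P - w%:P = \prod_(r <- s) ('X - r%:P) ->
    \sum_(r <- s) E.[r] = k.
Proof.
move=> mP sP sE; pose A := (E * P^`()) %/ P; pose r0 := (E * P^`()) %% P.
have P0 : P != 0 by rewrite -size_poly_gt0 sP.
have sA : (size A <= d)%N.
  rewrite size_divp // sP /= leq_subLR.
  apply: leq_trans (size_polyMleq _ _) _; rewrite (size_deriv_monic sP).
  by rewrite addnS /= leq_add2r.
have sr0 : (size r0 <= d.+1)%N by have := ltn_modp (E * P^`()) P; rewrite P0 sP ltnS.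
exists (r0`_d) => w s ew.
have [B [T [e sT cT _]]] := interpolation_step E s.
have [mw sw] := fibre_shift w mP sP.
have ss : size s = d.+1 by have := size_prod_XsubC s id; rewrite -ew sw => -[].
rewrite -cT ss coefXM /=.
rewrite -ew derivB derivC subr0 in e.
have e2 : (P - w%:P) * (A - B) = T - (r0 + w%:P * A).
  have e3 : E * P^`() = A * P + r0 by apply: divp_eq.
  have -> : T = E * P^`() - (P - w%:P) * B by rewrite e; ring.
  by rewrite e3; ring.
(* A nonzero multiple of P - w would have size at least [d.+2], but the right-hand side has size at
   most [d.+1]. Since A has size at most d, the coefficients of T and r0 in degree d then agree. *)
have Tz : T - (r0 + w%:P * A) = 0.
  apply/eqP; case: (eqVneq (A - B) 0) => [z|nz]; first by rewrite -e2 z mulr0.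
  have : (size (T - (r0 + w%:P * A))%R <= d.+1)%N.
    rewrite ss in sT; apply: leq_trans (size_polyD _ _) _; rewrite geq_max sT size_polyN /=.
    apply: leq_trans (size_polyD _ _) _; rewrite geq_max sr0 /=.
    by rewrite mul_polyC; apply: leq_trans (size_scale_leq _ _) (leqW sA).
  rewrite -e2 size_proper_mul; last by rewrite (monicP mw) mul1r lead_coef_eq0.
  have /eqP := nz; rewrite -size_poly_gt0 in nz; case: (size (A - B)) nz => // k _ _.
  by rewrite sw addnS /= addSn ltnS -ltn_subRL subnn.
move/eqP: Tz; rewrite subr_eq0 => /eqP ->.
by rewrite coefD mul_polyC coefZ (nth_default _ sA) mulr0 addr0.
Qed.

End FibreSums.

(** * Compactness and strict convexity in the plane *)

Section BoundedSets.
Variable R : realType.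
Local Notation C := R[i].

(** The value is the limit superior of g along the family [Phi e] as e tends to 0: the supremum of
    all x that g reaches or exceeds on every [Phi e]. *)
Lemma cluster_value (T : Type) (Phi : R -> T -> Prop) (g : T -> R) (B : R) :
  (forall e, 0 < e -> exists w, Phi e w) ->
  (forall e e' w, e <= e' -> Phi e w -> Phi e' w) ->
  (forall e w, Phi e w -> `|g w| <= B) ->
  exists x, forall e, 0 < e -> exists w, Phi e w /\ `|g w - x| < e.
Proof.
move=> ne mono bd.
pose A : set R := fun x => forall e, 0 < e -> exists w, Phi e w /\ x <= g w.
have AB : A (- B).
  move=> e /ne[w hw]; exists w; split=> //.
  by have := bd _ _ hw; rewrite ler_norml => /andP[].
have ubA : has_ubound A.
  exists B => x /(_ 1 ltr01)[w [hw h]]; apply: le_trans h _.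
  by have := bd _ _ hw; rewrite ler_norml => /andP[].
have supA : has_sup A by split=> //; exists (- B).
exists (sup A) => e e0.
have [x Ax hx] := sup_adherent e0 supA.
have nA : ~ A (sup A + e / 2).
  by move=> /(ub_le_sup ubA); lra.
have [e1 [e10 h1]] : exists e1, 0 < e1 /\ forall w, Phi e1 w -> g w < sup A + e / 2.
  apply: contrapT => hn; apply: nA => e1 e10; apply: contrapT => hn1.
  apply: hn; exists e1; split=> // w hw; rewrite ltNge; apply/negP => h.
  by apply: hn1; exists w.
have [w [hw hxw]] := Ax (Num.min e e1) ltac:(by rewrite lt_min e0).
exists w; split; first by apply: mono hw; rewrite ge_min lexx.
have := h1 w (mono _ _ _ _ hw); rewrite ge_min lexx orbT => /(_ isT) h2.
by rewrite ltr_norml; apply/andP; split; lra.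
Qed.

Definition cclosed (J : C -> Prop) :=
  forall z, (forall e : R, 0 < e -> exists2 y, J y & cmod (y - z) < e) -> J z.

Lemma farthest_point (J : C -> Prop) (M : R) (c : C) :
  (exists z, J z) -> cclosed J -> (forall z, J z -> cmod z <= M) ->
  exists2 w, J w & forall y, J y -> cmod (y - c) <= cmod (w - c).
Proof.
move=> [z0 Jz0] cl bd.
pose A : set R := fun t => exists2 z, J z & t = cmod (z - c).
have ubA : has_ubound A.
  exists (M + cmod c) => t [z /bd hz ->]; apply: le_trans (cmodB _ _) _; lra.
have supA : has_sup A by split=> //; exists (cmod (z0 - c)), z0.
set S := sup A.
pose Phi (e : R) (w : C) := J w /\ S - e < cmod (w - c).
have ne e : 0 < e -> exists w, Phi e w.
  by move=> e0; have [t [z Jz ->] h] := sup_adherent e0 supA; exists z.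
have mono e e' w : e <= e' -> Phi e w -> Phi e' w.
  by move=> h [? h1]; split=> //; lra.
(* Real parts cluster first; imaginary parts are then clustered along the refined family [Psi],
   which gives a limit point of a maximising family. *)
have [x hx] := cluster_value ne mono (fun e w hw => le_trans (Re_le_cmod w) (bd _ hw.1)).
pose Psi e w := Phi e w /\ `|re w - x| < e.
have mono' e e' w : e <= e' -> Psi e w -> Psi e' w.
  by move=> h [h1 h2]; split; [apply: mono h h1 | lra].
have [y hy] := cluster_value hx mono' (fun e w hw => le_trans (Im_le_cmod w) (bd _ hw.1.1)).
pose w := Complex x y.
have near e : 0 < e -> exists2 v, Phi e v & cmod (v - w) < e.
  move=> e0; have [v [[hv h1] h2]] := hy (e / 2) ltac:(lra).
  exists v; first by apply: mono hv; lra.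
  apply: le_lt_trans (cmod_le_ReIm _) _; rewrite !ReImE /=; lra.
exists w; first by apply: cl => e /near[v [Jv _] h]; exists v.
move=> z Jz; have h1 : cmod (z - c) <= S by apply: ub_le_sup => //; exists z.
rewrite leNgt; apply/negP => h.
have [v [_ h2] h3] := near ((S - cmod (w - c)) / 2) ltac:(lra).
have := cmod_tri w v c; lra.
Qed.

(** Expanding the sum of |F r - x|^2 and inserting the mean gives the sum of |F r|^2 - |x|^2, which
    is at most 0. *)
Lemma equal_of_mean (s : seq C) (F : C -> C) (x : C) :
  \sum_(r <- s) F r = (size s)%:R * x ->
  (forall r, r \in s -> cmod (F r) <= cmod x) -> forall r, r \in s -> F r = x.
Proof.
move=> hs hF r rs.
have h0 : \sum_(t <- s) cmod (F t - x) ^+ 2 <= 0.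
  have e1 : \sum_(t <- s) re (F t * conjc x) = (size s)%:R * cmod x ^+ 2.
    have -> : \sum_(t <- s) re (F t * conjc x) = re ((\sum_(t <- s) F t) * conjc x).
      rewrite mulr_suml; elim: (s) => [|a l IH]; rewrite ?big_nil // !big_cons IH reD //.
    rewrite hs -mulrA reM cmod_sq !ReImE.
    have -> : re (size s)%:R = (size s)%:R :> R by rewrite -(rmorph_nat (real_complex R)).
    have -> : im (size s)%:R = 0 :> R by rewrite -(rmorph_nat (real_complex R)).
    ring.
  have e2 t : cmod (F t - x) ^+ 2 =
      cmod (F t) ^+ 2 - 2 * re (F t * conjc x) + cmod x ^+ 2.
    by rewrite !cmod_sq !ReImE; ring.
  under eq_bigr do rewrite e2.
  rewrite mulr_natl in e1.
  rewrite big_split sumrB /= -mulr_sumr e1 big_const_seq count_predT iter_addr_0.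
  have : \sum_(t <- s) cmod (F t) ^+ 2 <= \sum_(t <- s) cmod x ^+ 2.
    rewrite big_seq [leRHS]big_seq; apply: ler_sum => t /hF ht.
    by rewrite lerXn2r ?nnegrE ?cmod_ge0.
  rewrite big_const_seq count_predT iter_addr_0.
  by move: (cmod x ^+ 2 *+ size s) => k; lra.
have : cmod (F r - x) ^+ 2 <= 0.
  apply: le_trans h0; rewrite (big_rem r) //= lerDl sumr_ge0 // => *.
  exact: sqr_ge0.
move=> h; apply/eqP; rewrite -subr_eq0 -cmod_eq0 -sqrf_eq0.
by rewrite eq_le h sqr_ge0.
Qed.
End BoundedSets.

(** * Affine symmetries of a bounded completely invariant set *)

Section PolynomialRigidity.
Variable R : realType.
Local Notation C := R[i].
Implicit Types (z w : C).

Lemma comp_isom_size (P : {poly C}) (a b : C) d : P \is monic -> size P = d.+2 ->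
  a != 0 -> (size (P \Po (a *: 'X + b%:P) - a ^+ d.+1 *: P)%R <= d.+1)%N.
Proof.
move=> mP sP a0; set q := a *: 'X + b%:P.
have q1 : lead_coef q = a.
  by rewrite lead_coefDl ?lead_coefZ ?lead_coefX ?mulr1 // size_scale // size_polyX
    ltnS size_polyC_leq1.
have sq : size q = 2.
  by rewrite size_polyDl size_scale ?size_polyX // ltnS size_polyC_leq1.
have sc : size (P \Po q) = d.+2 by rewrite size_comp_poly2 ?sP.
apply/leq_sizeP => j; rewrite leq_eqVlt => /orP[/eqP<-|hj].
  rewrite coefB coefZ.
  have -> : P`_d.+1 = 1 by have := monicP mP; rewrite lead_coefE sP.
  have -> : (P \Po q)`_d.+1 = a ^+ d.+1.
    have := lead_coef_comp P (_ : 1 < size q)%N; rewrite sq => /(_ isT).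
    by rewrite q1 (monicP mP) mul1r lead_coefE sc sP.
  by rewrite mulr1 subrr.
by rewrite coefB coefZ !nth_default ?mulr0 ?subr0 // ?sc ?sP.
Qed.

(* If P^-1(J) = J, averaging P(a r + b) over the fibre of w gives
   a^d w + k in the convex hull of J; at a point w of J farthest from the
   centre of w |-> a^d w + k strict convexity makes the average constant. *)
Lemma julia_rigidity (P : {poly C}) (J : C -> Prop) (M : R) (a b : C) d :
  P \is monic -> size P = d.+2 -> (forall z, J z <-> J P.[z]) ->
  cclosed J -> (forall z, J z -> cmod z <= M) ->
  (exists z1 z2, [/\ J z1, J z2 & z1 != z2]) ->
  cmod a = 1 -> (forall z, J z -> J (a * z + b)) ->
  exists k, forall z, P.[a * z + b] = a ^+ d.+1 * P.[z] + k.
Proof.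
move=> mP sP inv cl bd [z1 [z2 [Jz1 Jz2 z12]]] a1 sig.
have a0 : a != 0 by rewrite -cmod_gt0 a1.
set E := P \Po (a *: 'X + b%:P) - a ^+ d.+1 *: P.
have EE z : E.[z] = P.[a * z + b] - a ^+ d.+1 * P.[z].
  by rewrite /E !hornerE horner_comp !hornerE.
have sE : (size E <= d.+1)%N by apply: comp_isom_size.
have [K hK] := fibre_sum_constant mP sP sE.
pose k := K / d.+1%:R; pose A := a ^+ d.+1; pose tau w := A * w + k.
have dn0 : d.+1%:R != 0 :> C by rewrite pnatr_eq0.
have A1 : cmod A = 1 by rewrite cmodX a1 expr1n.
have fib w : exists s, [/\ size s = d.+1, (forall r, (r \in s) <-> P.[r] = w) &
    \sum_(r <- s) P.[a * r + b] = (size s)%:R * tau w].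
  have [mw sw] := fibre_shift w mP sP.
  have [s es] := monic_factor mw.
  have ss : size s = d.+1 by have := size_prod_XsubC s id; rewrite -es sw => -[].
  have rs r : (r \in s) <-> P.[r] = w.
    rewrite -root_prod_XsubC -es rootE !hornerE subr_eq0; split; first by move/eqP.
    by move->.
  exists s; split=> //.
  have -> : \sum_(r <- s) P.[a * r + b] = \sum_(r <- s) (E.[r] + A * w).
    by apply: eq_big_seq => r /rs hr; rewrite EE hr subrK.
  rewrite big_split /= (hK w s es) big_const_seq count_predT iter_addr_0 ss /tau /k.
  by rewrite -[_ *+ _]mulr_natl mulrDr [_ * (K / _)]mulrC divfK // addrC.
have Jimg w r : J w -> P.[r] = w -> J P.[a * r + b].
  by move=> Jw e; apply: (inv _).1; apply: sig; apply: (inv _).2; rewrite e.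
(* Here [tau] is the translation by k. For w whose value re (w conj k) is within |k|^2 of the
   supremum over J, the mean [tau w] of points of J would exceed that supremum. *)
have Ak : A = 1 -> k = 0.
  move=> Ae; apply/eqP; rewrite -cmod_eq0 -sqrf_eq0; apply/eqP.
  pose T : set R := fun t => exists2 z, J z & t = re (z * conjc k).
  have ubT : has_ubound T.
    exists (M * cmod k) => t [z Jz ->].
    apply: le_trans (ler_norm _) _; apply: le_trans (Re_le_cmod _) _.
    by rewrite cmodM cmodJ ler_wpM2r ?cmod_ge0 ?bd.
  have supT : has_sup T by split=> //; exists (re (z1 * conjc k)), z1.
  apply/eqP; rewrite eq_le sqr_ge0 andbT leNgt; apply/negP => kp.
  have [t [w Jw ->] hw] := sup_adherent kp supT.
  have [s [ss rs hs]] := fib w.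
  have h1 r : r \in s -> re (P.[a * r + b] * conjc k) <= sup T.
    move=> /rs hr; apply: ub_le_sup => //; exists P.[a * r + b] => //.
    exact: Jimg hr.
  have h2 : \sum_(r <- s) re (P.[a * r + b] * conjc k) <= \sum_(r <- s) sup T.
    by rewrite big_seq [leRHS]big_seq; apply: ler_sum => r /h1.
  have e : \sum_(r <- s) re (P.[a * r + b] * conjc k) = re ((size s)%:R * tau w * conjc k).
    by rewrite -hs mulr_suml; elim: (s) => [|x l IH]; rewrite ?big_nil // !big_cons IH reD.
  rewrite e big_const_seq count_predT iter_addr_0 ss in h2.
  have e3 : re (d.+1%:R * tau w * conjc k) =
     (re (w * conjc k) + cmod k ^+ 2) *+ d.+1.
    rewrite mulr_natl mulrnAl /tau Ae mul1r mulrDl.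
    have -> : k * conjc k = ((cmod k ^+ 2)%:C)%C := mulJ_cmod k.
    by elim: d.+1 => [//|i IH]; rewrite !mulrS reD IH reD.
  rewrite e3 lerMn2r /= in h2.
  by move: hw; rewrite ltrBlDr ltNge h2.
have far c : (forall w, tau w - c = A * (w - c)) -> exists w, [/\ J w, J (tau w),
    (forall y, J y -> cmod (y - c) <= cmod (w - c)) &
    forall r, P.[r] = w -> P.[a * r + b] = tau w].
  move=> ctau.
  have [w Jw hw] := farthest_point c (ex_intro _ z1 Jz1) cl bd.
  have [s [ss rs hs]] := fib w.
  have h r : P.[r] = w -> P.[a * r + b] = tau w.
    move=> /rs r_s; apply/eqP; rewrite -(inj_eq (addIr (- c))); apply/eqP.
    apply: (equal_of_mean (s := s) (F := fun r => P.[a * r + b] - c)) => //.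
      rewrite sumrB hs big_const_seq count_predT iter_addr_0 mulrBr.
      by rewrite [_ * c]mulr_natl.
    move=> r' /rs r's; rewrite ctau cmodM A1 mul1r; apply: hw.
    exact: Jimg r's.
  exists w; split=> //.
  have : (0 < size s)%N by rewrite ss.
  case: s {hs ss} rs => // r s rs _.
  have hr : P.[r] = w by apply/rs; rewrite mem_head.
  by rewrite -(h r hr); apply: Jimg hr.
(* If A = 1, every centre is fixed by [tau]: w2 is taken farthest from w1. If A <> 1, the centre is
   the fixed point k/(1 - A), and [tau w1] is as far from it as w1. *)
have [w1 [w2 [w12 f1 f2]]] : exists w1 w2, [/\ w1 != w2,
    (forall r, P.[r] = w1 -> P.[a * r + b] = tau w1) &
    (forall r, P.[r] = w2 -> P.[a * r + b] = tau w2)].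
  case: (eqVneq A 1) => [Ae|An].
    have k0 := Ak Ae.
    have ct c w : tau w - c = A * (w - c) by rewrite /tau Ae k0; ring.
    have [w1 [Jw1 _ _ f1]] := far 0 (ct 0).
    have [w2 [Jw2 _ h2 f2]] := far w1 (ct w1).
    exists w1, w2; split=> //; apply/eqP => e.
    have h z : J z -> z = w1.
      by move=> /h2; rewrite -e subrr cmod0 => /cmod_le0 /eqP; rewrite subr_eq0 => /eqP.
    by move/eqP: z12; rewrite (h z1) // (h z2).
  have An' : 1 - A != 0 by rewrite subr_eq0 eq_sym.
  pose c := k / (1 - A).
  have ct w : tau w - c = A * (w - c) by rewrite /tau /c; field.
  have [w1 [Jw1 Jt h1 f1]] := far c ct.
  exists w1, (tau w1); split=> //.
    apply/eqP => e; have := ct w1; rewrite -e => e2.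
    have e3 : (1 - A) * (w1 - c) = 0 by rewrite mulrBl mul1r {1}e2 subrr.
    have e4 : w1 - c = 0.
      by apply/eqP; move/eqP: e3; rewrite mulf_eq0 (negPf An').
    have h z : J z -> z = c.
      by move=> /h1; rewrite e4 cmod0 => /cmod_le0 /eqP; rewrite subr_eq0 => /eqP.
    by move/eqP: z12; rewrite (h z1) // (h z2).
  have [s [ss rs hs]] := fib (tau w1).
  move=> r /rs r_s; apply/eqP; rewrite -(inj_eq (addIr (- c))); apply/eqP.
  apply: (equal_of_mean (s := s) (F := fun r => P.[a * r + b] - c)) => //.
    rewrite sumrB hs big_const_seq count_predT iter_addr_0 mulrBr.
    by rewrite [_ * c]mulr_natl.
  move=> r' /rs r's; rewrite ct cmodM A1 mul1r ct cmodM A1 mul1r.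
  by apply: h1; apply: Jimg Jt r's.
pose G := E - k%:P.
have van w : (forall r, P.[r] = w -> P.[a * r + b] = tau w) -> P - w%:P %| G * P^`().
  move=> hw; have [mw sw] := fibre_shift w mP sP.
  have := @dvdp_deriv _ (P - w%:P) G mw; rewrite derivB derivC subr0; apply => z.
  rewrite hornerD hornerN hornerC => /eqP; rewrite subr_eq0 => /eqP hz.
  by rewrite /G hornerD hornerN hornerC EE hw // hz /tau [A * w + k]addrC addrK subrr.
(* (P - w1)(P - w2) has degree 2d + 2, while G P' has degree at most 2d. *)
have G0 : G = 0.
  apply/eqP; apply: contraT => Gn.
  have [m1 s1] := fibre_shift w1 mP sP; have [m2 s2] := fibre_shift w2 mP sP.
  have cop : coprimep (P - w1%:P) (P - w2%:P).
    apply/Pdiv.ClosedField.coprimepP => z; rewrite rootE !hornerE subr_eq0 => /eqP ->.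
    by rewrite subr_eq0.
  have dv : (P - w1%:P) * (P - w2%:P) %| G * P^`() by rewrite Gauss_dvdp // !van.
  have sd := size_deriv_monic sP.
  have d0 : P^`() != 0 by rewrite -size_poly_gt0 sd.
  have := dvdp_leq (mulf_neq0 Gn d0) dv.
  rewrite size_monicM // -?size_poly_gt0 ?s2 // s1 => /leq_trans /(_ (size_polyMleq _ _)).
  rewrite sd.
  have sG : (size G <= d.+1)%N.
    apply: leq_trans (size_polyD _ _) _; rewrite geq_max sE size_polyN /=.
    exact: leq_trans (size_polyC_leq1 _) _.
  rewrite !addnS !addSn /= => h.
  have := leq_trans h (leq_add sG (leqnn d)).
  by rewrite addSn ltnNge ltnW // ltnS.
exists k => z; have : G.[z] = 0 by rewrite G0 horner0.
rewrite /G hornerD hornerN hornerC EE => /eqP; rewrite subr_eq0 subr_eq addrC => /eqP ->.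
by rewrite addrC.
Qed.

End PolynomialRigidity.

(** * Symmetries of the Julia set of the polynomial *)

Arguments ratmap : simpl never.
Arguments polymap : simpl never.
Arguments relaxed_newton : simpl never.

Section Symmetries.
Variable R : realType.
Local Notation C := R[i].
Local Notation sphere := (sphere R).
Implicit Types (z w a b : C) (f : sphere -> sphere).

Lemma symgroup_elim f a b : symgroup f (a, b) ->
  cmod a = 1 /\ forall z, julia f (Some z) <-> julia f (Some (a * z + b)).
Proof.
move=> [/= a1 h]; split=> // z; split=> [Jz|/h[[w|] //= Jw [e]]].
  by apply/h; exists (Some z).
have a0 : a != 0 by rewrite -cmod_gt0 a1.
by have <- : w = z by apply: (mulfI a0); apply: (addIr b).
Qed.

Lemma symgroup_intro f a b : cmod a = 1 ->
  (forall z, julia f (Some z) <-> julia f (Some (a * z + b))) -> symgroup f (a, b).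
Proof.
move=> a1 h; split=> //= -[w|]; split.
- have a0 : a != 0 by rewrite -cmod_gt0 a1.
  have e : a * ((w - b) / a) + b = w by field.
  by move=> Jw; exists (Some ((w - b) / a)); rewrite /= ?e //; apply: (h _).2; rewrite e.
- by move=> [[z|] Jz //= [<-]]; apply: (h z).1.
- by move=> Jn; exists None.
- by move=> [[z|] //=].
Qed.

Lemma unity_root_cmod a n : (0 < n)%N -> a ^+ n = 1 -> cmod a = 1.
Proof.
move=> n0 e; have : cmod a ^+ n = 1 by rewrite -cmodX e cmod1.
by move/eqP; rewrite pexpr_eq1 ?cmod_ge0 // => /eqP.
Qed.

(** Separability gives n distinct roots of X^n - 1, and only 1 and -1 among them can be real. *)
Lemma unity_root_exists n : (2 <= n)%N -> exists w : C,
  [/\ w ^+ n = 1, w != 1 & (3 <= n)%N -> im w != 0].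
Proof.
move=> n2; have n0 : (n%:R : C) != 0 by rewrite pnatr_eq0 -lt0n; case: (n) n2.
have sep : separable_poly ('X^n - 1 : {poly C}).
  by rewrite separable_Xn_sub_1.
have [s es] := closed_field_poly_normal ('X^n - 1 : {poly C}).
have np : (0 < n)%N by apply: leq_trans n2.
rewrite lead_coefXnsubC // scale1r in es.
have us : uniq s by rewrite -separable_prod_XsubC -es.
have ss : size s = n.
  by have := size_prod_XsubC s id; rewrite -es size_XnsubC // => -[].
have rs w : w \in s -> w ^+ n = 1.
  by rewrite -root_prod_XsubC -es rootE !hornerE subr_eq0 => /eqP.
have mem_real w : w ^+ n = 1 -> im w = 0 -> w \in [:: 1; -1].
  move=> wn w0; have := unity_root_cmod np wn => w1.
  have : re w ^+ 2 == 1 by have := cmod_sq w; rewrite w1 w0 expr1n expr0n addr0 => <-.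
  rewrite -subr_eq0 -(expr1n _ 2) subr_sqr mulf_eq0 subr_eq0 addr_eq0 !inE.
  move=> /orP[] /eqP e; apply/orP; [left|right]; apply/eqP; apply: complex_eq;
    by rewrite ?ReImE ?e ?w0 /= ?oppr0.
apply: contrapT => hn.
case: (leqP 3 n) => n3.
  have sub : {subset s <= [:: 1; -1]}.
    move=> w /rs wn; apply: mem_real => //; apply/eqP; apply: contraT => wi.
    exfalso; apply: hn; exists w; split=> //; apply: contra wi => /eqP ->.
    by rewrite /= eqxx.
  by have := uniq_leq_size us sub; rewrite ss /= leqNgt n3.
have sub : {subset s <= [:: 1]}.
  move=> w /rs wn; rewrite inE; apply: contraT => w1.
  by exfalso; apply: hn; exists w; split=> //; rewrite leqNgt n3.
by have := uniq_leq_size us sub; rewrite ss /= leqNgt n2.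
Qed.

Lemma chord_rot a (x y : sphere) : cmod a = 1 ->
  chord (isom a 0 x) (isom a 0 y) = chord x y.
Proof.
move=> a1; rewrite /chord; case: x y => [z|] [w|] //=; rewrite ?addr0 ?cmodM ?a1 ?mul1r //.
by rewrite -mulrBr cmodM a1 mul1r.
Qed.

Lemma isom_rotK a (x : sphere) : a != 0 -> isom a 0 (isom a^-1 0 x) = x.
Proof. by move=> a0; case: x => [z|] //=; rewrite !addr0 mulVKf. Qed.

(** Exponents of a modulo n form the finite index type that [fatou_symmetry] asks for. The map [t]
    records how f changes the exponent: j becomes j m for the polynomial, and stays j for the Newton
    map. *)
Lemma fatou_rotations f a n (t : nat -> nat) : (0 < n)%N -> a ^+ n = 1 ->
  (forall j x, f (isom (a ^+ j) 0 x) = isom (a ^+ t j) 0 (f x)) ->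
  forall z, julia f (Some z) <-> julia f (Some (a * z)).
Proof.
move=> n0 an fS.
have hr j x : fatou f x -> fatou f (isom (a ^+ j) 0 x).
  pose S (i : 'I_n) := @isom R (a ^+ i) 0.
  pose T (i : 'I_n) := @isom R (a ^+ i)^-1 0.
  pose u (i : 'I_n) : 'I_n := Ordinal (ltn_pmod (t i) n0).
  have ai i : cmod (a ^+ i) = 1 by rewrite cmodX (unity_root_cmod n0 an) expr1n.
  have := @fatou_symmetry R 'I_n S T u f _ _ _ (Ordinal (ltn_pmod j n0)) x.
  rewrite /S /= -[in X in _ -> X](expr_mod j an); apply.
  - by move=> i y y'; apply: chord_rot.
  - by move=> i y; rewrite /T isom_rotK // -cmod_gt0 ai.
  - by move=> i y; rewrite fS /= expr_mod.
move=> z; rewrite /julia; split=> h1 h2; apply: h1.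
  have := hr n.-1 _ h2; rewrite /= addr0 mulrA -exprSr prednK // an mul1r //.
by have := hr 1%N _ h2; rewrite /= addr0 expr1.
Qed.

(** The commutator of z |-> a z + b with the rotation by w has linear part 1, so it is a
    translation. *)
Lemma commutator_translation (J : C -> Prop) a b w : a != 0 -> w != 0 ->
  (forall z, J z <-> J (a * z + b)) -> (forall z, J z <-> J (w * z)) ->
  forall z, J z <-> J (z + (1 - w) * b).
Proof.
move=> a0 w0 ha hw z; pose u := (w^-1 * z - b) / a.
rewrite -[X in J X <-> _](mulVKf w0 z) -hw.
have -> : w^-1 * z = a * u + b by rewrite /u; field; rewrite a0.
rewrite -ha hw ha; have -> // : a * (w * u) + b = z + (1 - w) * b.
by rewrite /u; field; rewrite a0 w0.
Qed.

End Symmetries.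

Section PolynomialSymmetries.
Variable R : realType.
Local Notation C := R[i].
Variables (m n : nat).
Hypothesis n2 : (2 <= n)%N.
Local Notation p := (pmn R m n).
Local Notation f := (polymap p).
Local Notation J := (fun z : C => julia f (Some z)).

Lemma n_gt0 : (0 < n)%N. Proof. exact: leq_trans n2. Qed.

Lemma pmnE (z : C) : p.[z] = z ^+ m * (z ^+ n - 1).
Proof. by rewrite /pmn !hornerE. Qed.

Lemma pmn_size_monic : size p = (m + n).-1.+2 /\ p \is monic.
Proof.
have mq : ('X^n - 1 : {poly C}) \is monic by rewrite monicXnsubC // n_gt0.
split; last by rewrite /pmn monicMl ?monicXn.
rewrite /pmn size_monicM ?monicXn //; last exact: monic_neq0.
rewrite size_polyXn size_XnsubC ?n_gt0 // addSn addnS /=.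
by rewrite prednK // addn_gt0 n_gt0 orbT.
Qed.

Lemma polymap_form : ratform f p 1.
Proof.
have [sp mp] := pmn_size_monic.
apply: ratform_ratmap; rewrite ?oner_eq0 // ?size_poly1 ?sp //.
by move=> z /eqP; rewrite hornerC oner_eq0.
Qed.

Lemma polymap_Some z : f (Some z) = Some p.[z].
Proof.
have [_ _ _ -> _] := polymap_form.
by rewrite hornerC oner_eq0 divr1.
Qed.

Lemma polymap_escape z : 3 <= cmod z -> 2 * cmod z <= cmod p.[z].
Proof.
move=> z3; rewrite pmnE cmodM cmodX.
have h1 : 1 <= cmod z ^+ m by rewrite exprn_ege1 //; lra.
have h2 : cmod z ^+ 2 <= cmod z ^+ n by rewrite ler_weXn2l //; lra.
have h3 := cmod_sub_ge (z ^+ n) 1; rewrite cmodX cmod1 in h3.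
have h4 : 3 * cmod z <= cmod z ^+ 2 by rewrite expr2 ler_wpM2r // ?cmod_ge0.
rewrite -[leLHS]mul1r ler_pM //; first by rewrite mulr_ge0 ?cmod_ge0.
lra.
Qed.

Lemma polymap_escapes (e : R) : 0 < e -> exists K, forall k, (K <= k)%N ->
  forall z, 3 <= cmod z -> chord None (iter k f (Some z)) < e.
Proof.
move=> e0; have [K hK] := @pow_unbounded R 2 (2 / e) ltac:(lra).
exists K => k Kk z z3.
have [w [-> hw]] : exists w, iter k f (Some z) = Some w /\ 2 ^+ k * 3 <= cmod w.
  elim: k {Kk} => [|k [w [hw1 hw2]]]; first by exists z; rewrite expr0; split=> //; lra.
  exists p.[w]; rewrite iterS hw1 polymap_Some; split=> //.
  have w3 : 3 <= cmod w.
    by apply: le_trans hw2; rewrite ler_peMl // exprn_ege1 // ler1n.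
  by apply: le_trans (polymap_escape w3); rewrite exprS; lra.
apply: chord_None_small => //; apply: lt_le_trans hK _.
have : 2 ^+ K <= 2 ^+ k :> R by rewrite ler_weXn2l // ler1n.
have := exprn_ge0 k (ler0n R 2); lra.
Qed.

Lemma polymap_attracts : exists2 d : R, 0 < d & attracts f None d.
Proof.
have [d d0 hd] := chord_None_near (3 : R); exists d => // e e0.
have [K hK] := polymap_escapes e0.
exists K => k Kk v /hd[->|[z -> hz]]; last by apply: hK; rewrite ?ltW.
have -> : iter k f None = None.
  by elim: k {Kk} => [//|k IH]; rewrite iterS IH; have [_ _ _ _ ->] := polymap_form.
by rewrite chordxx.
Qed.

Lemma polymap_cont x : ccont f x.
Proof. exact: ratform_cont polymap_form x. Qed.

Lemma polymap_basin z : 3 < cmod z -> basin f None (Some z).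
Proof.
by move=> /ltW z3 e /polymap_escapes[K hK]; exists K => k Kk; apply: hK.
Qed.

Lemma polymap_julia_bounded z : J z -> cmod z <= 3.
Proof.
move=> Jz; rewrite leNgt; apply/negP => z3; apply: Jz.
have [d d0 hd] := polymap_attracts.
exact: basin_fatou d0 polymap_cont hd (polymap_basin z3).
Qed.

Lemma julia_closed (g : sphere R -> sphere R) : cclosed (fun z : C => julia g (Some z)).
Proof.
move=> z h /fatou_near[d d0 hd]; have [y Jy hy] := h d d0.
exact: Jy (hd y hy).
Qed.

Lemma polymap_julia_inv z : J z <-> J p.[z].
Proof. exact: ratform_julia polymap_form (polymap_Some z). Qed.

Lemma polymap_rot a : a ^+ n = 1 -> forall z, J z <-> J (a * z).
Proof.
move=> an; apply: (@fatou_rotations _ f a n (fun j => j * m)%N n_gt0 an).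
move=> j [z|] /=; last by have [_ _ _ _ ->] := polymap_form.
rewrite !polymap_Some /= !addr0 !pmnE; congr Some.
rewrite !exprMn -[in LHS](exprM _ j n) [(j * n)%N]mulnC [in LHS]exprM an expr1n mul1r.
by rewrite -exprM mulrA.
Qed.

(** A segment from 4, which escapes, to a fixed point, which does not, must leave the basin of
    infinity at a point of J. *)
Lemma polymap_julia_nonempty : exists z, J z.
Proof.
have [d d0 hd] := polymap_attracts.
have [q hq] : exists q : C, p.[q] = q.
  have [sp mp] := pmn_size_monic.
  have s : size (p - 'X) = (m + n).-1.+2.
    rewrite size_polyDl ?sp // size_polyN size_polyX !ltnS.
    by rewrite -ltnS prednK ?addn_gt0 ?n_gt0 ?orbT // (leq_trans n2) // leq_addl.
  have [q] : exists q, root (p - 'X) q by apply/closed_rootP; rewrite s.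
  by rewrite rootE hornerD hornerN hornerX subr_eq0 => /eqP hq; exists q.
have nq : ~ basin f None (Some q).
  have c0 : 0 < chord None (Some q) by rewrite chord_None_Some divr_gt0 // hnorm_gt0.
  move=> /(_ _ c0)[K /(_ K (leqnn _))].
  have -> : iter K f (Some q) = Some q.
    by elim: K => [//|k IH]; rewrite iterS IH polymap_Some hq.
  by rewrite ltxx.
have b4 : basin f None (Some 4) by apply: polymap_basin; rewrite cmod_nat; lra.
have [t [_ Jt _]] := basin_boundary d0 polymap_cont hd b4 nq.
by exists (segpt 4 q t).
Qed.

Lemma polymap_julia_two : exists z1 z2, [/\ J z1, J z2 & z1 != z2].
Proof.
have [z Jz] := polymap_julia_nonempty.
have [w [wn w1 _]] := @unity_root_exists R n n2.
case: (eqVneq z 0) => [z0|zn].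
  exists 0, 1; rewrite -{1}z0; split=> //; last by rewrite eq_sym oner_eq0.
  by apply/polymap_julia_inv; rewrite pmnE !expr1n subrr mulr0 -z0.
exists z, (w * z); split=> //; first by apply: (polymap_rot wn z).1.
by rewrite -{1}[z]mul1r (inj_eq (mulIf zn)) eq_sym.
Qed.

Lemma polymap_no_translation a b : a != 0 ->
  (forall z, J z <-> J (a * z + b)) -> b = 0.
Proof.
move=> a0 h; have [w [wn w1 _]] := @unity_root_exists R n n2.
have w0 : w != 0 by rewrite -cmod_gt0 (unity_root_cmod n_gt0 wn).
have ht := commutator_translation a0 w0 h (polymap_rot wn).
set be := (1 - w) * b in ht.
apply/eqP; apply: contraT => bn.
have ben : be != 0 by rewrite mulf_neq0 // subr_eq0 eq_sym.
have [z Jz] := polymap_julia_nonempty.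
have Jk k : J (z + k%:R * be).
  elim: k => [|k /ht IH]; first by rewrite mul0r addr0.
  by rewrite -natr1 mulrDl mul1r addrA.
have bp : 0 < cmod be by rewrite cmod_gt0.
have := archi_boundP (divr_ge0 (addr_ge0 (ler0n R 3) (cmod_ge0 z)) (ltW bp)).
set k := Num.bound _; rewrite ltr_pdivrMr // => hk.
have := polymap_julia_bounded (Jk k).
have := cmod_add_ge (k%:R * be) z; rewrite cmodM cmod_nat [z + _]addrC; lra.
Qed.

Lemma polymap_symgroup a b : symgroup f (a, b) <-> a ^+ n = 1 /\ b = 0.
Proof.
split=> [/symgroup_elim[a1 h]|[an ->]]; last first.
  apply: symgroup_intro; first exact: unity_root_cmod n_gt0 an.
  by move=> z; rewrite addr0; apply: polymap_rot.
have a0 : a != 0 by rewrite -cmod_gt0 a1.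
have b0 := polymap_no_translation a0 h; split=> //.
have [sp mp] := pmn_size_monic.
have [k hk] := julia_rigidity mp sp polymap_julia_inv (@julia_closed f)
  polymap_julia_bounded polymap_julia_two a1 (fun z => (h z).1).
rewrite b0 prednK in hk; last by rewrite addn_gt0 n_gt0 orbT.
(* Since p is onto and J is completely invariant, w |-> a^d w + k also preserves J, so it has no
   translation part. *)
have k0 : k = 0.
  apply: (@polymap_no_translation (a ^+ (m + n))); first by rewrite expf_neq0.
  move=> w; have [z ez] : exists z, p.[z] = w.
    have [_ s] := fibre_shift w mp sp.
    have [z] : exists z, root (p - w%:P) z by apply/closed_rootP; rewrite s.
    by rewrite rootE hornerD hornerN hornerC subr_eq0 => /eqP hq; exists z.
  rewrite -ez -hk -!polymap_julia_inv addr0.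
  by have := h z; rewrite b0 addr0.
(* As p(1) = 0, the identity p(a z) = a^d p(z) at z = 1 gives p(a) = 0, hence a^n = 1. *)
have := hk 1; rewrite mulr1 !addr0 !pmnE k0 !expr1n subrr !mulr0 addr0.
by move/eqP; rewrite mulf_eq0 expf_eq0 (negPf a0) andbF subr_eq0 => /eqP.
Qed.

End PolynomialSymmetries.

(** * A maximum principle for uniform limits of polynomials *)

Section PolynomialApproximation.
Variable R : realType.
Local Notation C := R[i].
Variable rho : R.
Hypothesis rho0 : 0 < rho.
Implicit Types (F G : C -> C) (P Q : {poly C}).

(** Uniform limits of polynomials on the closed disc of radius rho. They play the part of
    holomorphic functions: the class is stable under sums, products, polynomials, and inverses of
    functions bounded away from 0. *)
Definition papprox F := forall e : R, 0 < e -> exists P,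
  forall z, cmod z <= rho -> cmod (F z - P.[z]) <= e.

Lemma papprox_poly P : papprox (fun z => P.[z]).
Proof. by move=> e e0; exists P => z _; rewrite subrr cmod0 ltW. Qed.

Lemma papprox_ext F G : (forall z, cmod z <= rho -> F z = G z) -> papprox F -> papprox G.
Proof.
move=> eFG hF e /hF[P hP]; exists P => z hz; rewrite -eFG //; exact: hP.
Qed.

Lemma papprox_bounded F : papprox F ->
  exists2 K : R, 0 < K & forall z, cmod z <= rho -> cmod (F z) <= K.
Proof.
move=> /(_ 1 ltr01)[P hP]; have [K K0 hK] := poly_bounded P rho.
exists (K + 1) => [|z hz]; first by rewrite addr_gt0.
have := cmodD (F z - P.[z]) P.[z]; rewrite subrK.
have := hP z hz; have := hK z hz; lra.
Qed.

Lemma papprox_add F G : papprox F -> papprox G -> papprox (fun z => F z + G z).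
Proof.
move=> hF hG e e0; have e2 : 0 < e / 2 by rewrite divr_gt0.
have [P hP] := hF _ e2; have [Q hQ] := hG _ e2.
exists (P + Q) => z hz; rewrite hornerD.
have -> : F z + G z - (P.[z] + Q.[z]) = (F z - P.[z]) + (G z - Q.[z]) by ring.
apply: le_trans (cmodD _ _) _; have := hP z hz; have := hQ z hz; lra.
Qed.

Lemma papprox_mul F G : papprox F -> papprox G -> papprox (fun z => F z * G z).
Proof.
move=> hF hG e e0.
have [K K0 hK] := papprox_bounded hF; have [L L0 hL] := papprox_bounded hG.
have e2 : 0 < e / (2 * L) by rewrite divr_gt0 // mulr_gt0.
have [P hP] := hF (Num.min 1 (e / (2 * L))) ltac:(by rewrite lt_min ltr01).
have [Q hQ] := hG (e / (2 * (K + 1))) ltac:(by rewrite divr_gt0 // mulr_gt0 // addr_gt0).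
exists (P * Q) => z hz; rewrite hornerM.
have -> : F z * G z - P.[z] * Q.[z] = (F z - P.[z]) * G z + P.[z] * (G z - Q.[z]) by ring.
apply: le_trans (cmodD _ _) _; rewrite !cmodM.
have := hP z hz; rewrite le_min => /andP[p1 p2].
have bP : cmod P.[z] <= K + 1.
  have := cmodB (F z) (F z - P.[z]); have -> : F z - (F z - P.[z]) = P.[z] by ring.
  have := hK z hz; lra.
have a1 : cmod (F z - P.[z]) * cmod (G z) <= e / (2 * L) * L.
  by rewrite ler_pM ?cmod_ge0 ?hL.
have a2 : cmod P.[z] * cmod (G z - Q.[z]) <= (K + 1) * (e / (2 * (K + 1))).
  by rewrite ler_pM ?cmod_ge0 ?hQ.
have -> : e = e / (2 * L) * L + (K + 1) * (e / (2 * (K + 1))).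
  by field; rewrite (gt_eqF L0) gt_eqF // addr_gt0.
by rewrite lerD.
Qed.

Lemma papprox_comp Q F : papprox F -> papprox (fun z => Q.[F z]).
Proof.
move=> hF; elim/poly_ind: Q => [|Q c IH].
  by apply: papprox_ext (papprox_poly 0) => z _; rewrite !horner0.
apply: (@papprox_ext (fun z => Q.[F z] * F z + c%:P.[z])).
  by move=> z _; rewrite hornerMXaddC hornerC.
by apply: papprox_add (papprox_poly _); apply: papprox_mul.
Qed.

Lemma papprox_inv_linear (r : C) : rho < cmod r -> papprox (fun z => (z - r)^-1).
Proof.
move=> hr e e0.
have r0 : r != 0 by rewrite -cmod_gt0; apply: lt_trans hr.
have rp : 0 < cmod r by rewrite cmod_gt0.
have x1 : 0 <= rho / cmod r < 1.
  by rewrite divr_ge0 ?ltW //= ltr_pdivrMr // mul1r.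
have rr : 0 < cmod r - rho by rewrite subr_gt0.
have [K /(_ K (leqnn K)) hK] := pow_small x1 (mulr_gt0 e0 rr).
exists (- r^-1 *: \sum_(i < K) (r^-1 *: 'X) ^+ i) => z hz.
have zr : z - r != 0.
  rewrite subr_eq0; apply/eqP => zr; move: hz; rewrite zr; lra.
have -> : (z - r)^-1 - (- r^-1 *: \sum_(i < K) (r^-1 *: 'X) ^+ i).[z] =
    (z / r) ^+ K / (z - r).
  rewrite hornerZ horner_sum.
  under eq_bigr do rewrite horner_exp hornerZ hornerX.
  have := subrX1 (r^-1 * z) K.
  set S := \sum_(i < K) _ => eS.
  have -> : z / r = r^-1 * z by rewrite mulrC.
  have -> : (r^-1 * z) ^+ K = 1 + (r^-1 * z - 1) * S by rewrite -eS addrC subrK.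
  by field; rewrite r0 zr.
rewrite cmod_div cmodX cmod_div.
have zrp : cmod r - rho <= cmod (z - r).
  by rewrite cmodBC; have := cmod_sub_ge r z; lra.
rewrite ler_pdivrMr ?cmod_gt0 //.
apply: le_trans (_ : (rho / cmod r) ^+ K <= _).
  by rewrite lerXn2r ?nnegrE ?divr_ge0 ?cmod_ge0 ?(ltW rho0) // ler_pM2r ?invr_gt0.
apply: le_trans (ltW hK) _.
by rewrite ler_pM2l.
Qed.

Lemma papprox_inv_poly P : (forall z, cmod z <= rho -> P.[z] != 0) ->
  papprox (fun z => P.[z]^-1).
Proof.
move=> hP; have P0 : P != 0.
  apply/eqP => e; have := hP 0; rewrite cmod0 e horner0 eqxx => /(_ (ltW rho0)) //.
have [s [_ rs vP]] := poly_factor P0.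
have hs r : r \in s -> rho < cmod r.
  move=> /rs /eqP Pr; rewrite ltNge; apply/negP => /hP; by rewrite Pr eqxx.
apply: (@papprox_ext (fun z => (lead_coef P)^-1%:P.[z] * \prod_(r <- s) (z - r)^-1)).
  by move=> z _; rewrite hornerC vP prodfV invfM.
apply: papprox_mul; first exact: papprox_poly.
elim: s hs {rs vP} => [|r s IH] hs.
  by apply: papprox_ext (papprox_poly 1) => z _; rewrite big_nil hornerC.
apply: (@papprox_ext (fun z => (z - r)^-1 * \prod_(r <- s) (z - r)^-1)).
  by move=> z _; rewrite big_cons.
apply: papprox_mul; first by apply: papprox_inv_linear; rewrite hs ?mem_head.
by apply: IH => t ts; apply: hs; rewrite inE ts orbT.
Qed.

Lemma papprox_inv F (dl : R) : 0 < dl -> papprox F ->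
  (forall z, cmod z <= rho -> dl <= cmod (F z)) -> papprox (fun z => (F z)^-1).
Proof.
move=> dl0 hF hd e e0.
pose e' := Num.min (dl / 2) (e * dl ^+ 2 / 4).
have e'0 : 0 < e' by rewrite lt_min !divr_gt0 ?mulr_gt0 ?exprn_gt0.
have [P hP] := hF _ e'0.
have bP z : cmod z <= rho -> dl / 2 <= cmod P.[z].
  move=> hz; have := hP z hz; rewrite le_min => /andP[p1 _].
  have := cmod_sub_ge (F z) (F z - P.[z]); have -> : F z - (F z - P.[z]) = P.[z] by ring.
  have := hd z hz; lra.
have nP z : cmod z <= rho -> P.[z] != 0.
  by move=> /bP hz; rewrite -cmod_gt0; lra.
have [Q hQ] := papprox_inv_poly nP (divr_gt0 e0 (ltr0n R 2)).
exists Q => z hz; apply: le_trans (cmod_tri P.[z]^-1 _ _) _.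
have nF : F z != 0 by rewrite -cmod_gt0; apply: lt_le_trans (hd z hz).
have -> : (F z)^-1 - P.[z]^-1 = - (F z - P.[z]) / (F z * P.[z]).
  by field; rewrite nF nP.
rewrite cmod_div cmodN cmodM.
have a1 : cmod (F z - P.[z]) / (cmod (F z) * cmod P.[z]) <= e / 2.
  have b1 := hd z hz; have b2 := bP z hz.
  rewrite ler_pdivrMr; last by rewrite mulr_gt0 //; lra.
  have := hP z hz; rewrite le_min => /andP[_ p2]; apply: le_trans p2 _.
  have : dl * (dl / 2) <= cmod (F z) * cmod P.[z] by rewrite ler_pM //; lra.
  move=> b3; have := ler_wpM2l (ltW e0) b3; rewrite expr2; lra.
have := hQ z hz; lra.
Qed.

(* The mean of P over the fibre of 'X^L above rho^L is P(0), because it is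
   the same as the mean over the fibre above 0. *)
Lemma poly_max_principle P (M : R) : (forall z, cmod z = rho -> cmod P.[z] <= M) ->
  cmod P.[0] <= M.
Proof.
move=> hM; pose L := (size P).+1.
have sX : size ('X^L : {poly C}) = (size P).+2 by rewrite size_polyXn.
have mX : ('X^L : {poly C}) \is monic := monicXn _ _.
have [k hk] := fibre_sum_constant mX sX (leqnSn (size P)).
have e0 : L%:R * P.[0] = k.
  rewrite -(hk 0 (nseq L 0)).
    by rewrite big_nseq iter_addr_0 mulr_natl.
  by rewrite big_nseq !polyC0 !subr0 iter_mulr_1.
pose w : C := (rho%:C)%C ^+ L.
have [mw sw] := fibre_shift w mX sX.
have [s es] := monic_factor mw.
have ss : size s = L by have := size_prod_XsubC s id; rewrite -es sw => -[].
have rs r : r \in s -> cmod r = rho.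
  rewrite -root_prod_XsubC -es rootE hornerD hornerN hornerC hornerXn subr_eq0 => /eqP e.
  have : cmod r ^+ L == rho ^+ L.
    by rewrite -cmodX e /w cmodX cmod_real gtr0_norm.
  by rewrite eqrXn2 ?cmod_ge0 ?(ltW rho0) // => /eqP.
have := hk w s es; rewrite -e0 => e1.
have : cmod (L%:R * P.[0]) <= M *+ L.
  rewrite -e1; apply: le_trans (cmod_sum _ _) _.
  have -> : M *+ L = \sum_(r <- s) M by rewrite big_const_seq count_predT iter_addr_0 ss.
  by rewrite big_seq [leRHS]big_seq; apply: ler_sum => r /rs /hM.
by rewrite cmodM cmod_nat mulr_natl lerMn2r.
Qed.

Lemma papprox_max_principle F (M : R) : papprox F ->
  (forall z, cmod z = rho -> cmod (F z) <= M) -> cmod (F 0) <= M.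
Proof.
move=> hF hM; apply/ler_addgt0Pr => e e0.
have [P hP] := hF _ (divr_gt0 e0 (ltr0n R 2)).
have h1 : cmod P.[0] <= M + e / 2.
  apply: poly_max_principle => z hz.
  have := hP z ltac:(by rewrite hz); have := hM z hz.
  have := cmodB (F z) (F z - P.[z]); have -> : F z - (F z - P.[z]) = P.[z] by ring.
  lra.
have := hP 0; rewrite cmod0 => /(_ (ltW rho0)) h2.
have := cmodD (F 0 - P.[0]) P.[0]; rewrite subrK; lra.
Qed.

End PolynomialApproximation.

(** * The relaxed Newton map *)

Section NewtonMap.
Variable R : realType.
Local Notation C := R[i].
Variables (m n : nat) (h : C).
Hypothesis n2 : (2 <= n)%N.
Hypothesis h1 : cmod (h - 1) < 1.
Local Notation p := (pmn R m n).
Local Notation N := (relaxed_newton h p).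
Local Notation d := ((m + n)%:R : C).
Local Notation J := (fun z : C => julia N (Some z)).
Implicit Types (z w : C).

(** The factor lam of N(z) ~ lam z at infinity, so the multiplier of the fixed point at infinity is
    1/lam. *)
Definition newton_mult : C := 1 - h / d.
Definition newton_den z : C := d * z ^+ n - m%:R.
(** Away from 0, p'(z) = z^(m-1) (d z^n - m), so N(z) = z - h z (z^n - 1) / [newton_den z]. Writing
    z^n - 1 as ([newton_den z] - n)/d separates the linear part from a term of order z^(1-n). *)
Definition newton_val z : C := newton_mult * z + (h * n%:R / d) * (z / newton_den z).

Let n0 : (0 < n)%N := leq_trans (isT : (0 < 2)%N) n2.
Local Ltac isolate := clear -R m n h n2 h1 n0.

Lemma nC_neq0 : (n%:R : C) != 0. Proof. by rewrite pnatr_eq0 -lt0n. Qed.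
Lemma d_neq0 : d != 0. Proof. by rewrite pnatr_eq0 -lt0n addn_gt0 n0 orbT. Qed.

Lemma h_neq0 : h != 0.
Proof. by apply/eqP => e; move: h1; rewrite e sub0r cmodN cmod1 ltxx. Qed.

Lemma cmod_d : cmod d = (m + n)%:R. Proof. exact: cmod_nat. Qed.

Lemma d_ge2 : 2 <= (m + n)%:R :> R.
Proof. by rewrite ler_nat (leq_trans n2) // leq_addl. Qed.

Lemma dlamE : d * newton_mult = d - h.
Proof. by rewrite /newton_mult mulrBr mulr1 mulrC divfK ?d_neq0. Qed.

(** In other words d lam lies in the open unit disc about d - 1 >= 1. That disc misses 0 and stays
    inside radius d, whence 0 < |lam| < 1. *)
Lemma dh_close : cmod (d - h - (d - 1)) < 1.
Proof. by rewrite (_ : _ - _ = - (h - 1)) ?cmodN //; ring. Qed.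

Lemma lam_neq0 : newton_mult != 0.
Proof.
apply/eqP => e; have := dh_close; rewrite -dlamE e mulr0 sub0r cmodN.
have -> : d - 1 = (m + n).-1%:R.
  by rewrite -[in LHS](@prednK (m + n)) ?addn_gt0 ?n0 ?orbT // -natr1 addrK.
have : 1 <= (m + n).-1%:R :> R.
  by rewrite ler1n -subn1 subn_gt0 (leq_trans n2) // leq_addl.
rewrite cmod_nat; lra.
Qed.

Lemma lam_lt1 : cmod newton_mult < 1.
Proof.
have dp : 0 < (m + n)%:R :> R by rewrite (lt_le_trans _ d_ge2).
rewrite -(ltr_pM2l dp) -cmod_d -cmodM dlamE cmod_d mulr1.
have e : d - 1 = (m + n).-1%:R.
  by rewrite -[in LHS](@prednK (m + n)) ?addn_gt0 ?n0 ?orbT // -natr1 addrK.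
have := cmodD (d - h - (d - 1)) (d - 1); rewrite subrK {2}e cmod_nat.
have -> : (m + n)%:R = (m + n).-1%:R + 1 :> R.
  by rewrite natr1 prednK // addn_gt0 n0 orbT.
have := dh_close; lra.
Qed.

Lemma lam_gt0 : 0 < cmod newton_mult. Proof. by rewrite cmod_gt0 lam_neq0. Qed.

Lemma dh_neq0 : d - h != 0.
Proof. by rewrite -dlamE mulf_neq0 ?d_neq0 ?lam_neq0. Qed.

Lemma size_binomial (c e : C) k : (0 < k)%N -> c != 0 -> size (c *: 'X^k + e%:P) = k.+1.
Proof.
move=> k0 c0; rewrite size_polyDl size_scale ?size_polyXn // ltnS.
exact: leq_trans (size_polyC_leq1 _) _.
Qed.

Lemma pmn_deriv : p^`() = (m + n)%:R *: 'X^((m + n).-1) - m%:R *: 'X^(m.-1).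
Proof.
by rewrite /pmn mulrBr mulr1 -exprD derivB !derivXn !scaler_nat.
Qed.

(** For m > 0 the common factor z^(m-1) cancels and the denominator is [newton_den]. For m = 0 it is
    n z^(n-1), one power of z below [newton_den]; since n >= 2 both vanish exactly at 0. *)
Lemma newton_form : exists P Q, ratform N P Q /\
  forall z, Q.[z] != 0 = (newton_den z != 0) /\ (newton_den z != 0 -> P.[z] / Q.[z] = newton_val z).
Proof.
have p'0 : p^`() != 0.
  have [sp _] := @pmn_size_monic R m n n2.
  by rewrite -size_poly_gt0 (size_deriv_monic sp).
case: (posnP m) => [m0|mp].
  pose P : {poly C} := (n%:R - h) *: 'X^n + h%:P; pose Q : {poly C} := n%:R *: 'X^(n.-1).
  have dE : d = n%:R by rewrite m0.
  have nh : n%:R - h != 0 by rewrite -dE dh_neq0.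
  have eQ : p^`() = Q by rewrite pmn_deriv m0 add0n scale0r subr0.
  have eP : 'X * p^`() - h *: p = P.
    rewrite eQ /P /Q /pmn m0 expr0 mul1r -scalerAr -exprS prednK //.
    by rewrite -!mul_polyC polyCB; ring.
  exists P, Q; split.
    apply: ratform_ratmap => //; rewrite ?eP -?eQ //.
    - move=> z; rewrite eQ /Q /P !hornerE => /eqP.
      rewrite mulf_eq0 (negPf nC_neq0) /= expf_eq0 => /andP[_ /eqP ->].
      by rewrite expr0n eqn0Ngt n0 mulr0 add0r h_neq0.
    - rewrite eQ size_scale ?nC_neq0 // size_polyXn prednK // size_binomial //.
  move=> z; rewrite /Q /P !hornerE /newton_val /newton_den /newton_mult dE m0 subr0.
  rewrite !mulf_eq0 !expf_eq0 (negPf nC_neq0) /= n0.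
  have -> : (0 < n.-1)%N by rewrite -ltnS prednK.
  split=> // z0; have zn : z ^+ n = z * z ^+ n.-1 by rewrite -exprS prednK.
  have z1 : z ^+ n.-1 != 0 by rewrite expf_neq0.
  by rewrite zn; field; rewrite z0 z1 nC_neq0.
pose P : {poly C} := 'X * ((d - h) *: 'X^n + (- (m%:R - h))%:P).
pose Q : {poly C} := d *: 'X^n + (- m%:R)%:P.
have eQ : p^`() = 'X^(m.-1) * Q.
  rewrite pmn_deriv /Q -!mul_polyC -(prednK mp) addSn /= exprD prednK //.
  by rewrite polyCN; ring.
have Qn z : Q.[z] = newton_den z by rewrite /Q !hornerE.
have Q0 : Q != 0 by rewrite -size_poly_gt0 size_binomial ?d_neq0.
have mC : (m%:R : C) != 0 by rewrite pnatr_eq0 -lt0n.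
exists P, Q; split.
  apply: ratform_ratmap => //.
  - rewrite eQ /P /Q /pmn -!mul_polyC.
    have -> : 'X^m = 'X * 'X^(m.-1) :> {poly C} by rewrite -exprS prednK.
    by rewrite !polyCN polyCB !polyC_natr polyCB polyC_natr; ring.
  - move=> z; rewrite Qn /newton_den => /eqP; rewrite subr_eq0 => /eqP e.
    have z0 : z != 0.
      apply/eqP => z0; move/eqP: e; rewrite z0 expr0n eqn0Ngt n0 mulr0 eq_sym.
      by rewrite (negPf mC).
    rewrite /P !hornerE.
    have -> : (d - h) * z ^+ n - (m%:R - h) = h * (1 - z ^+ n) by rewrite -e; ring.
    rewrite !mulf_neq0 ?h_neq0 // subr_eq0 eq_sym; apply/eqP => zn.
    by move/eqP: e; rewrite zn mulr1 eqr_nat -[eqbRHS]addn0 eqn_add2l eqn0Ngt n0.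
  - rewrite size_binomial ?d_neq0 // /P mulrC size_mulX ?size_binomial ?dh_neq0 //.
    by rewrite -size_poly_gt0 size_binomial ?dh_neq0.
move=> z; rewrite Qn; split=> // nz; rewrite /P !hornerE /newton_val /newton_mult.
have e : d * z ^+ n = newton_den z + m%:R by rewrite /newton_den; ring.
have -> : (d - h) * z ^+ n - (m%:R - h) = newton_den z - h / d * (d * z ^+ n) + h.
  by rewrite e /newton_den; field; rewrite -natrD d_neq0.
by rewrite e natrD; field; rewrite nz /= -natrD d_neq0.
Qed.

Lemma newton_Some z : N (Some z) = if newton_den z != 0 then Some (newton_val z) else None.
Proof.
have [P [Q [[_ _ _ -> _] hz]]] := newton_form; have [-> e] := hz z.
by case: ifP => // nz; rewrite e.
Qed.

Lemma newton_None : N None = None.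
Proof. by have [P [Q [[_ _ _ _ ->] _]]] := newton_form. Qed.

Lemma newton_cont x : ccont N x.
Proof. by have [P [Q [hf _]]] := newton_form; apply: ratform_cont hf x. Qed.

Lemma newton_julia z w : N (Some z) = Some w -> J z <-> J w.
Proof. by have [P [Q [hf _]]] := newton_form; apply: ratform_julia hf. Qed.

Lemma newton_julia_val z : newton_den z != 0 -> J z <-> J (newton_val z).
Proof. by move=> nz; apply: newton_julia; rewrite newton_Some nz. Qed.

Lemma nden_rot a z : a ^+ n = 1 -> newton_den (a * z) = newton_den z.
Proof. by move=> an; rewrite /newton_den exprMn an mul1r. Qed.

Lemma newton_isom a x : a ^+ n = 1 -> N (isom a 0 x) = isom a 0 (N x).
Proof.
case: x => [z|] an /=; last by rewrite newton_None.
rewrite addr0 !newton_Some nden_rot //; case: ifP => //= _; congr Some.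
by rewrite addr0 /newton_val nden_rot //; ring.
Qed.

Lemma newton_rot a : a ^+ n = 1 -> forall z, J z <-> J (a * z).
Proof.
move=> an; apply: (@fatou_rotations _ N a n id n0 an) => j x.
by rewrite newton_isom // exprAC an expr1n.
Qed.

Lemma newton_fix1 : newton_den 1 = n%:R /\ newton_val 1 = 1.
Proof.
have e : newton_den 1 = n%:R by rewrite /newton_den expr1n mulr1 natrD addrAC subrr add0r.
split=> //; rewrite /newton_val /newton_mult e.
by field; rewrite nC_neq0 -natrD d_neq0.
Qed.

(** Writing z^n - 1 = (z - 1) S gives N(z) - 1 = (z - 1) A(z) / [newton_den z], where the quotient
    at 1 is 1 - h, of modulus below 1. *)
Lemma newton_contracts1 : exists r th : R, [/\ 0 < r, 0 <= th < 1 &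
  forall z, cmod (z - 1) < r ->
    exists2 w, N (Some z) = Some w & cmod (w - 1) <= th * cmod (z - 1)].
Proof.
pose S : {poly C} := \sum_(i < n) 'X^i.
have hS z : z ^+ n - 1 = (z - 1) * S.[z].
  rewrite subrX1 /S horner_sum; congr (_ * _); apply: eq_bigr => i _.
  by rewrite hornerXn.
have S1 : S.[1] = n%:R.
  by rewrite /S horner_sum; under eq_bigr do rewrite hornerXn expr1n; rewrite sumr_const card_ord.
pose Q : {poly C} := d *: 'X^n - m%:R%:P.
have Qn z : Q.[z] = newton_den z by rewrite /Q !hornerE.
pose A := Q - h *: ('X * S).
have A1 : A.[1] = n%:R * (1 - h).
  rewrite /A hornerD hornerN hornerZ hornerM hornerX S1 Qn newton_fix1.1; ring.
set dl := 1 - cmod (h - 1); have dl0 : 0 < dl by rewrite subr_gt0.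
have nR : 0 < n%:R :> R by rewrite ltr0n.
(* With [th] midway between |h - 1| and 1, the gap between th n and n |h - 1| is n dl / 2, room for
   an error e in the numerator and th e in the denominator. *)
pose e : R := dl * n%:R / 4; have e0 : 0 < e by rewrite divr_gt0 // mulr_gt0.
have [r1 r10 hr1] := poly_near A 1 e0.
have [r2 r20 hr2] := poly_near Q 1 e0.
pose th := (1 + cmod (h - 1)) / 2.
have hm := cmod_ge0 (h - 1).
exists (Num.min r1 r2), th; split.
- by rewrite lt_min r10.
- by rewrite /th; move: dl0 hm; rewrite /dl => a1 a2; apply/andP; split; lra.
move=> z; rewrite lt_min => /andP[/hr1 + /hr2].
rewrite A1 !Qn newton_fix1.1 => z1 z2.
have b1 : cmod A.[z] <= n%:R * cmod (h - 1) + e.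
  have := cmodD (A.[z] - n%:R * (1 - h)) (n%:R * (1 - h)).
  by rewrite subrK cmodM cmod_nat (cmodBC 1 h); lra.
have b2 : n%:R - e <= cmod (newton_den z).
  have := cmod_sub_ge (n%:R : C) (n%:R - newton_den z).
  have -> : n%:R - (n%:R - newton_den z) = newton_den z by ring.
  by rewrite cmod_nat (cmodBC n%:R); lra.
have dl1 : dl <= 1 by rewrite /dl; lra.
have be : e <= n%:R / 4 by have := ler_wpM2r (ltW nR) dl1; rewrite /e; lra.
have nz : newton_den z != 0 by rewrite -cmod_gt0; lra.
exists (newton_val z); first by rewrite newton_Some nz.
have -> : newton_val z - 1 = (z - 1) * A.[z] / newton_den z.
  have eA : A.[z] = newton_den z - h * (z * S.[z]).
    by rewrite /A hornerD hornerN hornerZ hornerM hornerX Qn.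
  have -> : (z - 1) * A.[z] = (z - 1) * newton_den z - h * z * (z ^+ n - 1).
    by rewrite eA hS; ring.
  have zn : z ^+ n = (newton_den z + m%:R) / d.
    by rewrite /newton_den subrK mulrC mulKf // d_neq0.
  rewrite zn /newton_val /newton_mult natrD; field; rewrite nz /= -natrD d_neq0 //.
rewrite cmod_div cmodM -mulrA mulrC ler_wpM2r ?cmod_ge0 //.
rewrite ler_pdivrMr ?cmod_gt0 //; apply: le_trans b1 _.
apply: le_trans (_ : th * (n%:R - e) <= _); last by rewrite ler_wpM2l // /th; lra.
have -> : th * (n%:R - e) = n%:R * cmod (h - 1) + e + (n%:R * dl / 2 - e - th * e).
  by rewrite /th /dl; field.
have : th * e <= e by rewrite ger_pMl // /th; have := h1; lra.
by rewrite /e; lra.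
Qed.

Lemma newton_attracts1 : exists2 r : R, 0 < r & attracts N (Some 1) r.
Proof.
by have [r [th [r0 th0 hr]]] := newton_contracts1; apply: attracts_contraction hr.
Qed.

(** N commutes with the rotation by a, so the orbit of a z tends to a, which differs from 1. *)
Lemma newton_basin_rot a z : a ^+ n = 1 -> a != 1 ->
  basin N (Some 1) (Some z) -> ~ basin N (Some 1) (Some (a * z)).
Proof.
move=> an a1 b1 b2.
have it k x : iter k N (isom a 0 x) = isom a 0 (iter k N x).
  by elim: k => [//|k IH]; rewrite !iterS IH newton_isom.
have c0 : 0 < chord (Some 1) (Some a) / 2.
  rewrite chordE /= !mulr1 !divr_gt0 ?mulr_gt0 ?hnorm_gt0 //.
  by rewrite cmod_gt0 subr_eq0 eq_sym.
have [K1 hK1] := b1 _ c0; have [K2 hK2] := b2 _ c0.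
have e1 := hK1 (maxn K1 K2) (leq_maxl _ _).
have e2 := hK2 (maxn K1 K2) (leq_maxr _ _).
set k := maxn K1 K2 in e1 e2.
have ae : Some (a * z) = isom a 0 (Some z) by rewrite /= addr0.
rewrite ae it in e2.
rewrite -(chord_rot _ _ (unity_root_cmod n0 an)) /= addr0 mulr1 in e1.
have := chord_tri (isom a 0 (iter k N (Some z))) (Some 1) (Some a).
by rewrite [X in _ <= _ + X]chordC; lra.
Qed.

Local Notation nden := newton_den.
Local Notation nval := newton_val.
Local Notation lam := newton_mult.

(** Because [0^-1 = 0], the point 1 receives the same value as infinity; hence the requirements
    below that points and images avoid [Some 1]. *)
Definition inv1 (x : sphere R) : C := if x is Some z then (z - 1)^-1 else 0.

(* N in the coordinate t = 1/(z - 1), where the fixed point at infinity is 0. *)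
Lemma newton_inv1_coordinate : exists A B : {poly C},
  [/\ A.[0] = d, B.[0] = d - h, coprimep ('X * A) B &
    forall y, y <> Some 1 -> N y <> Some 1 ->
      inv1 (N y) * B.[inv1 y] = inv1 y * A.[inv1 y]].
Proof.
(* With z = (1 + t)/t, A is t^n [newton_den z] and W is t^(n+1) z (z^n - 1). For m = 0 both contain
   the factor 1 + t = t z, which is removed to make 'X * A and B coprime. *)
pose A : {poly C} := if m == 0%N then n%:R *: (1 + 'X) ^+ n.-1
  else d *: (1 + 'X) ^+ n - m%:R *: 'X ^+ n.
pose W : {poly C} := if m == 0%N then (1 + 'X) ^+ n - 'X ^+ n
  else (1 + 'X) * ((1 + 'X) ^+ n - 'X ^+ n).
have AE t : A.[t] = if m == 0%N then n%:R * (1 + t) ^+ n.-1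
    else d * (1 + t) ^+ n - m%:R * t ^+ n.
  by rewrite /A; case: ifP => _; rewrite !hornerE ?horner_exp ?hornerE.
have WE t : W.[t] = if m == 0%N then (1 + t) ^+ n - t ^+ n
    else (1 + t) * ((1 + t) ^+ n - t ^+ n).
  by rewrite /W; case: ifP => _; rewrite !hornerE ?horner_exp ?hornerE.
have BE t : (A - h *: W).[t] = A.[t] - h * W.[t].
  by rewrite hornerD hornerN hornerZ.
have z0n : 0 ^+ n = 0 :> C by rewrite expr0n eqn0Ngt n0.
have A0 : A.[0] = d.
  rewrite AE addr0 !expr1n !mulr1 z0n mulr0 subr0; case: eqP => // ->.
  by rewrite add0n.
have W0 : W.[0] = 1 by rewrite WE addr0 z0n expr1n subr0 mulr1 if_same.
have hn0 := h_neq0.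
exists A, (A - h *: W); split=> //.
- by rewrite BE A0 W0 mulr1.
- apply/Pdiv.ClosedField.coprimepP => t; rewrite rootE hornerM hornerX mulf_eq0.
  case/orP => /eqP => [->|At]; first by rewrite BE A0 W0 mulr1 (dh_neq0).
  rewrite BE At sub0r oppr_eq0 mulf_neq0 // WE.
  move: At; rewrite AE; case: eqP => [m0|/eqP mn].
    move/eqP; rewrite mulf_eq0 (negPf (nC_neq0)) expf_eq0 /= => /andP[_ /eqP t1].
    rewrite t1 z0n sub0r oppr_eq0 expf_neq0 //; apply/eqP => tz.
    by move/eqP: t1; rewrite tz addr0 oner_eq0.
  have mC : (m%:R : C) != 0 by rewrite pnatr_eq0.
  move=> e; have t0 : t != 0.
    apply/eqP => tz; move/eqP: e; rewrite tz z0n addr0 expr1n mulr0 subr0 mulr1.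
    by rewrite (negPf (d_neq0)).
  have tn : t ^+ n != 0 by rewrite expf_neq0.
  have t1 : 1 + t != 0.
    apply/eqP => tz; move/eqP: e; rewrite tz z0n mulr0 sub0r oppr_eq0.
    by rewrite mulf_eq0 (negPf mC) (negPf tn).
  rewrite mulf_neq0 // subr_eq0; apply/eqP => e2.
  move/eqP: e; rewrite e2 -mulrBl mulf_eq0 (negPf tn) orbF natrD addrAC subrr add0r.
  by rewrite (negPf (nC_neq0)).
- case=> [z|] y1 Ny1; last by rewrite newton_None //= !mul0r.
  have z1 : z - 1 != 0 by rewrite subr_eq0; apply/eqP => e; apply: y1; rewrite e.
  rewrite BE; set t := inv1 (Some z).
  have t0 : t != 0 by rewrite invr_eq0.
  have zt : z * t = 1 + t by rewrite /t /=; field.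
  have ztn : z ^+ n * t ^+ n = (1 + t) ^+ n by rewrite -exprMn zt.
  have tn : t ^+ n != 0 by rewrite expf_neq0.
  pose c : C := if m == 0%N then 1 + t else 1.
  have eA : A.[t] * c = nden z * t ^+ n.
    rewrite AE /c /newton_den mulrBl -mulrA ztn; case: eqP => [m0|_]; last by rewrite mulr1.
    by rewrite m0 mul0r subr0 add0n -mulrA -exprSr prednK.
  have eW : W.[t] * c = z * (z ^+ n - 1) * t ^+ n * t.
    rewrite WE /c -ztn -zt; case: ifP => _; ring.
  have hnd := d_neq0.
  move: Ny1; rewrite newton_Some //; case: ifP => [nz|/negbFE/eqP nz] Ny1; last first.
    rewrite /= mul0r; move/eqP: eA; rewrite nz mul0r mulf_eq0 => /orP[/eqP ->|].
      by rewrite mulr0.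
    rewrite AE /c; case: (m == 0%N); last by rewrite oner_eq0.
    move=> /eqP ->; rewrite expr0n; case: (n) n2 => [|[|k]] //= _.
    by rewrite !mulr0.
  set w := nval z; have w1 : w - 1 != 0.
    by rewrite subr_eq0; apply/eqP => e; apply: Ny1; congr Some.
  have ew : (w - 1) * nden z = (z - 1) * nden z - h * (z * (z ^+ n - 1)).
    have zn : z ^+ n = (nden z + m%:R) / d.
      by rewrite /newton_den subrK mulrC mulKf.
    rewrite zn /w /newton_val /newton_mult natrD; field.
    by rewrite nz -natrD hnd.
  have tz : t * (z - 1) = 1 by rewrite /t /= mulVf.
  have c0 : c != 0.
    rewrite /c; case: (eqVneq m 0%N) => [m0|_]; last by rewrite oner_eq0.
    rewrite -zt mulf_neq0 //; apply/eqP => z0; move/eqP: nz; apply.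
    by rewrite /newton_den z0 z0n m0 mulr0 subr0.
  apply: (mulfI w1); rewrite /= mulrA mulfV // mul1r.
  apply: (mulIf c0); rewrite mulrBl eA -[h * _ * c]mulrA eW.
  have -> : (w - 1) * (t * A.[t]) * c = (w - 1) * t * (A.[t] * c) by ring.
  rewrite eA.
  have -> : (w - 1) * t * (nden z * t ^+ n) = ((w - 1) * nden z) * t ^+ n * t by ring.
  rewrite ew.
  have -> : ((z - 1) * nden z - h * (z * (z ^+ n - 1))) * t ^+ n * t =
    (t * (z - 1)) * nden z * t ^+ n - h * (z * (z ^+ n - 1)) * t ^+ n * t by ring.
  by rewrite tz; ring.
Qed.

Lemma newton_basin_unbounded (r : R) :
  exists2 z, r <= cmod z & basin N (Some 1) (Some z).
Proof.
apply: contrapT => hn.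
have [ra ra0 hat] := newton_attracts1.
pose r0 := Num.max 2 r; pose rho := r0^-1.
have r02 : 2 <= r0 by rewrite le_max lexx.
have r0p : 0 < r0 by lra.
have rho0 : 0 < rho by rewrite invr_gt0.
have rho2 : rho <= 1 / 2 by rewrite /rho ler_pdivlMr // mulrC ler_pdivrMr //; lra.
pose x (xi : C) : sphere R := if xi == 0 then None else Some xi^-1.
pose g k xi := inv1 (iter k N (x xi)).
have itN k : iter k N None = None by elim: k => [//|k IH]; rewrite iterS IH newton_None.
have away k xi : cmod xi <= rho -> ra <= chord (Some 1) (iter k N (x xi)) \/ iter k N (x xi) = None.
  rewrite /x; case: eqP => [_ _|/eqP xn hxi]; first by right.
  left; rewrite leNgt; apply/negP => hc; apply: hn; exists xi^-1.
    rewrite cmodV; apply: le_trans (_ : r0 <= _); first by rewrite le_max lexx orbT.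
    by rewrite -[r0]invrK lef_pV2 ?posrE ?cmod_gt0.
  exact: basin_hit hat hc.
have not1 k xi : cmod xi <= rho -> iter k N (x xi) <> Some 1.
  by move=> /(away k)[+ e|-> //]; rewrite e chordxx; lra.
have M0 : 0 < 2 / ra by rewrite divr_gt0.
have gM k xi : cmod xi <= rho -> cmod (g k xi) <= 2 / ra.
  move=> hxi; rewrite /g; have := not1 k xi hxi.
  case: (away k xi hxi) => [|->]; last by rewrite /= cmod0 ltW.
  case: (iter k N (x xi)) => [w|] /=; last by move=> _ _; rewrite cmod0 ltW.
  move=> hc w1; have w10 : w - 1 != 0.
    by rewrite subr_eq0; apply/eqP => e; apply: w1; rewrite e.
  rewrite cmodV -[leRHS]invrK lef_pV2 ?posrE ?invr_gt0 ?cmod_gt0 // invf_div.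
  by have := chord_Some_le 1 w; rewrite cmodBC; lra.
have [A [B [A0 B0 cop hAB]]] := newton_inv1_coordinate.
(* From a Bezout relation u t A + v B = 1 and t A = s B follows (u s + v) B = 1. Hence B cannot be
   small while t and s are bounded. *)
have [dl dl0 hdl] : exists2 dl : R, 0 < dl & forall t s : C, cmod t <= 2 / ra ->
    cmod s <= 2 / ra -> s * B.[t] = t * A.[t] -> dl <= cmod B.[t].
  have /Bezout_eq1_coprimepP[[u v] /= e] := cop.
  have [K K0 hK] := poly_bounded u (2 / ra); have [L L0 hL] := poly_bounded v (2 / ra).
  have q0 : 0 < K * (2 / ra) + L by rewrite addr_gt0 // mulr_gt0.
  exists (K * (2 / ra) + L)^-1; first by rewrite invr_gt0.
  move=> t s ht hs est; have := congr1 (horner^~ t) e.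
  rewrite /= hornerD !hornerM hornerX hornerC -est mulrA -mulrDl => e1.
  have : 1 <= (K * (2 / ra) + L) * cmod B.[t].
    rewrite -[leLHS](@cmod1 R) -e1 cmodM ler_wpM2r ?cmod_ge0 //.
    apply: le_trans (cmodD _ _) _; rewrite cmodM lerD ?hL // ler_pM ?cmod_ge0 ?hK //.
  by rewrite -ler_pdivrMl // mulr1.
have [hk hhk] : exists hk : nat -> C -> C, forall k, [/\ papprox rho (hk k),
    (forall xi, cmod xi <= rho -> g k xi = xi * hk k xi) & hk k 0 = lam^-1 ^+ k].
  (* [H k] is g k divided by xi, so [H k 0] is the derivative at infinity. The start is 1/(1 - xi)
     because 1/(1/xi - 1) = xi/(1 - xi). *)
  pose H := fix H k : C -> C := if k is k'.+1 then
    fun xi => H k' xi * (A.[xi * H k' xi] * (B.[xi * H k' xi])^-1)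
    else fun xi => ((1 - 'X).[xi])^-1.
  exists H; elim=> [|k [IH1 IH2 IH3]].
    split.
    - have half0 : 0 < 1 / 2 :> R by lra.
      apply: (papprox_inv rho0 half0); first exact: papprox_poly.
      move=> z hz; rewrite !hornerE; have := cmod_sub_ge 1 z; rewrite cmod1; lra.
    - move=> xi hxi; rewrite /g /x /= !hornerE; case: eqP => [->|/eqP xn].
        by rewrite mul0r.
      have x1 : 1 - xi != 0.
        by rewrite -cmod_gt0; have := cmod_sub_ge 1 xi; rewrite cmod1; lra.
      by rewrite /=; field; rewrite xn x1.
    - by rewrite /= !hornerE subr0 invr1.
  have pg : papprox rho (fun xi => xi * H k xi).
    apply: (@papprox_ext _ _ (fun xi => 'X.[xi] * H k xi)).
      by move=> z _; rewrite hornerX.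
    by apply: papprox_mul => //; apply: papprox_poly.
  have step xi : cmod xi <= rho -> g k.+1 xi * B.[xi * H k xi] = xi * H k xi * A.[xi * H k xi].
    move=> hxi; rewrite -IH2 // /g iterS; apply: hAB; first exact: not1.
    by have := not1 k.+1 xi hxi; rewrite iterS.
  have bB xi : cmod xi <= rho -> dl <= cmod B.[xi * H k xi].
    move=> hxi; apply: (hdl _ (g k.+1 xi)); rewrite ?step ?gM //.
    by rewrite -IH2 ?gM.
  split.
  - apply: papprox_mul => //; apply: papprox_mul; first exact: papprox_comp.
    by apply: (papprox_inv rho0 dl0) bB; apply: papprox_comp.
  - move=> xi hxi /=; have Bn : B.[xi * H k xi] != 0.
      by rewrite -cmod_gt0; apply: lt_le_trans (bB xi hxi).
    by apply: (mulIf Bn); rewrite step // !mulrA divfK.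
  - have -> : H k.+1 0 = H k 0 * (A.[0 * H k 0] * (B.[0 * H k 0])^-1) by [].
    rewrite mul0r A0 B0 IH3 exprSr -(dlamE).
    by congr (_ * _); field; rewrite lam_neq0 // -natrD d_neq0.
(* On the circle |xi| = rho the quotient g k xi / xi is at most (2/ra)/rho for every k, and the
   maximum principle carries this bound to xi = 0. *)
have bound k : cmod (lam^-1 ^+ k) <= 2 / ra / rho.
  have [q1 q2 q3] := hhk k; rewrite -q3; apply: (papprox_max_principle rho0) => // z hz.
  by rewrite ler_pdivlMr // -hz mulrC -cmodM -q2 ?gM ?hz.
have l1 : 1 < (cmod lam)^-1 by rewrite invf_gt1 ?lam_gt0 ?lam_lt1.
have [k hk'] := pow_unbounded (2 / ra / rho) l1.
have := bound k; rewrite cmodX cmodV; lra.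
Qed.

(** * The Newton map near infinity *)

Lemma chord_arc_far (al be : C) (t : R) : cmod al = 1 -> cmod be = 1 ->
  0 <= re al * re be + im al * im be -> 0 <= t <= 1 ->
  1 / 2 <= cmod (al + (t%:C)%C * (be - al)).
Proof.
move=> a1 b1 hab /andP[t0 t1].
rewrite -(@ler_pXn2r _ 2) ?nnegrE ?cmod_ge0 ?divr_ge0 // cmod_sq !ReImE /=.
have ha := cmod_sq al; have hb := cmod_sq be; rewrite a1 b1 expr1n in ha hb.
have -> : (re al + (t * (re be - re al) - 0 * (im be - im al))) ^+ 2 +
   (im al + (t * (im be - im al) + 0 * (re be - re al))) ^+ 2 =
   (1 - t) ^+ 2 * (re al ^+ 2 + im al ^+ 2) + t ^+ 2 * (re be ^+ 2 + im be ^+ 2) +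
   2 * (t * (1 - t)) * (re al * re be + im al * im be) by ring.
rewrite -ha -hb.
have : 0 <= 2 * (t * (1 - t)) * (re al * re be + im al * im be).
  by rewrite !mulr_ge0 // subr_ge0.
nra.
Qed.

(** If w lies in the basin of 1, then a w does not, for an n-th root of unity a <> 1. A path from w
    to a w that stays far from 0 therefore leaves the basin at a far point of J. *)
Lemma newton_far_boundary (r : R) : exists z0, [/\ r <= cmod z0, J z0 &
  forall e : R, 0 < e -> exists2 y, cmod (y - z0) < e & fatou N (Some y)].
Proof.
have [w hw bw] := newton_basin_unbounded (2 * `|r|).
have [a [an a1 _]] := @unity_root_exists R n n2.
have [ra ra0 hat] := newton_attracts1.
have cN := newton_cont.
have naw := newton_basin_rot an a1 bw.
have ca := unity_root_cmod n0 an.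
have key al be : cmod al = 1 -> cmod be = 1 -> 0 <= re al * re be + im al * im be ->
    basin N (Some 1) (Some (al * w)) -> ~ basin N (Some 1) (Some (be * w)) ->
    exists z0, [/\ r <= cmod z0, J z0 &
      forall e : R, 0 < e -> exists2 y, cmod (y - z0) < e & fatou N (Some y)].
  move=> al1 be1 hab ba nb.
  have [t [t01 Jt ht]] := basin_boundary ra0 cN hat ba nb.
  exists (segpt (al * w) (be * w) t); split=> //; last first.
    move=> e /ht[y hy by_]; exists y => //; exact: basin_fatou ra0 cN hat by_.
  have -> : segpt (al * w) (be * w) t = (al + (t%:C)%C * (be - al)) * w.
    by rewrite /segpt; ring.
  rewrite cmodM; have := chord_arc_far al1 be1 hab t01.
  have := cmod_ge0 w; have := ler_norm r; nra.
(* The straight segment from w to a w may pass through 0, as when a = -1. Going through s w with s =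
   i or -i keeps both angles at most right, so each leg stays at distance at least |w|/2 from 0. *)
have [s [s1 s2 s3]] : exists s : C, [/\ cmod s = 1, re s = 0 &
    0 <= re s * re a + im s * im a].
  have cs (e : R) : e ^+ 2 = 1 -> cmod (Complex 0 e) = 1.
    by move=> e2; rewrite /cmod /= expr0n add0r e2 sqrtr1.
  case: (leP 0 (im a)) => ha.
    by exists (Complex 0 1); rewrite cs ?expr1n //= mul0r mul1r add0r.
  exists (Complex 0 (-1)); rewrite cs ?sqrrN ?expr1n //= mul0r mulN1r add0r.
  by split=> //; rewrite oppr_ge0 ltW.
case: (pselect (basin N (Some 1) (Some (s * w)))) => bs.
  exact: (key s a).
by apply: (key 1 s); rewrite ?cmod1 ?mul1r //= s2 mul0r addr0.
Qed.

(** In u = 1/z the correction z / [nden z] is u^(n-1) / (d - m u^n), which is Lipschitz on |u| <=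
    1/2 and vanishes at 0 because n >= 2. *)
Lemma newton_asymptotics : exists2 K : R, 0 < K &
  forall x y, 2 <= cmod x -> 2 <= cmod y ->
  [/\ nden x != 0, cmod (nval x - lam * x) <= K / cmod x &
      cmod (nval x - nval y - lam * (x - y)) <= K * cmod (x - y) / cmod x].
Proof.
pose T : {poly C} := 'X^(n.-1); pose D : {poly C} := d%:P - m%:R *: 'X^n.
have TE u : T.[u] = u ^+ n.-1 by rewrite hornerXn.
have DE u : D.[u] = d - m%:R * u ^+ n by rewrite /D !hornerE.
have D1 u : cmod u <= 1 / 2 -> 1 <= cmod D.[u].
  move=> hu; rewrite DE; have := cmod_sub_ge d (m%:R * u ^+ n).
  rewrite cmodM cmodX !cmod_nat.
  have u1 : cmod u ^+ n <= 1 / 2.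
    apply: le_trans (hu); rewrite -[leRHS]expr1 ler_wiXn2l ?cmod_ge0 //; lra.
  have := ler_wpM2l (ler0n R m) u1; rewrite natrD.
  have : 2 <= n%:R :> R by rewrite ler_nat.
  have := ler0n R m; lra.
have [K1 K10 hK1] := poly_lipschitz T (1 / 2); have [K2 K20 hK2] := poly_lipschitz D (1 / 2).
have [B1 B10 hB1] := poly_bounded T (1 / 2); have [B2 B20 hB2] := poly_bounded D (1 / 2).
pose psi u := T.[u] / D.[u].
pose L := K1 * B2 + B1 * K2.
have L0 : 0 < L by rewrite addr_gt0 ?mulr_gt0.
have hpsi u v : cmod u <= 1 / 2 -> cmod v <= 1 / 2 ->
    cmod (psi u - psi v) <= L * cmod (u - v).
  move=> hu hv; have du := D1 _ hu; have dv := D1 _ hv.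
  have du0 : D.[u] != 0 by rewrite -cmod_gt0; lra.
  have dv0 : D.[v] != 0 by rewrite -cmod_gt0; lra.
  have -> : psi u - psi v =
      ((T.[u] - T.[v]) * D.[v] - T.[v] * (D.[u] - D.[v])) / (D.[u] * D.[v]).
    by rewrite /psi; field; rewrite du0 dv0.
  rewrite cmod_div ler_pdivrMr; last by rewrite cmod_gt0 mulf_neq0.
  apply: le_trans (_ : L * cmod (u - v) <= _); last first.
    by rewrite ler_peMr ?mulr_ge0 ?cmod_ge0 ?(ltW L0) // cmodM -[leLHS]mulr1 ler_pM.
  apply: le_trans (cmodB _ _) _; rewrite !cmodM /L mulrDl lerD //.
    by rewrite mulrAC ler_pM ?cmod_ge0 ?hK1 ?hB2.
  by rewrite -mulrA ler_pM ?cmod_ge0 ?hK2 ?hB1.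
pose e1 := h * n%:R / d.
exists (cmod e1 * L + 1); first by have := mulr_ge0 (cmod_ge0 e1) (ltW L0); lra.
move=> x y x2 y2.
have inv_half z : 2 <= cmod z -> cmod z^-1 <= 1 / 2.
  move=> z2; rewrite cmodV ler_pdivlMr // mulrC ler_pdivrMr //; lra.
have big z : 2 <= cmod z -> nden z != 0 /\ z / nden z = psi z^-1.
  move=> z2; have z0 : z != 0 by rewrite -cmod_gt0; lra.
  have zn : z ^+ n = z * z ^+ n.-1 by rewrite -exprS prednK.
  have zn0 : z ^+ n.-1 != 0 by rewrite expf_neq0.
  have Dn : nden z = z ^+ n * D.[z^-1].
    by rewrite /newton_den DE exprVn; field; rewrite expf_neq0.
  have Dz : D.[z^-1] != 0 by rewrite -cmod_gt0; have := D1 _ (inv_half z z2); lra.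
  split; first by rewrite Dn mulf_neq0 // expf_neq0.
  by rewrite /psi Dn TE zn exprVn; field; rewrite z0 Dz zn0.
have [nx ex] := big x x2; have [ny ey] := big y y2.
have x0 : x != 0 by rewrite -cmod_gt0; lra.
have y0 : y != 0 by rewrite -cmod_gt0; lra.
have xp : 0 < cmod x by rewrite cmod_gt0.
have yp : 0 < cmod y by rewrite cmod_gt0.
have psi0 : psi 0 = 0.
  by rewrite /psi TE expr0n; case: (n) n2 => [|[|k]] //= _; rewrite mul0r.
split=> //.
  have -> : nval x - lam * x = e1 * psi x^-1.
    by rewrite /newton_val ex /e1; ring.
  have := hpsi x^-1 0 (inv_half x x2); rewrite cmod0 => /(_ ltac:(lra)).
  rewrite psi0 !subr0 cmodM cmodV => hh.
  have := ler_wpM2l (cmod_ge0 e1) hh; rewrite mulrA => h2.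
  apply: le_trans h2 _; rewrite ler_pM2r ?invr_gt0 //; lra.
have -> : nval x - nval y - lam * (x - y) = e1 * (psi x^-1 - psi y^-1).
  by rewrite /newton_val ex ey /e1; ring.
have := hpsi x^-1 y^-1 (inv_half x x2) (inv_half y y2).
have -> : x^-1 - y^-1 = - (x - y) / (x * y) by field; rewrite x0 y0.
rewrite cmod_div cmodN cmodM => hh; rewrite cmodM.
have := ler_wpM2l (cmod_ge0 e1) hh => h2; apply: le_trans h2 _.
have hxy := cmod_ge0 (x - y).
have q1 : cmod (x - y) / (cmod x * cmod y) <= cmod (x - y) / cmod x.
  by rewrite ler_wpM2l // lef_pV2 ?posrE ?mulr_gt0 // ler_peMr; lra.
have q2 : 0 <= cmod (x - y) / cmod x by rewrite divr_ge0 // ltW.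
have := ler_wpM2l (mulr_ge0 (cmod_ge0 e1) (ltW L0)) q1.
rewrite !mulrA; lra.
Qed.

(** At y/lam the polynomial P - y Q is small, so it has a root within relative distance e = (1 -
    |lam|)/2; its modulus is at least (1 - e)|y|/|lam|, which is where [rho] comes from. *)
Lemma newton_preimage : exists rho r0 : R, [/\ 1 < rho, 2 <= r0 &
  forall y, r0 <= cmod y -> exists x, [/\ 2 <= cmod x, rho * cmod y <= cmod x & nval x = y]].
Proof.
have [K K0 hK] := newton_asymptotics.
have [P [Q [[_ sz Q0 _ _] hPQ]]] := newton_form.
have P0 : P != 0 by rewrite -size_poly_gt0; apply: leq_ltn_trans sz.
have [B B0 hB] := poly_upper Q.
set l := cmod lam; have l0 : 0 < l := lam_gt0; have l1 : l < 1 := lam_lt1.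
have lc0 : 0 < cmod (lead_coef P) by rewrite cmod_gt0 lead_coef_eq0.
set D := (size P).-1.
have D0 : (0 < D)%N by rewrite -ltnS prednK ?size_poly_gt0 //; apply: leq_ltn_trans sz; rewrite size_poly_gt0.
pose e := (1 - l) / 2; have e0 : 0 < e by rewrite /e; lra.
pose c := B * K / (cmod (lead_coef P) * e ^+ D).
have c0 : 0 < c by rewrite divr_gt0 ?mulr_gt0 ?exprn_gt0.
have l' : 1 <= l^-1 by rewrite invf_ge1 // ltW.
exists ((1 + l) / (2 * l)), (4 + 2 * c); split.
- by rewrite ltr_pdivlMr ?mulr_gt0 //; lra.
- lra.
move=> y hy; pose x0 := y / lam.
have x0E : cmod x0 = cmod y / l by rewrite cmod_div.
have yx : cmod y <= cmod x0 by rewrite x0E ler_peMr // cmod_ge0.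
have x2 : 2 <= cmod x0 by lra.
have [nx hx _] := hK x0 x0 x2 x2.
have lx : lam * x0 = y by rewrite mulrC divfK // lam_neq0.
rewrite lx in hx.
have sz' : (size (- (y *: Q))%R < size P)%N.
  by rewrite size_polyN; apply: leq_ltn_trans (size_scale_leq _ _) sz.
have szE : size (P - y *: Q) = size P by rewrite size_polyDl.
have lcE : lead_coef (P - y *: Q) = lead_coef P by rewrite lead_coefDl.
have s1 : (1 < size (P - y *: Q)%R)%N.
  by rewrite szE; apply: leq_ltn_trans sz; rewrite size_poly_gt0.
have [r rr hr] := root_near x0 s1.
rewrite szE lcE -/D hornerD hornerN hornerZ in hr.
have [Qx Px] := hPQ x0; rewrite nx in Qx.
have {}Px : P.[x0] = nval x0 * Q.[x0] by rewrite -(Px nx) divfK.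
have bnd : cmod (P.[x0] - y * Q.[x0]) <= B * K * cmod x0 ^+ D.-1.
  rewrite Px -mulrBl cmodM.
  have a1 : cmod Q.[x0] <= B * cmod x0 ^+ D.
    apply: le_trans (hB x0 _) _; first by lra.
    rewrite ler_wpM2l ?(ltW B0) // ler_weXn2l ?leq_pred //; first by lra.
    by rewrite /D -!subn1 leq_sub2r // ltnW.
  have : cmod (nval x0 - y) * cmod Q.[x0] <= K / cmod x0 * (B * cmod x0 ^+ D).
    by rewrite ler_pM ?cmod_ge0.
  have -> : cmod x0 ^+ D = cmod x0 * cmod x0 ^+ D.-1 by rewrite -exprS prednK.
  have -> // : K / cmod x0 * (B * (cmod x0 * cmod x0 ^+ D.-1)) = B * K * cmod x0 ^+ D.-1.
  by field; rewrite gt_eqF //; move: x2; isolate; lra.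
have near : cmod (x0 - r) <= e * cmod x0.
  rewrite leNgt; apply/negP => hlt.
  have x0p : 0 < cmod x0 by move: x2; isolate; lra.
  have a1 : cmod (lead_coef P) * (e * cmod x0) ^+ D <= B * K * cmod x0 ^+ D.-1.
    apply: le_trans bnd; apply: le_trans hr; rewrite ler_pM2l //.
    have ex0 : 0 <= e * cmod x0 by rewrite mulr_ge0 ?cmod_ge0 // ltW.
    by rewrite lerXn2r ?nnegrE ?cmod_ge0 // ltW.
  have : cmod x0 <= c.
    rewrite /c ler_pdivlMr ?mulr_gt0 ?exprn_gt0 //.
    have xp : 0 < cmod x0 ^+ D.-1 by rewrite exprn_gt0.
    rewrite -(ler_pM2r xp); apply: le_trans a1.
    have xD : cmod x0 ^+ D = cmod x0 * cmod x0 ^+ D.-1 by rewrite -exprS prednK.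
    by rewrite [(e * cmod x0) ^+ D]exprMn xD le_eqVlt; apply/orP; left; apply/eqP; ring.
  by move: hy yx c0; isolate; lra.
have rb : (1 - e) * cmod x0 <= cmod r.
  have := cmod_sub_ge x0 (x0 - r); have -> : x0 - (x0 - r) = r by ring.
  by move: near; isolate; lra.
have rb2 : (1 + l) / (2 * l) * cmod y <= cmod r.
  apply: le_trans rb; rewrite x0E /e le_eqVlt; apply/orP; left; apply/eqP.
  by field; rewrite gt_eqF.
have r2 : 2 <= cmod r.
  apply: le_trans rb2; apply: le_trans (_ : 1 * cmod y <= _).
    by move: hy c0; isolate; lra.
  by rewrite ler_wpM2r ?cmod_ge0 // ler_pdivlMr ?mulr_gt0 //; move: l1; isolate; lra.
exists r; split=> //.
have [nr _ _] := hK r r r2 r2.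
have [Qr Pr] := hPQ r; rewrite nr in Qr.
rewrite -(Pr nr); move: rr; rewrite rootE hornerD hornerN hornerZ subr_eq0 => /eqP ->.
by rewrite mulfK.
Qed.

(* Near infinity J is preserved, up to relative error eta, by the time-one
   map of the vector field g z^(1-q). *)
Definition drift1 q g := forall eta : R, 0 < eta -> exists r : R,
  forall z, J z -> r <= cmod z ->
    exists2 z', J z' & cmod (z' - z - g * z / z ^+ q) <= eta * cmod (g * z / z ^+ q).

Definition drift q g := forall eta : R, 0 < eta -> exists r : R,
  forall k z, J z -> r <= cmod z ->
    exists2 z', J z' &
      cmod (z' - z - lam ^+ (q * k) * (g * z / z ^+ q)) <=
      eta * cmod (lam ^+ (q * k) * (g * z / z ^+ q)).

Lemma power_near1 q : exists2 L : R, 0 < L & forall t, cmod (t - 1) <= 1 ->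
  cmod (t ^+ q - 1) <= L * cmod (t - 1).
Proof.
have [L L0 hL] := poly_lipschitz ('X^q : {poly C}) 2.
exists L => // t ht; have := hL t 1; rewrite !hornerXn expr1n cmod1; apply; last by lra.
by have := cmodD (t - 1) 1; rewrite subrK cmod1; lra.
Qed.

(* Conjugating by N^k shrinks the drift by lam^(q k); the weight A/|z| absorbs
   the distortion of N, which is summable along the expanding inverse orbit. *)
Lemma drift_of_drift1 q g : (0 < q)%N -> drift1 q g -> drift q g.
Proof.
move=> q0 hb eta0 eta00.
pose eta := Num.min 1 eta0; have et0 : 0 < eta by rewrite lt_min ltr01.
have et1 : eta <= 1 by rewrite ge_min lexx.
have ete : eta <= eta0 by rewrite ge_min lexx orbT.
have [K K0 hK] := newton_asymptotics.
have [rho [r0 [rho1 r02 hpre]]] := newton_preimage.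
have [L L0 hL] := power_near1 q.-1.
set l := cmod lam; have l0 : 0 < l := lam_gt0; have l1 : l < 1 := lam_lt1.
(* Relative errors in units of 1/|y|: 2K/l for the nonlinearity of N over a displacement of length
   2|V|, and L K for replacing lam V by the target v'. [c2] is the loss in bounding l |V| by
   |v'|. *)
pose c1 := 2 * K / l + L * K; pose c2 := L * K.
have LK : 0 < L * K by rewrite mulr_gt0.
have c10 : 0 < c1 by rewrite addr_gt0 ?divr_gt0 ?mulr_gt0.
have c20 : 0 < c2 by [].
(* Chosen so that A + c1 + c2 = A rho: as |y| >= rho |z|, one inductive step turns A/|y| plus the
   new errors into at most A/|z|. *)
pose A := (c1 + c2) / (rho - 1).
have rm : 0 < rho - 1 by lra.
have A0 : 0 < A by apply: divr_gt0 => //; apply: addr_gt0.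
have [rb hrb] := hb (eta / 2) ltac:(lra).
pose r := Num.max (Num.max rb r0) (Num.max (2 * A / eta) (Num.max (K + 2) (Num.max (2 * cmod g + 2) (2 * c2 + 2)))).
have main k z : J z -> r <= cmod z -> exists2 z', J z' &
    cmod (z' - z - lam ^+ (q * k) * (g * z / z ^+ q)) <=
    (eta / 2 + A / cmod z) * cmod (lam ^+ (q * k) * (g * z / z ^+ q)).
  elim: k z => [|k IH] z Jz; rewrite /r !ge_max => /andP[/andP[z1 z2] /andP[z3 /andP[z4 /andP[z5 z6]]]].
    have [z' Jz' hz'] := hrb z Jz z1; exists z' => //.
    rewrite muln0 expr0 mul1r; apply: le_trans hz' _; rewrite ler_wpM2r ?cmod_ge0 // lerDl.
    by rewrite divr_ge0 ?cmod_ge0 ?(ltW A0).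
  have [y [y2 hy Ny]] := hpre z z2.
  have zp : 0 < cmod z by lra.
  have yz : cmod z <= cmod y by apply: le_trans hy; rewrite ler_peMl ?cmod_ge0 ?ltW.
  have yp : 0 < cmod y by lra.
  have y0 : y != 0 by rewrite -cmod_gt0.
  have zn0 : z != 0 by rewrite -cmod_gt0.
  have [ndy ay _] := hK y y y2 y2; rewrite Ny in ay.
  have Jy : J y by apply/(newton_julia_val ndy); rewrite Ny.
  have [y' Jy' hy'] := IH y Jy ltac:(by apply: le_trans yz; rewrite /r !ge_max z1 z2 z3 z4 z5 z6).
  set V := lam ^+ (q * k) * (g * y / y ^+ q) in hy'.
  have Vg : cmod V <= cmod g.
    have yq : y ^+ q = y * y ^+ q.-1 by rewrite -exprS prednK.
    have -> : V = lam ^+ (q * k) * (g / y ^+ q.-1).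
      by rewrite /V yq; field; rewrite y0 expf_neq0.
    rewrite cmodM cmod_div !cmodX.
    have a1 : cmod lam ^+ (q * k) <= 1 by rewrite exprn_ile1 ?cmod_ge0 ?ltW.
    have a2 : cmod g / cmod y ^+ q.-1 <= cmod g.
      rewrite ler_pdivrMr ?exprn_gt0 // ler_peMr ?cmod_ge0 // exprn_ege1 //.
      by move: y2; isolate; lra.
    apply: le_trans a2; rewrite ler_piMl // divr_ge0 ?exprn_ge0 ?cmod_ge0 //.
  have Ay : A / cmod y <= A / cmod z by rewrite ler_pM2l // lef_pV2 ?posrE.
  have Az : A / cmod z <= eta / 2.
    by rewrite ler_pdivrMr //; rewrite ler_pdivrMr // in z3; move: z3; isolate; lra.
  have V0 := cmod_ge0 V.
  have dy : cmod (y' - y) <= 2 * cmod V.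
    have := cmodD (y' - y - V) V; rewrite subrK => hh.
    have : (eta / 2 + A / cmod y) * cmod V <= 1 * cmod V.
      by rewrite ler_wpM2r //; move: et1 Ay Az; isolate; lra.
    by move: hh hy'; isolate; lra.
  have y'2 : 2 <= cmod y'.
    have := cmod_add_ge y (y' - y); have -> : y + (y' - y) = y' by ring.
    by move: dy Vg z5 yz; isolate; lra.
  have [_ _ ayy] := hK y y' y2 y'2.
  have [ndy' _ _] := hK y' y' y'2 y'2.
  exists (nval y'); first by apply/(newton_julia_val ndy').
  set v' := lam ^+ (q * k.+1) * (g * z / z ^+ q).
  (* This ratio is 1 + O(1/|y|) and measures the failure of N to be linear in the field: v' =
     th^(q-1) lam V. *)
  pose th := lam * y / z.
  have lamn0 := lam_neq0.
  have thn0 : th != 0 by rewrite !mulf_neq0 ?invr_eq0.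
  have v'E : v' = th ^+ q.-1 * (lam * V).
    have e (x : C) : x ^+ q = x * x ^+ q.-1 by rewrite -exprS prednK.
    rewrite /v' /V /th mulnS exprD expr_div_n exprMn !e.
    by field; rewrite y0 zn0 !expf_neq0.
  have th1 : cmod (th - 1) <= K / cmod y / cmod z.
    have -> : th - 1 = - (z - lam * y) / z by rewrite /th; field.
    by rewrite cmod_div cmodN ler_pM2r ?invr_gt0.
  have Ky : K / cmod y <= 1 by rewrite ler_pdivrMr //; move: z4 yz; isolate; lra.
  have th2 : cmod (th - 1) <= K / cmod y.
    apply: le_trans th1 _; rewrite ler_pdivrMr // ler_peMr ?divr_ge0 ?(ltW K0) ?cmod_ge0 //.
    by move: z4 K0; isolate; lra.
  have th3 : cmod (th ^+ q.-1 - 1) <= c2 / cmod y.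
    apply: le_trans (hL _ (le_trans th2 Ky)) _.
    by rewrite /c2 -mulrA ler_pM2l.
  have lV : cmod (lam * V) = l * cmod V by rewrite cmodM.
  have vb : cmod (v' - lam * V) <= c2 / cmod y * (l * cmod V).
    have -> : v' - lam * V = (th ^+ q.-1 - 1) * (lam * V) by rewrite v'E; ring.
    by rewrite cmodM lV ler_wpM2r // mulr_ge0 // ltW.
  have vb2 : (1 - c2 / cmod y) * (l * cmod V) <= cmod v'.
    have := cmod_sub_ge (lam * V) (lam * V - v'); have -> : lam * V - (lam * V - v') = v' by ring.
    by rewrite (cmodBC _ v') lV; move: vb; isolate; lra.
  have E1 : cmod (nval y' - z - lam * (y' - y)) <= 2 * K / cmod y * cmod V.
    have -> : nval y' - z - lam * (y' - y) = - (nval y - nval y' - lam * (y - y')).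
      by rewrite Ny; ring.
    rewrite cmodN; apply: le_trans ayy _; rewrite cmodBC.
    have -> : 2 * K / cmod y * cmod V = K * (2 * cmod V) / cmod y by field; rewrite gt_eqF.
    by rewrite ler_pM2r ?invr_gt0 // ler_pM2l.
  have E2 : cmod (lam * (y' - y) - lam * V) <= l * ((eta / 2 + A / cmod y) * cmod V).
    by rewrite -mulrBr cmodM ler_pM2l.
  have tot : cmod (nval y' - z - v') <=
      (eta / 2 + A / cmod y + c1 / cmod y) * (l * cmod V).
    have -> : nval y' - z - v' = (nval y' - z - lam * (y' - y)) +
       ((lam * (y' - y) - lam * V) - (v' - lam * V)) by ring.
    have t1 := cmodD (nval y' - z - lam * (y' - y)) ((lam * (y' - y) - lam * V) - (v' - lam * V)).
    have t2 := cmodB (lam * (y' - y) - lam * V) (v' - lam * V).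
    have -> : (eta / 2 + A / cmod y + c1 / cmod y) * (l * cmod V) =
       2 * K / cmod y * cmod V + l * ((eta / 2 + A / cmod y) * cmod V) +
       c2 / cmod y * (l * cmod V).
      by rewrite /c1 /c2; field; rewrite !gt_eqF.
    by move: t1 t2 E1 E2 vb; isolate; lra.
  apply: le_trans tot _.
  apply: le_trans (_ : (eta / 2 + A / cmod z) * ((1 - c2 / cmod y) * (l * cmod V)) <= _); last first.
    apply: ler_wpM2l => //; apply: addr_ge0; last exact: divr_ge0 (ltW A0) (ltW zp).
    exact: divr_ge0 (ltW et0) (ler0n R 2).
  rewrite [leRHS]mulrA; apply: ler_wpM2r; first exact: mulr_ge0 (ltW l0) V0.
  have c2y : 0 <= c2 / cmod y := divr_ge0 (ltW c20) (ltW yp).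
  have key : (A + c1 + c2) / cmod y <= A / cmod z.
    rewrite ler_pdivrMr // mulrAC ler_pdivlMr //.
    apply: le_trans (_ : A * (rho * cmod z) <= _); last by rewrite ler_pM2l.
    rewrite mulrA ler_pM2r //.
    have -> : A + c1 + c2 = A * rho by rewrite /A; field; rewrite gt_eqF.
    by [].
  have s : (eta / 2 + A / cmod z) * (c2 / cmod y) <= c2 / cmod y.
    by rewrite ler_piMl //; move: et1 Az; isolate; lra.
  have -> : (eta / 2 + A / cmod z) * (1 - c2 / cmod y) =
     eta / 2 + A / cmod z - (eta / 2 + A / cmod z) * (c2 / cmod y) by ring.
  have -> : eta / 2 + A / cmod y + c1 / cmod y = eta / 2 + (A + c1 + c2) / cmod y - c2 / cmod y.
    by ring.
  by move: s key; isolate; lra.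
exists r => k z Jz hz; have [z' Jz' hz'] := main k z Jz hz; exists z' => //.
apply: le_trans hz' _; rewrite ler_wpM2r ?cmod_ge0 //.
move: hz; rewrite /r !ge_max => /andP[/andP[_ z2] /andP[z3 _]].
have zp : 0 < cmod z by lra.
have : A / cmod z <= eta / 2.
  by rewrite ler_pdivrMr //; rewrite ler_pdivrMr // in z3; move: z3; isolate; lra.
by move: ete; isolate; lra.
Qed.

(** Conjugation by the rotation turns z^(1-q) into a (z/a)^(1-q) = a^q z^(1-q). *)
Lemma drift_rot q g a : (forall z, J z <-> J (a * z)) -> cmod a = 1 ->
  drift q g -> drift q (a ^+ q * g).
Proof.
move=> ha a1 hd eta e0; have [r hr] := hd eta e0; exists r => k z Jz hz.
have a0 : a != 0 by rewrite -cmod_gt0 a1.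
have [x' Jx' hx'] := hr k (z / a) ltac:(by apply: (ha _).2; rewrite mulrC divfK)
  ltac:(by rewrite cmod_div a1 divr1).
exists (a * x'); first exact: (ha _).1.
have aq : a ^+ q != 0 by rewrite expf_neq0.
have e : lam ^+ (q * k) * (a ^+ q * g * z / z ^+ q) =
         a * (lam ^+ (q * k) * (g * (z / a) / (z / a) ^+ q)).
  by rewrite expr_div_n invf_div; move: (z ^+ q)^-1 => u; field; rewrite a0.
rewrite e cmodM a1 mul1r.
have -> : a * x' - z - a * (lam ^+ (q * k) * (g * (z / a) / (z / a) ^+ q)) =
   a * (x' - z / a - lam ^+ (q * k) * (g * (z / a) / (z / a) ^+ q)).
  by rewrite !mulrBr [a * (z / a)]mulrC divfK.
by rewrite cmodM a1 mul1r.
Qed.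

(** The displacement for [lam ^+ q * g] at level k is that for g at level k + 1, and the radius in
    [drift] is the same for all k. *)
Lemma drift_lam q g : drift q g -> drift q (lam ^+ q * g).
Proof.
move=> hd eta e0; have [r hr] := hd eta e0; exists r => k z Jz hz.
have := hr k.+1 z Jz hz; rewrite mulnS exprD.
have -> // : lam ^+ q * lam ^+ (q * k) * (g * z / z ^+ q) =
  lam ^+ (q * k) * (lam ^+ q * g * z / z ^+ q).
by rewrite !mulrA; congr (_ * _ / _); ring.
Qed.

Lemma drift1_translation be : (forall z, J z -> J (z + be)) -> drift1 1 be.
Proof.
move=> hb eta e0; exists 1 => z Jz hz; exists (z + be); first exact: hb.
have z0 : z != 0 by rewrite -cmod_gt0; lra.
have -> : z + be - z - be * z / z ^+ 1 = 0 by rewrite expr1; field.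
by rewrite cmod0 mulr_ge0 ?cmod_ge0 // ltW.
Qed.

(* z |-> a N(a^-1 N^-1(z)) preserves J and differs from the identity by the
   z^(1-n) term of the expansion of N at infinity. *)
Lemma drift1_rotation a : (forall z, J z <-> J (a * z)) -> cmod a = 1 ->
  drift1 n (h * n%:R / d ^+ 2 * lam ^+ n.-1 * (a ^+ n - 1)).
Proof.
move=> ha a1 eta e0; set g := _ * (a ^+ n - 1).
have a0 : a != 0 by rewrite -cmod_gt0 a1.
have [K K0 hK] := newton_asymptotics.
have [rho [r0 [rho1 r02 hpre]]] := newton_preimage.
have [L L0 hL] := power_near1 n.-1.
set l := cmod lam; have l0 : 0 < l := lam_gt0; have l1 : l < 1 := lam_lt1.
pose c := L * K / l + 3; have c0 : 0 < c by have := divr_gt0 (mulr_gt0 L0 K0) l0; rewrite /c; lra.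
exists (Num.max r0 (Num.max (K / l) (4 * c / eta))) => y Jy.
rewrite !ge_max => /andP[y1 /andP[y2 y3]].
have [x [x2 hx Nx]] := hpre y y1.
have yp : 0 < cmod y by lra.
have yx : cmod y <= cmod x by apply: le_trans hx; rewrite ler_peMl ?cmod_ge0 ?ltW.
have xp : 0 < cmod x by lra.
have x0 : x != 0 by rewrite -cmod_gt0.
have y0 : y != 0 by rewrite -cmod_gt0.
have [ndx ax _] := hK x x x2 x2; rewrite Nx in ax.
have Jx : J x by apply/(newton_julia_val ndx); rewrite Nx.
have Jxa : J (x / a) by apply: (ha _).2; rewrite mulrC divfK.
have xa2 : 2 <= cmod (x / a) by rewrite cmod_div a1 divr1.
have [ndxa _ _] := hK _ _ xa2 xa2.
exists (a * nval (x / a)).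
  by apply: (ha _).1; apply: (newton_julia_val ndxa).1.
have lamn0 := lam_neq0; have dn0 := d_neq0.
have hn0 := h_neq0.
pose th := y / (lam * x).
have th1 : cmod (th - 1) <= K / l / cmod x.
  have -> : th - 1 = (y - lam * x) / (lam * x) by rewrite /th; field; rewrite x0 lamn0.
  rewrite cmod_div cmodM -/l.
  have -> : K / l / cmod x = K / (l * cmod x) by field; rewrite !gt_eqF.
  rewrite ler_pM2r ?invr_gt0 ?mulr_gt0 //; apply: le_trans ax _.
  by rewrite ler_pdivrMr // ler_peMr ?(ltW K0) //; move: x2; isolate; lra.
have th2 : cmod (th - 1) <= 1.
  by apply: le_trans th1 _; rewrite ler_pdivrMr //; move: y2 yx; isolate; lra.
have th3 := hL _ th2.
pose X := x ^+ n; pose b := (a ^+ n)^-1.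
have X0 : X != 0 by rewrite expf_neq0.
have b0 : b != 0 by rewrite invr_eq0 expf_neq0.
have b1 : cmod b = 1 by rewrite cmodV cmodX a1 expr1n invr1.
have XnE : cmod x <= cmod X.
  by rewrite cmodX -[leLHS]expr1 ler_weXn2l //; move: x2; isolate; lra.
have md : cmod (m%:R / d) <= 1.
  rewrite cmod_div !cmod_nat ler_pdivrMr ?mul1r ?ler_nat ?leq_addr //.
  by rewrite ltr0n addn_gt0 n0 orbT.
(* The relative corrections of [nden] to its leading term at x / a and at x; both are O(1/|x|). *)
pose al := m%:R / d / (b * X); pose be := m%:R / d / X.
have halb (t : C) : cmod x <= cmod t -> cmod (m%:R / d / t) <= 1 / cmod x.
  move=> ht; rewrite cmod_div ler_pM ?cmod_ge0 ?invr_ge0 ?cmod_ge0 // lef_pV2 ?posrE //.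
  exact: lt_le_trans ht.
have hal : cmod al <= 1 / cmod x by apply: halb; rewrite cmodM b1 mul1r.
have hbe : cmod be <= 1 / cmod x by apply: halb.
have x12 : 1 / cmod x <= 1 / 2.
  by rewrite ler_pdivrMr // mulrC mulrA ler_pdivlMr //; move: x2; isolate; lra.
have ngt (t : C) : cmod t <= 1 / cmod x -> 1 / 2 <= cmod (1 - t).
  by have := cmod_sub_ge 1 t; rewrite cmod1; move: x12; isolate; lra.
have na := ngt _ hal; have nb := ngt _ hbe.
have na0 : 1 - al != 0 by rewrite -cmod_gt0; move: na; isolate; lra.
have nb0 : 1 - be != 0 by rewrite -cmod_gt0; move: nb; isolate; lra.
have ndE : nden x = d * X * (1 - be) by rewrite /newton_den /be -/X; field; rewrite -?natrD ?X0 ?dn0.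
have ndaE : nden (x / a) = d * (b * X) * (1 - al).
  have -> : nden (x / a) = d * (b * X) - m%:R by rewrite /newton_den expr_div_n mulrC /b -/X; ring.
  by rewrite /al; field; rewrite -?natrD ?X0 ?dn0 ?b0.
pose v := g * y / y ^+ n.
have thn0 : th != 0 by rewrite mulf_neq0 // invr_eq0 mulf_neq0.
have vE : v = h * n%:R / d ^+ 2 * (b^-1 - 1) * (x / X) / th ^+ n.-1.
  have e (t : C) : t ^+ n = t * t ^+ n.-1 by rewrite -exprS prednK.
  have bE : b^-1 = a ^+ n by rewrite /b invrK.
  rewrite /v /g bE /th expr_div_n exprMn /X (e y) (e x).
  by field; rewrite -?natrD ?x0 ?y0 ?dn0 ?lamn0 ?expf_neq0.
(* The linear parts lam x cancel exactly, and what remains is the expected displacement v times a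
   factor that tends to 1. *)
have diff : a * nval (x / a) - y = v * (th ^+ n.-1 / ((1 - al) * (1 - be))).
  have thp : th ^+ n.-1 != 0 by rewrite expf_neq0.
  have -> : v * (th ^+ n.-1 / ((1 - al) * (1 - be))) =
    h * n%:R / d ^+ 2 * (b^-1 - 1) * (x / X) / ((1 - al) * (1 - be)).
    by rewrite vE; field; rewrite -?natrD ?thp ?na0 ?nb0 ?X0 ?dn0 ?b0.
  rewrite -Nx /newton_val ndE ndaE.
  have ab : b * X * (1 - al) = b * (X * (1 - be)) + (b - 1) * (X * be).
    by rewrite /al /be; field; rewrite -?natrD ?X0 ?b0 ?dn0.
  have -> : a * (lam * (x / a) + h * n%:R / d * (x / a / (d * (b * X) * (1 - al)))) -
      (lam * x + h * n%:R / d * (x / (d * X * (1 - be)))) =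
      h * n%:R / d ^+ 2 * x * ((b * X * (1 - al))^-1 - (X * (1 - be))^-1).
    by field; rewrite -?natrD ?a0 ?X0 ?dn0 ?b0 ?na0 ?nb0.
  have -> : (b * X * (1 - al))^-1 - (X * (1 - be))^-1 =
      (X * (1 - be) - b * X * (1 - al)) / (b * X * (1 - al) * (X * (1 - be))).
    by field; rewrite X0 b0 na0 nb0.
  have -> : X * (1 - be) - b * X * (1 - al) = (1 - b) * X.
    by rewrite ab; ring.
  by field; rewrite -?natrD ?X0 ?dn0 ?b0 ?na0 ?nb0.
have -> : a * nval (x / a) - y - g * y / y ^+ n =
   v * ((th ^+ n.-1 - (1 - al) * (1 - be)) / ((1 - al) * (1 - be))).
  by rewrite diff -/v; field; rewrite na0 nb0.
rewrite cmodM -/v mulrC ler_wpM2r ?cmod_ge0 // cmod_div ler_pdivrMr; last first.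
  by rewrite cmod_gt0 mulf_neq0.
have q : 1 / 4 <= cmod ((1 - al) * (1 - be)).
  have -> : 1 / 4 = (1 / 2) * (1 / 2) :> R by field.
  by rewrite cmodM ler_pM // ltW // divr_gt0.
apply: le_trans (_ : eta * (1 / 4) <= _); last by rewrite ler_pM2l.
have -> : th ^+ n.-1 - (1 - al) * (1 - be) = (th ^+ n.-1 - 1) + (al + be * (1 - al)) by ring.
apply: le_trans (cmodD _ _) _.
have q2 : cmod (al + be * (1 - al)) <= 3 / cmod x.
  apply: le_trans (cmodD _ _) _; rewrite [cmod (be * _)]cmodM.
  have k1 : cmod (1 - al) <= 2.
    by have := cmodB 1 al; rewrite cmod1; move: hal x12; isolate; lra.
  have -> : 3 / cmod x = 1 / cmod x + 1 / cmod x * 2 by field; rewrite gt_eqF.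
  by apply: lerD => //; rewrite ler_pM ?cmod_ge0.
have q3 : cmod (th ^+ n.-1 - 1) <= L * K / l / cmod x.
  apply: le_trans th3 _; rewrite -!mulrA ler_pM2l // !mulrA //.
have q4 : c / cmod x <= eta / 4.
  rewrite ler_pdivrMr //; rewrite ler_pdivrMr // in y3; move: y3 yx e0; isolate; nra.
have : c / cmod x = L * K / l / cmod x + 3 / cmod x by rewrite /c mulrDl.
by move: q2 q3 q4; isolate; lra.
Qed.

(** The directions 1, -1, kap, -kap positively span the plane, so one of them has a uniformly
    positive component along any given vector. *)
Lemma positive_direction kap : im kap != 0 -> exists2 c : R, 0 < c <= 1 &
  forall w, exists2 s, s \in [:: 1; -1; kap; - kap] & c * cmod w <= re (w * s).
Proof.
move=> k0; have kq : 0 < `|im kap| by rewrite normr_gt0.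
set B := 1 + (1 + `|re kap|) / `|im kap|.
have q0 : 0 <= (1 + `|re kap|) / `|im kap| by rewrite divr_ge0 // addr_ge0.
have B1 : 1 <= B by rewrite /B; lra.
exists B^-1.
  rewrite invr_gt0 (lt_le_trans ltr01 B1) /=.
  by rewrite invf_le1 // (lt_le_trans ltr01 B1).
move=> w; have Bp : 0 < B by lra.
suff [s hs le] : exists2 s, s \in [:: 1; kap] & cmod w <= B * `|re (w * s)|.
  have [h0|h0] := leP 0 (re (w * s)).
    exists s; first by move: hs; rewrite !inE => /orP[] ->; rewrite ?orbT.
    by rewrite mulrC ler_pdivrMr // mulrC; rewrite ger0_norm in le.
  exists (- s).
    by move: hs; rewrite !inE => /orP[/eqP ->|/eqP ->]; rewrite eqxx ?orbT.
  by rewrite mulrN reN mulrC ler_pdivrMr // mulrC; rewrite ltr0_norm in le.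
have hw := cmod_le_ReIm w.
have e1 : re (w * 1) = re w by rewrite mulr1.
have e2 : re (w * kap) = re w * re kap - im w * im kap by rewrite reM.
set T1 := `|re (w * 1)|; set T2 := `|re (w * kap)|.
have hb : `|im w| * `|im kap| <= T2 + `|re w| * `|re kap|.
  rewrite -!normrM /T2 e2.
  have := ler_normB (re w * re kap) (re w * re kap - im w * im kap).
  by rewrite opprB addrC subrK addrC.
have bnd (T : R) : 0 <= T -> `|re w| <= T -> T2 <= T -> cmod w <= B * T.
  move=> T0 b1 b2; apply: le_trans hw _; rewrite /B mulrDl mul1r lerD //.
  rewrite mulrAC ler_pdivlMr //; apply: le_trans hb _.
  by rewrite mulrDl mul1r lerD // mulrC ler_wpM2l.
case: (leP T1 T2) => hT.
  exists kap; first by rewrite !inE eqxx orbT.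
  by apply: bnd => //; rewrite -e1.
by exists 1; rewrite ?inE ?eqxx //; apply: bnd; rewrite -?e1 // ltW.
Qed.

(** Law of cosines: in |D - v|^2 the cross term, at least 2 c |D| b, outweighs |v|^2 by c |D| b, and
    (|D| - c b / 2)^2 loses no more than that. *)
Lemma step_closer (D v : C) (c b : R) : 0 < c <= 1 -> 0 <= b ->
  c * (cmod D * b) <= re (conjc D * v) -> cmod v ^+ 2 <= c * cmod D * b ->
  c * b <= 2 * cmod D -> cmod (D - v) <= cmod D - c * b / 2.
Proof.
move=> /andP[c0 c1] b0 hre hv hcb.
have D0 := cmod_ge0 D.
rewrite -(@ler_pXn2r _ 2) ?nnegrE ?cmod_ge0 //; last by lra.
have -> : cmod (D - v) ^+ 2 = cmod D ^+ 2 - 2 * re (conjc D * v) + cmod v ^+ 2.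
  by rewrite !cmod_sq !ReImE; ring.
have : 0 <= (c * b / 2) ^+ 2 by apply: sqr_ge0.
rewrite sqrrB; lra.
Qed.

Lemma no_transverse_drift q g kap : (0 < q)%N -> g != 0 -> im kap != 0 ->
  drift q g -> drift q (- g) -> drift q (kap * g) -> drift q (- (kap * g)) -> False.
Proof.
move=> q0 g0 k0 d1 d2 d3 d4.
have [c c01 hc] := positive_direction k0; have [c0 c1] := andP c01.
set S := 1 + cmod kap; have S1 : 1 <= S by rewrite lerDl cmod_ge0.
have Sp : 0 < S by lra.
pose eta := c / (4 * S); have eta0 : 0 < eta by rewrite divr_gt0 // mulr_gt0.
have [r hr] : exists r : R, forall s, s \in [:: 1; -1; kap; - kap] -> forall k z, J z ->
    r <= cmod z -> exists2 z', J z' &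
      cmod (z' - z - s * (lam ^+ (q * k) * (g * z / z ^+ q))) <=
      eta * (cmod s * cmod (lam ^+ (q * k) * (g * z / z ^+ q))).
  have [r1 hr1] := d1 _ eta0; have [r2 hr2] := d2 _ eta0.
  have [r3 hr3] := d3 _ eta0; have [r4 hr4] := d4 _ eta0.
  exists (Num.max (Num.max r1 r2) (Num.max r3 r4)) => s hs k z Jz.
  rewrite !ge_max => /andP[/andP[z1 z2] /andP[z3 z4]].
  set v := lam ^+ (q * k) * (g * z / z ^+ q).
  have e a : lam ^+ (q * k) * (a * g * z / z ^+ q) = a * v by rewrite /v; ring.
  move: hs; rewrite !inE => /or4P[] /eqP ->; rewrite -cmodM.
  - by have := hr1 k z Jz z1; rewrite -/v mul1r.
  - by have := hr2 k z Jz z2; rewrite -[- g]mulN1r e.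
  - by have := hr3 k z Jz z3; rewrite e.
  - by have := hr4 k z Jz z4; rewrite -[- (kap * g)]mulNr e.
have smax s : s \in [:: 1; -1; kap; - kap] -> cmod s <= S.
  have := cmod_ge0 kap; rewrite !inE => ck /or4P[] /eqP ->; rewrite ?cmodN ?cmod1 /S; lra.
have [z0 [hz0 Jz0 hF]] := newton_far_boundary (2 * `|r| + 2).
have rn := ler_norm r; have rn0 := normr_ge0 r.
set M := cmod z0 in hz0; have M2 : 2 <= M by move: hz0 rn rn0; isolate; lra.
have [y hy Fy] := hF (M / 8) ltac:(lra).
(* The infimum [dl] is the distance from the Fatou point y to J. As y is within M/8 of z0, nearly
   closest points have modulus between 5M/8 and 2M. *)
pose A : set R := fun (t : R) => exists2 z, J z & t = cmod (z - y).
have Abd : has_lbound A by exists 0 => t [z _ ->]; apply: cmod_ge0.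
have A0 : A (cmod (z0 - y)) by exists z0.
have infA : has_inf A by split=> //; exists (cmod (z0 - y)).
set dl := inf A.
have dle : dl <= cmod (z0 - y) by apply: ge_inf.
have dl0 : 0 < dl.
  have [e e0 he] := fatou_near Fy.
  apply: lt_le_trans e0 _; apply: lb_le_inf; first by exists (cmod (z0 - y)).
  move=> t [z Jz ->]; rewrite leNgt; apply/negP => /he; exact: Jz.
rewrite cmodBC in hy.
have l0 := lam_gt0; have l1 := lam_lt1.
have gp : 0 < cmod g by rewrite cmod_gt0.
(* K is so large that the displacement is short compared with dl, as [step_closer] demands for
   directions of modulus up to S. *)
have [K hK] := @pow_small R (cmod lam) (c * dl / (S ^+ 2 * cmod g))
  ltac:(by rewrite (ltW l0) l1) ltac:(by rewrite !(divr_gt0, mulr_gt0, exprn_gt0)).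
have {hK} hK := hK (q * K)%N (leq_pmull _ q0).
set L := cmod lam ^+ (q * K) in hK; have L0 : 0 < L by rewrite exprn_gt0.
rewrite ltr_pdivlMr ?mulr_gt0 ?exprn_gt0 // in hK.
pose b := ((2 * M) ^+ q.-1)^-1.
have b0 : 0 < b by rewrite invr_gt0 exprn_gt0 //; move: M2; isolate; lra.
(* A step approaches y by c |v0| / 2 up to an error c |v0| / 4, and |v0| >= L |g| b on the region. A
   point within [gain] of the infimum is thus moved below it. *)
pose gain := c / 4 * (L * cmod g * b).
have c4 : 0 < c / 4 by rewrite divr_gt0.
have gain0 : 0 < gain by apply: mulr_gt0 => //; apply: mulr_gt0 => //; apply: mulr_gt0.
have mn0 : 0 < Num.min gain (M / 8) by rewrite lt_min gain0; move: M2; isolate; lra.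
have [t [z Jz ->] hz] := inf_adherent mn0 infA.
have [z1 z2] : cmod (z - y) < dl + gain /\ cmod (z - y) < dl + M / 8.
  rewrite -/dl in hz; have : Num.min gain (M / 8) <= gain by rewrite ge_min lexx.
  have : Num.min gain (M / 8) <= M / 8 by rewrite ge_min lexx orbT.
  by move=> g1 g2; split; move: hz g1 g2; isolate; lra.
have zz0 := cmod_tri y z z0; rewrite (cmodBC y z0) in zz0.
have zlo : 5 / 8 * M <= cmod z.
  have := cmod_sub_ge z0 (z0 - z); have -> : z0 - (z0 - z) = z by ring.
  by rewrite (cmodBC z0 z) -/M; move: zz0 z2 hy dle; isolate; lra.
have zhi : cmod z <= 2 * M.
  by have := cmodD (z - z0) z0; rewrite subrK -/M; move: zz0 z2 hy dle M2; isolate; lra.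
have zp : 0 < cmod z by move: M2 zlo; isolate; lra.
have zn0 : z != 0 by rewrite -cmod_gt0.
set v0 := lam ^+ (q * K) * (g * z / z ^+ q).
have v0E : cmod v0 = L * cmod g / cmod z ^+ q.-1.
  have -> : v0 = lam ^+ (q * K) * g / z ^+ q.-1.
    have e : z ^+ q = z * z ^+ q.-1 by rewrite -exprS prednK.
    by rewrite /v0 e; field; rewrite zn0 expf_neq0.
  by rewrite cmod_div cmodM !cmodX.
have Lg : 0 < L * cmod g by rewrite mulr_gt0.
have vup : cmod v0 <= L * cmod g.
  rewrite v0E ler_pdivrMr ?exprn_gt0 // ler_peMr ?(ltW Lg) // exprn_ege1 //.
  by move: M2 zlo; isolate; lra.
have vlo : L * cmod g * b <= cmod v0.
  have M0 : 0 < 2 * M by move: M2; isolate; lra.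
  rewrite v0E ler_pM2l // /b lef_pV2 ?posrE ?exprn_gt0 //.
  by rewrite lerXn2r ?nnegrE ?(ltW zp) // ltW.
have vp : 0 < cmod v0 by apply: lt_le_trans vlo; rewrite mulr_gt0.
pose D := y - z.
have DE : cmod D = cmod (z - y) by rewrite /D cmodBC.
have Dl : dl <= cmod D by rewrite DE; apply: ge_inf => //; exists z.
have [s hs hle] := hc (conjc D * v0).
have sS := smax s hs.
have S2 : S ^+ 2 * cmod v0 <= c * cmod D.
  have S20 : 0 < S ^+ 2 by rewrite exprn_gt0.
  have a1 : S ^+ 2 * cmod v0 <= S ^+ 2 * (L * cmod g) by rewrite ler_pM2l.
  have a2 : c * dl <= c * cmod D by rewrite ler_pM2l.
  by move: a1 a2 hK; isolate; lra.
have S21 : 1 <= S ^+ 2 by rewrite exprn_ege1.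
have cD : c * cmod D <= cmod D by rewrite ler_piMl ?cmod_ge0.
have vS : cmod v0 <= S ^+ 2 * cmod v0 by rewrite ler_peMl ?cmod_ge0.
have sc : cmod (D - s * v0) <= cmod D - c * cmod v0 / 2.
  apply: step_closer => //; first exact: ltW.
  - have -> : conjc D * (s * v0) = conjc D * v0 * s by ring.
    by move: hle; rewrite cmodM cmodJ.
  - rewrite cmodM exprMn [cmod v0 ^+ 2]expr2 mulrA ler_pM2r //.
    apply: le_trans S2; rewrite ler_pM2r //.
    by rewrite lerXn2r ?nnegrE ?cmod_ge0 // ltW.
  - have : c * cmod v0 <= cmod v0 by rewrite ler_piMl ?cmod_ge0.
    have := cmod_ge0 D; move: vS S2 cD; isolate; lra.
have [z' Jz' hz'] := hr s hs K z Jz ltac:(move: zlo hz0 rn M2; isolate; lra).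
rewrite -/v0 in hz'.
have : dl <= cmod (z' - y) by apply: ge_inf => //; exists z'.
have : cmod (z' - y) <= cmod (z' - z - s * v0) + cmod (D - s * v0).
  have -> : z' - y = (z' - z - s * v0) - (D - s * v0) by rewrite /D; ring.
  exact: cmodB.
have : eta * (cmod s * cmod v0) <= c / 4 * cmod v0.
  rewrite mulrA ler_pM2r // /eta.
  have -> : c / 4 = c / (4 * S) * S by field; rewrite gt_eqF.
  by rewrite ler_pM2l // divr_gt0 // mulr_gt0.
have : gain <= c / 4 * cmod v0 by rewrite /gain ler_pM2l // divr_gt0.
by move: hz' sc z1 DE; isolate; lra.
Qed.

(** The powers of w sum to 0, so n is the sum of the 1 - w^i, each at most i |1 - w| in modulus; the
    total is |1 - w| n (n - 1)/2. *)
Lemma unity_root_gap w : w ^+ n = 1 -> w != 1 -> 2 <= cmod (1 - w) * (n%:R - 1).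
Proof.
move=> wn w1.
have w0 : \sum_(i < n) w ^+ i = 0.
  apply/eqP; have /eqP := subrX1 w n; rewrite wn subrr eq_sym mulf_eq0 subr_eq0.
  by rewrite (negPf w1).
have cw := unity_root_cmod n0 wn.
have pw i : cmod (1 - w ^+ i) <= i%:R * cmod (1 - w).
  elim: i => [|i IH]; first by rewrite expr0 subrr cmod0 mul0r.
  have -> : 1 - w ^+ i.+1 = (1 - w ^+ i) + w ^+ i * (1 - w) by rewrite exprSr; ring.
  apply: le_trans (cmodD _ _) _; rewrite cmodM cmodX cw expr1n mul1r -natr1 mulrDl mul1r.
  by rewrite lerD.
have e : (n%:R : C) = \sum_(i < n) (1 - w ^+ i).
  by rewrite sumrB w0 subr0 sumr_const card_ord.
have : n%:R <= (\sum_(i < n) i%:R) * cmod (1 - w).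
  rewrite -(cmod_nat R n) e mulr_suml; apply: le_trans (cmod_sum _ _) _.
  by apply: ler_sum => i _.
have -> : \sum_(i < n) (i%:R : R) = n%:R * (n%:R - 1) / 2.
  elim: (n) => [|k IH]; first by rewrite big_ord0 !mul0r.
  by rewrite big_ord_recr /= IH -natr1; field.
have np : 0 < n%:R :> R by rewrite ltr0n.
have -> : n%:R * (n%:R - 1) / 2 * cmod (1 - w) = n%:R * (cmod (1 - w) * (n%:R - 1) / 2).
  by field.
by rewrite -[leLHS]mulr1 ler_pM2l //; lra.
Qed.

(** For nonreal lam, w = lam / conj lam is an n-th root of unity other than 1, and its distance 2
    |im lam| / |lam| from 1 is at least 2/(n - 1). But d lam lies in the unit disc about c = d - 1,
    where the sine of the argument is below 1/c <= 1/(n - 1). *)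
Lemma lam_pow_real : im (lam ^+ n) = 0 -> im h = 0.
Proof.
move=> hr; have l0 := lam_neq0.
have dE : d = (((m + n)%:R : R)%:C)%C by rewrite rmorph_nat.
suff il : im lam = 0.
  have hE : h = d - d * lam by rewrite dlamE //; ring.
  by rewrite [LHS](congr1 (@complex.Im R) hE) imD imN imM il dE /=; ring.
apply/eqP; apply: contraT => il.
pose w := lam / conjc lam.
have cl0 : conjc lam != 0 by rewrite conjc_eq0.
have wn : w ^+ n = 1.
  rewrite /w expr_div_n -rmorphXn /=.
  have -> : conjc (lam ^+ n) = lam ^+ n.
    by apply: complex_eq; rewrite ?reJ ?imJ ?hr ?oppr0.
  by rewrite divff // expf_neq0.
have w1 : w != 1.
  apply: contra il => /eqP e; have e2 : lam = conjc lam.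
    by rewrite -[LHS](divfK cl0) -/w e mul1r.
  by have := congr1 (@complex.Im R) e2; rewrite imJ => /eqP; rewrite -addr_eq0 -mulr2n mulrn_eq0.
have gap := unity_root_gap wn w1.
have lp : 0 < cmod lam by rewrite cmod_gt0.
have e1 : cmod (1 - w) = 2 * `|im lam| / cmod lam.
  have -> : 1 - w = (conjc lam - lam) / conjc lam by rewrite /w; field.
  rewrite cmod_div cmodJ; congr (_ / _).
  apply/eqP; rewrite -(@eqrXn2 _ 2) ?cmod_ge0 ?mulr_ge0 //; apply/eqP.
  by rewrite cmod_sq !ReImE exprMn real_normK ?num_real //; ring.
set X := re lam in il *; set Y := im lam in il e1 *.
rewrite e1 mulrAC ler_pdivlMr // in gap.
set D : R := (m + n)%:R; set c := D - 1.
have cn : n%:R - 1 <= c by rewrite /c /D lerB // ler_nat leq_addl.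
have c1 : 1 <= c by have := d_ge2; rewrite /c /D; lra.
have nn : 0 <= n%:R - 1 :> R by rewrite subr_ge0 ler1n.
have cl := dh_close; rewrite -dlamE // in cl.
have hc : (D * X - c) ^+ 2 + (D * Y) ^+ 2 < 1.
  have : cmod (d * lam - (d - 1)) ^+ 2 < 1.
    by rewrite -[ltRHS](expr1n _ 2) ltrXn2r ?nnegrE ?cmod_ge0.
  rewrite cmod_sq.
  have -> : re (d * lam - (d - 1)) = D * X - c.
    by rewrite dE reD reN reD reN reM /= -/X -/D /c; ring.
  have -> // : im (d * lam - (d - 1)) = D * Y.
  by rewrite dE imD imN imD imN imM /= -/Y -/D; ring.
have D0 : 0 < D by have := d_ge2; rewrite /D; lra.
(* The tangents from 0 to the unit circle about c have sine 1/c. For c = 1 the first term of the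
   identity vanishes, and strictness comes from D X <> 0 instead. *)
have lt1 : c ^+ 2 * (D * Y) ^+ 2 < (D * X) ^+ 2 + (D * Y) ^+ 2.
  have e : (D * X) ^+ 2 + (D * Y) ^+ 2 - c ^+ 2 * (D * Y) ^+ 2 =
    (c ^+ 2 - 1) * (1 - ((D * X - c) ^+ 2 + (D * Y) ^+ 2)) + (c * (D * X) - (c ^+ 2 - 1)) ^+ 2.
    by ring.
  rewrite -subr_gt0 e; move: (D * X) (D * Y) hc => x y hxy.
  have sq := sqr_ge0 (c * x - (c ^+ 2 - 1)).
  have [cgt|] := ltP 1 c.
    have : 0 < (c ^+ 2 - 1) * (1 - ((x - c) ^+ 2 + y ^+ 2)).
      by rewrite mulr_gt0 ?subr_gt0 // exprn_egt1.
    lra.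
  move=> cle; have -> : c = 1 by lra.
  rewrite expr1n subrr mul0r add0r subr0 mul1r exprn_even_gt0 //=.
  apply/eqP => x0; have ce : c = 1 by lra.
  by move: hxy; rewrite x0 ce sub0r sqrrN expr1n; have := sqr_ge0 y; lra.
have l2 : cmod lam ^+ 2 = X ^+ 2 + Y ^+ 2 := cmod_sq lam.
have a1 : cmod lam <= `|Y| * c.
  have : `|Y| * (n%:R - 1) <= `|Y| * c by rewrite ler_wpM2l.
  lra.
have a2 : cmod lam ^+ 2 <= (`|Y| * c) ^+ 2.
  by rewrite lerXn2r ?nnegrE ?cmod_ge0 ?mulr_ge0 //; lra.
rewrite l2 exprMn real_normK ?num_real // in a2.
have a3 : D ^+ 2 * (X ^+ 2 + Y ^+ 2) <= D ^+ 2 * (Y ^+ 2 * c ^+ 2).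
  by rewrite ler_pM2l // exprn_gt0.
rewrite !exprMn in lt1; lra.
Qed.

(** * Real parameters *)

Lemma power_second_order q : exists2 B : R, 0 < B & forall t : C, cmod t <= 1 ->
  cmod ((1 + t) ^+ q - 1 - q%:R * t) <= B * cmod t ^+ 2.
Proof.
elim: q => [|q [B B0 IH]].
  by exists 1 => // t _; rewrite expr0 mul0r subrr subr0 cmod0 mul1r sqr_ge0.
exists (2 * B + q%:R) => [|t ht]; first by rewrite ltr_wpDr ?mulr_gt0.
have -> : (1 + t) ^+ q.+1 - 1 - q.+1%:R * t =
    (1 + t) * ((1 + t) ^+ q - 1 - q%:R * t) + q%:R * t ^+ 2.
  by rewrite exprS -natr1; ring.
apply: le_trans (cmodD _ _) _; rewrite [cmod ((1 + t) * _)]cmodM [cmod (q%:R * _)]cmodM cmod_nat cmodX mulrDl lerD //.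
rewrite -mulrA ler_pM ?cmod_ge0 ?IH //.
by apply: le_trans (cmodD _ _) _; rewrite cmod1; lra.
Qed.

(** In the coordinate z^q the field g z^(1-q) becomes the constant field q g, up to terms that
    vanish at infinity. *)
Lemma drift1_power q g : (0 < q)%N -> drift1 q g -> forall e : R, 0 < e ->
  exists r : R, forall z, J z -> r <= cmod z ->
    exists2 z', J z' & cmod (z' ^+ q - z ^+ q - q%:R * g) <= e.
Proof.
move=> q0 hd e e0; have [B B0 hB] := power_second_order q.
pose G := q%:R * cmod g + 1; have G0 : 0 < G by rewrite ltr_wpDl ?mulr_ge0 ?cmod_ge0.
pose eta := Num.min 1 (e / (2 * G)).
have eta0 : 0 < eta by rewrite lt_min ltr01 divr_gt0 // mulr_gt0.
have [r hr] := hd eta eta0.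
exists (Num.max r (Num.max (1 + 2 * cmod g) (8 * B * cmod g ^+ 2 / e))) => z Jz.
rewrite !ge_max => /andP[z1 /andP[z2 z3]].
have [z' Jz' hz'] := hr z Jz z1; exists z' => //.
have g0 := cmod_ge0 g.
have zp : 0 < cmod z by lra.
have zn0 : z != 0 by rewrite -cmod_gt0.
have zq0 : z ^+ q != 0 by rewrite expf_neq0.
set v := g * z / z ^+ q in hz'.
pose ta := (z' - z) / z; pose er := z' - z - v.
have zq : cmod z <= cmod (z ^+ q).
  by rewrite cmodX -[leLHS]expr1 ler_weXn2l //; lra.
have e1 : eta <= 1 by rewrite ge_min lexx.
have e2 : eta <= e / (2 * G) by rewrite ge_min lexx orbT.
have vz : cmod (v / z) = cmod g / cmod (z ^+ q).
  by rewrite -cmod_div; congr cmod; rewrite /v; field; rewrite zq0 zn0.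
have zqp : 0 < cmod (z ^+ q) by rewrite cmod_gt0.
have erz : cmod (er / z) <= eta * (cmod g / cmod (z ^+ q)).
  rewrite -vz cmod_div [cmod (v / z)]cmod_div mulrA ler_pM2r ?invr_gt0 //.
have gz : 0 <= cmod g / cmod (z ^+ q) by rewrite divr_ge0 ?cmod_ge0.
have taE : ta = v / z + er / z by rewrite /ta /er; field.
have ta1 : cmod ta <= 2 * (cmod g / cmod (z ^+ q)).
  rewrite taE; apply: le_trans (cmodD _ _) _; rewrite vz.
  have : eta * (cmod g / cmod (z ^+ q)) <= 1 * (cmod g / cmod (z ^+ q)).
    by rewrite ler_wpM2r.
  lra.
have ta2 : cmod ta <= 1.
  apply: le_trans ta1 _; rewrite mulrA ler_pdivrMr //; lra.
have z'E : z' = z * (1 + ta) by rewrite /ta; field.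
have -> : z' ^+ q - z ^+ q - q%:R * g =
   z ^+ q * ((1 + ta) ^+ q - 1 - q%:R * ta) + q%:R * (z ^+ q * (er / z)).
  have -> : q%:R * (z ^+ q * (er / z)) = q%:R * (z ^+ q * ta) - q%:R * g.
    by rewrite taE /v; field; rewrite zq0 zn0.
  by rewrite z'E exprMn; ring.
apply: le_trans (cmodD _ _) _.
have b1 : cmod (z ^+ q * ((1 + ta) ^+ q - 1 - q%:R * ta)) <= e / 2.
  rewrite cmodM; apply: le_trans (_ : cmod (z ^+ q) * (B * (2 * (cmod g / cmod (z ^+ q))) ^+ 2) <= _).
    rewrite ler_pM2l //; apply: le_trans (hB _ ta2) _; rewrite ler_pM2l //.
    have t2 : 0 <= 2 * (cmod g / cmod (z ^+ q)) by apply: mulr_ge0.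
    by rewrite lerXn2r ?nnegrE ?cmod_ge0.
  have -> : cmod (z ^+ q) * (B * (2 * (cmod g / cmod (z ^+ q))) ^+ 2) =
     4 * B * cmod g ^+ 2 / cmod (z ^+ q) by field; rewrite gt_eqF.
  rewrite ler_pdivrMr //; rewrite ler_pdivrMr // in z3.
  have : cmod z * e <= cmod (z ^+ q) * e by rewrite ler_pM2r.
  lra.
have b2 : cmod (q%:R * (z ^+ q * (er / z))) <= e / 2.
  rewrite cmodM cmod_nat cmodM.
  have : cmod (z ^+ q) * cmod (er / z) <= cmod (z ^+ q) * (eta * (cmod g / cmod (z ^+ q))).
    by rewrite ler_pM2l.
  have -> : cmod (z ^+ q) * (eta * (cmod g / cmod (z ^+ q))) = eta * cmod g.
    by field; rewrite gt_eqF.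
  move=> a1; have a2 := ler_wpM2l (ler0n R q) a1; apply: le_trans a2 _.
  have -> : q%:R * (eta * cmod g) = eta * (q%:R * cmod g) by ring.
  have a3 : eta * (q%:R * cmod g) <= eta * G by rewrite ler_pM2l // /G; lra.
  have a4 : eta * G <= e / (2 * G) * G by rewrite ler_pM2r.
  have a5 : e / (2 * G) * G = e / 2 by field; rewrite gt_eqF.
  lra.
lra.
Qed.

(* Iterating the constant drift of z^q carries J along the whole ray. *)
Lemma long_drift q u (gam : R) eps : (0 < q)%N -> cmod u = 1 -> 0 < gam ->
  drift1 q (u ^+ q * (gam%:C)%C) -> eps ^+ q = -1 -> (forall z, J z <-> J (eps * z)) ->
  forall eta : R, 0 < eta -> exists X0 : R, forall X, X0 <= X ->
    exists2 z, J z & cmod (z ^+ q - u ^+ q * (X%:C)%C) <= eta * X.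
Proof.
move=> q0 u1 gam0 hd heps hJ eta0 eta00.
pose eta := Num.min (1 / 4) (eta0 / 2).
have eta_gt0 : 0 < eta by rewrite lt_min; apply/andP; split; lra.
have et4 : eta <= 1 / 4 by rewrite ge_min lexx.
have et2 : eta <= eta0 / 2 by rewrite ge_min lexx orbT.
set U := u ^+ q; have U1 : cmod U = 1 by rewrite cmodX u1 expr1n.
pose s := q%:R * gam; have s0 : 0 < s by rewrite mulr_gt0 // ltr0n.
have [r hr] := drift1_power q0 hd (mulr_gt0 eta_gt0 s0).
pose r1 := Num.max 1 r; have r11 : 1 <= r1 by rewrite le_max lexx.
have rr1 : r <= r1 by rewrite le_max lexx orbT.
(* The symmetry [eps] reverses the sign of z^q, so the start may be chosen on the forward side of U;
   walking along U then keeps z^q away from 0, where the drift estimate holds. *)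
have [z0 [hz0 Jz0]] : exists z0, [/\ 2 * r1 <= cmod z0, J z0 & 0 <= re (conjc U * z0 ^+ q)].
  have [z0 [hz0 Jz0 _]] := newton_far_boundary (2 * r1).
  have [hre|hre] := leP 0 (re (conjc U * z0 ^+ q)); first by exists z0.
  exists (eps * z0); split.
  - have ce : cmod eps = 1.
      have : cmod eps ^+ q = 1 by rewrite -cmodX heps cmodN cmod1.
      by move/eqP; rewrite pexpr_eq1 ?cmod_ge0 // => /eqP.
    by rewrite cmodM ce mul1r.
  - exact: (hJ _).1.
  - by rewrite exprMn heps mulN1r mulrN reN oppr_ge0 ltW.
move=> hre; set zeta := z0 ^+ q in hre.
have zb : 2 * r1 ^+ q <= cmod zeta.
  rewrite cmodX; apply: le_trans (_ : (2 * r1) ^+ q <= _); last first.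
    by rewrite lerXn2r ?nnegrE ?cmod_ge0 //; lra.
  rewrite exprMn ler_pM2r; last by rewrite exprn_gt0 //; lra.
  by rewrite -[leLHS]expr1 ler_weXn2l // ler1n.
have walk j : exists2 z, J z & cmod (z ^+ q - zeta - U * ((j%:R * s)%:C)%C) <= j%:R * (eta * s).
  elim: j => [|j [z Jz hz]].
    by exists z0 => //; rewrite -/zeta subrr !mul0r mulr0 subr0 cmod0.
  have js0 : 0 <= j%:R * s by rewrite mulr_ge0 // ltW.
  have lo : cmod zeta / 2 + j%:R * s / 2 <= cmod (zeta + U * ((j%:R * s)%:C)%C).
    set T := j%:R * s in js0 *.
    rewrite -(@ler_pXn2r _ 2) ?nnegrE ?cmod_ge0 ?addr_ge0 ?divr_ge0 ?cmod_ge0 //.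
    have -> : cmod (zeta + U * (T%:C)%C) ^+ 2 =
      cmod zeta ^+ 2 + T ^+ 2 + 2 * T * re (conjc U * zeta).
      have uu := cmod_sq U; rewrite U1 expr1n in uu.
      rewrite !cmod_sq !ReImE /=.
      have -> : T ^+ 2 = T ^+ 2 * (re U ^+ 2 + im U ^+ 2) by rewrite -uu mulr1.
      by ring.
    have : 0 <= 2 * T * re (conjc U * zeta).
      by apply: mulr_ge0 => //; apply: mulr_ge0.
    have := sqr_ge0 (cmod zeta - T); have := sqr_ge0 T; have := sqr_ge0 (cmod zeta).
    rewrite sqrrB sqrrD; lra.
  have zlo : r1 ^+ q <= cmod (z ^+ q).
    have := cmod_add_ge (zeta + U * ((j%:R * s)%:C)%C) (z ^+ q - zeta - U * ((j%:R * s)%:C)%C).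
    have -> : zeta + U * ((j%:R * s)%:C)%C + (z ^+ q - zeta - U * ((j%:R * s)%:C)%C) = z ^+ q.
      by ring.
    have : j%:R * (eta * s) <= j%:R * s / 4.
      have -> : j%:R * (eta * s) = eta * (j%:R * s) by ring.
      have := ler_wpM2r js0 et4; lra.
    lra.
  have zr : r <= cmod z.
    apply: le_trans rr1 _; rewrite -(@ler_pXn2r _ q) ?nnegrE ?cmod_ge0 //; last by lra.
    by rewrite -cmodX.
  have [z' Jz' hz'] := hr z Jz zr; exists z' => //.
  have -> : z' ^+ q - zeta - U * ((j.+1%:R * s)%:C)%C =
    (z' ^+ q - z ^+ q - q%:R * (U * (gam%:C)%C)) + (z ^+ q - zeta - U * ((j%:R * s)%:C)%C).
    have -> : ((j.+1%:R * s)%:C)%C = ((j%:R * s)%:C)%C + q%:R * (gam%:C)%C.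
      have <- : (s%:C)%C = q%:R * (gam%:C)%C by rewrite /s rmorphM /= rmorph_nat.
      by rewrite -natr1 mulrDl mul1r rmorphD.
    by ring.
  apply: le_trans (cmodD _ _) _; rewrite -natr1 mulrDl mul1r addrC lerD //.
exists ((cmod zeta + s) / eta) => X hX.
rewrite ler_pdivrMr // in hX.
have zs : 0 < cmod zeta + s by have := cmod_ge0 zeta; lra.
have X0 : 0 <= X.
  have : 0 < X * eta by lra.
  by rewrite pmulr_lgt0 // => /ltW.
have [j [j1 j2]] : exists j : nat, j%:R * s <= X /\ X < j%:R * s + s.
  have := truncn_itv (divr_ge0 X0 (ltW s0)) => /andP[a1 a2].
  exists (Num.truncn (X / s)); rewrite ler_pdivlMr // in a1; split=> //.
  by rewrite ltr_pdivrMr // -natr1 mulrDl mul1r in a2.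
have [z Jz hz] := walk j; exists z => //.
have -> : z ^+ q - U * (X%:C)%C = (z ^+ q - zeta - U * ((j%:R * s)%:C)%C) +
    (zeta - U * ((X - j%:R * s)%:C)%C).
  by rewrite rmorphB /=; ring.
apply: le_trans (cmodD _ _) _.
have b1 : cmod (zeta - U * ((X - j%:R * s)%:C)%C) <= cmod zeta + s.
  apply: le_trans (cmodB _ _) _; rewrite cmodM U1 mul1r cmod_real.
  by rewrite ger0_norm; lra.
have b2 : j%:R * (eta * s) <= eta * X.
  have -> : j%:R * (eta * s) = eta * (j%:R * s) by ring.
  by rewrite ler_pM2l.
have : 2 * (eta * X) <= eta0 * X.
  have := ler_wpM2r X0 et2; lra.
lra.
Qed.

Lemma nval_factor z : nden z != 0 -> nval z = z * (1 - h * (z ^+ n - 1) / nden z).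
Proof.
move=> nz; have dn0 := d_neq0.
have zn : z ^+ n = (nden z + m%:R) / d by rewrite /newton_den subrK mulrC mulKf.
by rewrite zn /newton_val /newton_mult natrD; field; rewrite nz -natrD dn0.
Qed.

Lemma h_real_bounds : im h = 0 -> h = ((re h)%:C)%C /\ 0 < re h < 2.
Proof.
move=> hi; split; first exact: complex_eq.
have := Re_le_cmod (h - 1); rewrite reD reN /= => hh.
have := le_lt_trans hh h1; rewrite ltr_norml => /andP[]; lra.
Qed.

(** The multiplier of N at 0 is (m - h)/m, and |h - m| <= |h - 1| + (m - 1) < m. *)
Lemma newton_attracts0 : (0 < m)%N -> exists2 r : R, 0 < r & attracts N (Some 0) r.
Proof.
move=> m0; have mR : 1 <= m%:R :> R by rewrite ler1n.
have z0n : 0 ^+ n = 0 :> C by rewrite expr0n eqn0Ngt n0.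
pose Q : {poly C} := d *: 'X^n - m%:R%:P; pose A := Q - h *: ('X^n - 1).
have QE z : Q.[z] = nden z by rewrite /Q !hornerE.
have AE z : A.[z] = nden z - h * (z ^+ n - 1).
  rewrite /A hornerD hornerN hornerZ -QE; congr (_ - h * _).
  by rewrite hornerD hornerN hornerXn -polyC1 hornerC.
have Q0 : Q.[0] = - m%:R by rewrite QE /newton_den z0n mulr0 sub0r.
have A0 : A.[0] = h - m%:R by rewrite AE -QE Q0 z0n; ring.
set k := cmod (h - m%:R).
have km : k < m%:R.
  have e : (m%:R : C) - 1 = m.-1%:R by rewrite -[in LHS](prednK m0) -natr1 addrK.
  have := cmodB (h - 1) (m%:R - 1).
  have -> : h - 1 - (m%:R - 1) = h - m%:R by ring.
  rewrite e cmod_nat -/k; have -> : m%:R = m.-1%:R + 1 :> R by rewrite natr1 prednK.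
  have := h1; lra.
have k0 : 0 <= k := cmod_ge0 _.
pose e := (m%:R - k) / 4; have e0 : 0 < e by rewrite /e; lra.
have [r1 r10 hr1] := poly_near A 0 e0; have [r2 r20 hr2] := poly_near Q 0 e0.
pose th := (1 + k / m%:R) / 2.
have km1 : k / m%:R < 1 by rewrite ltr_pdivrMr ?mul1r //; lra.
have km0 : 0 <= k / m%:R by rewrite divr_ge0.
apply: (@attracts_contraction R N 0 (Num.min r1 r2) th).
- by rewrite lt_min r10.
- by rewrite /th; apply/andP; split; lra.
move=> z; rewrite lt_min => /andP[/hr1 + /hr2]; rewrite A0 Q0 => a1 a2.
have b1 : cmod A.[z] <= k + e.
  by have := cmodD (A.[z] - (h - m%:R)) (h - m%:R); rewrite subrK -/k; lra.
have b2 : m%:R - e <= cmod (nden z).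
  have := cmod_sub_ge (- m%:R : C) (- m%:R - Q.[z]).
  have -> : - m%:R - (- m%:R - Q.[z]) = nden z by rewrite -QE; ring.
  by rewrite cmodN cmod_nat (cmodBC (- m%:R)); lra.
have nz : nden z != 0 by rewrite -cmod_gt0; rewrite /e in b2; lra.
exists (nval z); first by rewrite newton_Some // nz.
rewrite !subr0 nval_factor //.
have -> : z * (1 - h * (z ^+ n - 1) / nden z) = A.[z] / nden z * z by rewrite AE; field.
rewrite cmodM ler_wpM2r ?cmod_ge0 // cmod_div ler_pdivrMr ?cmod_gt0 //.
apply: le_trans b1 _; apply: le_trans (_ : th * (m%:R - e) <= _); last first.
  by rewrite ler_wpM2l // /th; lra.
have -> : th * (m%:R - e) = (m%:R + k) / 2 - th * e by rewrite /th; field; lra.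
have : th * e <= 1 * e by rewrite ler_pM2r // /th; lra.
by rewrite /e; lra.
Qed.

(** Let s > 1 be the left end of the maximal ray in J; s stays away from 1, which is a Fatou point.
    As f(s) < s, the image of the ray beyond s covers everything above f(s), and invariance of J
    extends the ray to the left of s. *)
Lemma real_ray_not_julia : im h = 0 -> (exists r : R, forall X, r <= X -> J (X%:C)%C) -> False.
Proof.
move=> hi [r0 hr0]; have [hE /andP[hp hl2]] := h_real_bounds hi.
set hr := re h in hE hp hl2; set D : R := (m + n)%:R; set M : R := m%:R.
have D2 : 2 <= D := d_ge2.
have nR : 2 <= n%:R :> R by rewrite ler_nat.
have DE : D = M + n%:R by rewrite /D natrD.
pose q (x : R) := D * x ^+ n - M.
pose f (x : R) := x * (1 - hr * (x ^+ n - 1) / q x).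
have xn (x : R) : 1 <= x -> 1 <= x ^+ n by move=> hx; rewrite exprn_ege1.
have q0 (x : R) : 1 <= x -> 0 < q x.
  move=> /xn hx; have : D * 1 <= D * x ^+ n by rewrite ler_pM2l //; lra.
  rewrite /q; lra.
have ndC (x : R) : nden (x%:C)%C = ((q x)%:C)%C.
  by rewrite /newton_den /q rmorphB rmorphM rmorphXn !rmorph_nat.
have nd0 (x : R) : 1 <= x -> nden (x%:C)%C != 0.
  by move=> hx; rewrite ndC -cmod_gt0 cmod_real normr_gt0 gt_eqF ?q0.
have fC (x : R) : 1 <= x -> nval (x%:C)%C = ((f x)%:C)%C.
  move=> hx; rewrite nval_factor ?nd0 // ndC {1}hE /f.
  by rewrite !(rmorphM, rmorphB, rmorph1, fmorphV, rmorphXn).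
have fJ (x : R) : 1 <= x -> J (x%:C)%C -> J ((f x)%:C)%C.
  by move=> hx; rewrite -fC //; apply: (newton_julia_val (nd0 x hx)).1.
have flt (x : R) : 1 < x -> f x < x.
  move=> hx; rewrite /f -[ltRHS]mulr1 ltr_pM2l; last by lra.
  rewrite ltrBlDr ltrDl divr_gt0 ?q0 ?(ltW hx) // mulr_gt0 // subr_gt0.
  by rewrite exprn_egt1 // -lt0n.
pose l := 1 - hr / D.
have l0 : 0 < l by rewrite /l subr_gt0 ltr_pdivrMr //; lra.
have fge (x : R) : 1 <= x -> l * x <= f x.
  move=> hx; rewrite /f mulrC ler_pM2l; last by lra.
  rewrite /l lerB // -mulrA ler_pM2l // ler_pdivrMr ?q0 // mulrC ler_pdivlMr; last by lra.
  rewrite /q; have : M <= D by rewrite DE; lra.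
  lra.
have F1 : fatou N (Some 1).
  have [ra ra0 hat] := newton_attracts1.
  apply: (basin_fatou ra0 (newton_cont) hat).
  by apply: (basin_hit (k := 0%N) hat); rewrite chordxx.
have [e e0 he] := fatou_near F1.
pose S : set R := fun x => 1 <= x /\ forall y, x <= y -> J (y%:C)%C.
have S0 : S (Num.max 1 r0).
  split; first by rewrite le_max lexx.
  by move=> y; rewrite ge_max => /andP[_]; apply: hr0.
have infS : has_inf S.
  by split; [exists (Num.max 1 r0) | exists 1 => x []].
set s := inf S.
have s1 : 1 < s.
  apply: lt_le_trans (_ : 1 + e / 2 <= _); first by lra.
  apply: lb_le_inf => [|x [x1 hx]]; first by exists (Num.max 1 r0).
  rewrite leNgt; apply/negP => xe; have Jy := hx (1 + e / 2) (ltW xe).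
  apply: Jy; apply: he; rewrite rmorphD rmorph1 /= addrAC subrr add0r cmod_real.
  by rewrite gtr0_norm; lra.
have Js (y : R) : s < y -> J (y%:C)%C.
  move=> sy; have ys : 0 < y - s by lra.
  have [x [x1 hx] xs] := inf_adherent ys infS.
  by apply: hx; rewrite -/s in xs; lra.
have fs := flt s s1.
(* The two midpoints keep t at least 1 and strictly between f(s) and s. *)
pose t := Num.max ((1 + s) / 2) ((f s + s) / 2).
have ts : t < s by rewrite gt_max; apply/andP; split; lra.
have t1 : 1 <= t by rewrite le_max; apply/orP; left; lra.
have tf : f s < t by rewrite lt_max; apply/orP; right; lra.
suff St : S t by have := @ge_inf R S infS.2 t St; rewrite -/s; lra.
split=> // y ty.
(* The equation f(x) = y with denominators cleared; G is negative at s, and nonnegative at B because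
   f(B) >= l B >= y. *)
pose G : {poly R} := 'X * (D *: 'X^n - M%:P) - hr *: ('X * ('X^n - 1)) - y *: (D *: 'X^n - M%:P).
have GE (x : R) : 1 <= x -> G.[x] = q x * (f x - y).
  move=> hx; have := q0 x hx; rewrite /f /q => qx.
  rewrite /G !(hornerD, hornerN, hornerM, hornerZ, hornerXn, hornerX, hornerC).
  move: qx; move: (D) (M) (x ^+ n) => D' M' X' qx.
  by field; rewrite gt_eqF.
pose B := Num.max s (y / l).
have sB : s <= B by rewrite le_max lexx.
have B1 : 1 <= B by lra.
have [x] := @poly_ivt R G s B sB ltac:(
  rewrite !GE ?(ltW s1) //; apply/andP; split;
  [ by rewrite mulr_ge0_le0 ?ltW ?q0 ?(ltW s1) // subr_lt0; lra
  | rewrite mulr_ge0 ?(ltW (q0 _ B1)) // subr_ge0; apply: le_trans (fge B B1);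
    by rewrite mulrC -ler_pdivrMr // le_max lexx orbT ]).
move=> /andP[sx xB] rx; have x1 : 1 <= x by lra.
move: rx; rewrite rootE GE // mulf_eq0 (gt_eqF (q0 x x1)) /= subr_eq0 => /eqP fx.
have sx' : s < x.
  rewrite lt_neqAle sx andbT; apply/eqP => e1; move: fx; rewrite -e1; lra.
by rewrite -fx; apply: fJ => //; apply: Js.
Qed.

End NewtonMap.

(** * Rays in the Julia set for real h *)

Section Rays.
Variable R : realType.
Local Notation C := R[i].
Variables (m n : nat) (h : C).
Hypothesis n2 : (2 <= n)%N.
Hypothesis h1 : cmod (h - 1) < 1.
Hypothesis hreal : im h = 0.
Local Notation p := (pmn R m n).
Local Notation N := (relaxed_newton h p).
Local Notation d := ((m + n)%:R : C).
Local Notation J := (fun z : C => julia N (Some z)).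
Local Notation nden := (@newton_den R m n).
Local Notation nval := (@newton_val R m n h).
Local Notation lam := (@newton_mult R m n h).
Local Notation drift1 := (@drift1 R m n h).
Implicit Types (z w x y g u : C).

Let n0 : (0 < n)%N := leq_trans (isT : (0 < 2)%N) n2.
Local Ltac isolate := clear -R m n h n2 h1 n0 hreal.

Definition sconj (x : sphere R) : sphere R := if x is Some z then Some (conjc z) else None.

Lemma chord_conj (x y : sphere R) : chord (sconj x) (sconj y) = chord x y.
Proof.
rewrite /chord; case: x y => [z|] [w|] //=; rewrite ?cmodJ //.
by rewrite -rmorphB cmodJ.
Qed.

Lemma conj_h : conjc h = h.
Proof. by apply: complex_eq; rewrite ?reJ ?imJ ?hreal ?oppr0. Qed.

Lemma conj_lam : conjc lam = lam.
Proof.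
by rewrite /newton_mult rmorphB rmorph1 rmorphM /= fmorphV /= rmorph_nat conj_h.
Qed.

Lemma conj_nden z : conjc (nden z) = nden (conjc z).
Proof. by rewrite /newton_den rmorphB rmorphM /= rmorphXn /= !rmorph_nat. Qed.

Lemma conj_nval z : conjc (nval z) = nval (conjc z).
Proof.
rewrite /newton_val rmorphD !rmorphM /= !fmorphV /= conj_lam conj_h conj_nden.
by rewrite !rmorph_nat.
Qed.

Lemma newton_conj z : J z <-> J (conjc z).
Proof.
have hr (x : sphere R) : fatou N x -> fatou N (sconj x).
  apply: (@fatou_symmetry R unit (fun=> sconj) (fun=> sconj) id N _ _ _ tt).
  - by move=> _; apply: chord_conj.
  - by move=> _ [w|] //=; rewrite conjcK.
  - move=> _ [w|] /=; last by rewrite newton_None.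
    rewrite !newton_Some // -conj_nden conjc_eq0; case: ifP => //= _.
    by rewrite conj_nval.
rewrite /julia; split=> h2 h3; apply: h2.
  by have := hr _ h3; rewrite /= conjcK.
exact: hr _ h3.
Qed.

Lemma lam_real : exists2 l : R, lam = (l%:C)%C & 0 < l < 1.
Proof.
have hE : h = ((re h)%:C)%C by apply: complex_eq.
have D2 := d_ge2 R m n2; set D : R := (m + n)%:R in D2.
have e : lam = ((1 - re h / D)%:C)%C.
  by rewrite /newton_mult {1}hE rmorphB rmorph1 rmorphM /= fmorphV /= rmorph_nat.
exists (1 - re h / D) => //.
have h01 : `|re h - 1| < 1.
  have := Re_le_cmod (h - 1); rewrite reD reN /= => hh; apply: le_lt_trans hh h1.
move: h01; rewrite ltr_norml => /andP[h2 h3].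
have Dp : 0 < D by lra.
have q : re h / D < 1 by rewrite ltr_pdivrMr //; lra.
have q2 : 0 < re h / D by rewrite divr_gt0 //; lra.
by apply/andP; split; lra.
Qed.

(* N is injective near infinity and commutes with the reflection in the ray. *)
Lemma ray_preimage u : cmod u = 1 -> (u ^+ 2) ^+ n = 1 ->
  exists rho r0 : R, [/\ 1 < rho, 2 <= r0 & forall X, r0 <= X ->
    exists2 Y : R, rho * X <= Y & nval (u * (Y%:C)%C) = u * (X%:C)%C].
Proof.
move=> u1 un; have [K K0 hK] := newton_asymptotics m h n2.
have [rho [r0 [rho1 r02 hpre]]] := newton_preimage m n2 h1.
have [l lE /andP[l0 l1]] := lam_real.
have un0 : u != 0 by rewrite -cmod_gt0 u1.
have cu : conjc u = u^-1.
  apply: (mulfI un0); rewrite mulfV // mulJ_cmod u1 expr1n //.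
exists rho, (Num.max r0 (2 * K / l + 1 + K)); split=> //; first by rewrite le_max r02.
move=> X; rewrite ge_max => /andP[X1 X2].
have kl : 0 < K / l by rewrite divr_gt0.
have X0 : 0 < X by lra.
have cX : cmod (u * (X%:C)%C) = X by rewrite cmodM u1 mul1r cmod_real gtr0_norm.
have [x [x2 hx Nx]] := hpre (u * (X%:C)%C) ltac:(by rewrite cX).
rewrite cX in hx.
have xX : X <= cmod x by apply: le_trans hx; rewrite ler_peMl // ltW.
(* The reflection of x in the line through u; it has the same image as x, so it equals x by
   injectivity near infinity, and x lies on that line. *)
pose x' := u ^+ 2 * conjc x.
have cx' : cmod x' = cmod x by rewrite cmodM cmodJ cmodX u1 expr1n mul1r.
have Nx' : nval x' = nval x.
  have -> : nval x' = u ^+ 2 * nval (conjc x).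
    by rewrite /newton_val /x' nden_rot //; ring.
  have cuX : conjc (u * (X%:C)%C) = u^-1 * (X%:C)%C.
    by rewrite -cu; apply: complex_eq; rewrite !ReImE /=; ring.
  by rewrite -conj_nval Nx cuX; field.
have xx : x' = x.
  have [_ _] := hK x x' x2 ltac:(by rewrite cx').
  rewrite Nx' subrr sub0r cmodN cmodM lE cmod_real (gtr0_norm l0) => hh.
  apply/eqP; rewrite eq_sym -subr_eq0 -cmod_eq0; apply/eqP.
  have xp : 0 < cmod x by move: x2; isolate; lra.
  have : K * cmod (x - x') / cmod x <= l / 2 * cmod (x - x').
    rewrite ler_pdivrMr // mulrAC ler_wpM2r ?cmod_ge0 //.
    have : 2 * K / l * l = 2 * K by field; rewrite gt_eqF.
    have : 2 * K / l * l <= cmod x * l by rewrite ler_pM2r //; lra.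
    lra.
  have := cmod_ge0 (x - x'); have := mulr_gt0 l0 (ltr0n R 2); nra.
have yE : x / u = ((re (x / u))%:C)%C.
  apply: complex_eq => //=; have : conjc (x / u) = x / u.
    have cxe : conjc x = x / u ^+ 2 by rewrite -{2}xx /x' mulrAC mulfV ?mul1r // expf_neq0.
    by rewrite rmorphM /= fmorphV /= cu invrK cxe; field.
  move=> /(congr1 (@complex.Im R)); rewrite imJ => e; lra.
set Y := re (x / u) in yE.
have xE : x = u * (Y%:C)%C by rewrite -yE mulrC divfK.
have cY : cmod x = `|Y| by rewrite xE cmodM u1 mul1r cmod_real.
exists Y; last by rewrite -xE.
have [_ + _] := hK x x x2 x2.
rewrite Nx xE lE.
have -> : u * (X%:C)%C - (l%:C)%C * (u * (Y%:C)%C) = u * ((X - l * Y)%:C)%C.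
  by rewrite rmorphB rmorphM /=; ring.
rewrite -xE cmodM u1 mul1r cmod_real cY => hh.
(* A negative Y would put the image u X at distance more than X > K from lam x, against the
   asymptotics. *)
have [Yp|Yn] := leP 0 Y; first by rewrite -(ger0_norm Yp) -cY.
have aY : 1 <= `|Y| by rewrite -cY; move: x2; isolate; lra.
have : K / `|Y| <= K.
  by rewrite ler_pdivrMr ?(lt_le_trans ltr01 aY) // ler_peMr ?(ltW K0).
have := ler_norm (X - l * Y).
have : l * Y < 0 by rewrite pmulr_rlt0.
lra.
Qed.

(** Points of J within relative error al of far ray points are pushed back along the ray by N^k.
    Near infinity N contracts distances by about lam, so the error at a fixed ray point stays below
    al times a constant, and al is arbitrary while J is closed. *)
Lemma ray_in_julia u : cmod u = 1 -> (u ^+ 2) ^+ n = 1 ->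
  (forall al : R, 0 < al -> exists X0 : R, forall X, X0 <= X ->
     exists2 z, J z & cmod (z - u * (X%:C)%C) <= al * X) ->
  exists r : R, forall X, r <= X -> J (u * (X%:C)%C).
Proof.
move=> u1 un hn; have [K K0 hK] := newton_asymptotics m h n2.
have [rho [r0 [rho1 r02 hpre]]] := ray_preimage u1 un.
have [l lE /andP[l0 l1]] := lam_real.
(* Chosen so that (l + K/Y)(Y + A) <= X + A when N carries u Y to u X: the slack (1 - l) A / 2 = K +
   1 absorbs the corrections. *)
pose A := 2 * (K + 1) / (1 - l).
have l1' : 0 < 1 - l by lra.
have A0 : 0 < A by rewrite divr_gt0 // mulr_gt0 // addr_gt0.
have AE : A * (1 - l) = 2 * (K + 1) by rewrite /A divfK // gt_eqF.
exists (Num.max r0 (Num.max (2 * K / (1 - l) + K) (A + 4))) => X0 hX0.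
apply: julia_closed => e e0.
pose al := Num.min (1 / 4) (e / (2 * (X0 + A))).
move: (hX0); rewrite !ge_max => /andP[h01 /andP[h02 h03]].
have XA : 0 < X0 + A by lra.
have al0 : 0 < al by rewrite lt_min divr_gt0 // divr_gt0 // mulr_gt0.
have al4 : al <= 1 / 4 by rewrite ge_min lexx.
have ale : al <= e / (2 * (X0 + A)) by rewrite ge_min lexx orbT.
have [X1 hX1] := hn al al0.
set r := Num.max r0 _ in hX0.
have walk k X : r <= X -> X1 <= X * rho ^+ k -> exists2 z, J z &
    cmod (z - u * (X%:C)%C) <= al * (X + A).
  elim: k X => [|k IH] X hr hX.
    rewrite expr0 mulr1 in hX; have [z Jz hz] := hX1 X hX; exists z => //.
    by apply: le_trans hz _; rewrite ler_pM2l //; lra.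
  move: (hr); rewrite /r !ge_max => /andP[k1 /andP[k2 k3]].
  have [Y hY NY] := hpre X k1.
  have X4 : 4 < X by move: k3 A0; isolate; lra.
  have XY : X <= Y.
    by apply: le_trans hY; rewrite ler_peMl //; [move: X4|move: rho1]; isolate; lra.
  have hX' : X1 <= Y * rho ^+ k.
    rewrite (le_trans hX) // exprS mulrA ler_pM2r ?exprn_gt0 1?mulrC //.
    exact: lt_trans rho1.
  have [z Jz hz] := IH Y (le_trans hr XY) hX'.
  have Y4 : 4 < Y by apply: lt_le_trans XY.
  have Yp : 0 < Y by move: Y4; isolate; lra.
  have cY : cmod (u * (Y%:C)%C) = Y by rewrite cmodM u1 mul1r cmod_real gtr0_norm.
  have zb : 2 <= cmod z.
    have := cmod_add_ge (u * (Y%:C)%C) (z - u * (Y%:C)%C).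
    have -> : u * (Y%:C)%C + (z - u * (Y%:C)%C) = z by ring.
    have : al * (Y + A) <= 1 / 4 * (Y + A) by rewrite ler_pM2r // addr_gt0.
    by rewrite cY; move: hz Y4 XY k3; isolate; lra.
  have [nz _ _] := hK z z zb zb.
  exists (nval z); first exact: (newton_julia_val n2 h1 nz).1.
  have y2 : 2 <= cmod (u * (Y%:C)%C) by rewrite cY; move: Y4; isolate; lra.
  have [_ b1 b2] := hK _ _ y2 zb; rewrite NY cY in b1 b2.
  set D := cmod (z - u * (Y%:C)%C) in hz.
  have D0 : 0 <= D := cmod_ge0 _.
  have s1 : cmod (nval z - u * (X%:C)%C) <= (l + K / Y) * D.
    have -> : nval z - u * (X%:C)%C =
      - (u * (X%:C)%C - nval z - lam * (u * (Y%:C)%C - z)) + lam * (z - u * (Y%:C)%C) by ring.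
    apply: le_trans (cmodD _ _) _; rewrite cmodN cmodM lE cmod_real (gtr0_norm l0) -/D.
    rewrite mulrDl addrC lerD //; rewrite lE in b2; apply: le_trans b2 _.
    by rewrite (cmodBC _ z) -/D mulrAC.
  have s2 : l * Y - K / Y <= X.
    have e1 : u * (X%:C)%C - lam * (u * (Y%:C)%C) = u * ((X - l * Y)%:C)%C.
      by rewrite lE rmorphB rmorphM /=; ring.
    rewrite e1 cmodM u1 mul1r cmod_real in b1.
    by move: b1; rewrite ler_norml => /andP[]; isolate; lra.
  have q1 : K / Y <= 1.
    rewrite ler_pdivrMr //.
    have : 0 < 2 * K / (1 - l) by rewrite divr_gt0 // mulr_gt0.
    by move: k2 XY; isolate; lra.
  have q2 : K / Y <= (1 - l) / 2.
    rewrite ler_pdivrMr //.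
    have e1 : 2 * K / (1 - l) * (1 - l) = 2 * K by field; rewrite gt_eqF.
    have : 2 * K / (1 - l) * (1 - l) <= Y * (1 - l).
      by rewrite ler_pM2r //; move: k2 XY K0; isolate; lra.
    by move: e1; isolate; lra.
  have KY0 : 0 <= K / Y by rewrite divr_ge0 ?ltW.
  apply: le_trans s1 _.
  apply: le_trans (_ : (l + K / Y) * (al * (Y + A)) <= _).
    by rewrite ler_wpM2l // addr_ge0 // ltW.
  rewrite mulrCA ler_pM2l //.
  have q3 : K / Y * A <= (1 - l) / 2 * A by rewrite ler_pM2r.
  have q4 : K / Y * Y = K by field; rewrite gt_eqF.
  have -> : (l + K / Y) * (Y + A) = l * Y + l * A + K / Y * Y + K / Y * A by ring.
  by rewrite q4; move: q1 q3 s2 AE; isolate; lra.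
have [k hk] := pow_unbounded (X1 / X0) rho1.
have X00 : 0 < X0 by lra.
have [z Jz hz] := walk k X0 hX0 ltac:(by rewrite mulrC; move: hk; rewrite ltr_pdivrMr // => /ltW).
exists z => //; apply: le_lt_trans hz _.
have : al * (X0 + A) <= e / (2 * (X0 + A)) * (X0 + A) by rewrite ler_pM2r.
have -> : e / (2 * (X0 + A)) * (X0 + A) = e / 2 by field; rewrite gt_eqF.
lra.
Qed.

(** [long_drift] controls only z^q, so z is close to c u X for some c with c^q = 1; by hypothesis c
    is an n-th root of unity, and rotating by it moves z to the ray. *)
Lemma drift_ray q u (gam : R) eps : (0 < q)%N -> (forall c : C, c ^+ q = 1 -> c ^+ n = 1) ->
  cmod u = 1 -> (u ^+ 2) ^+ n = 1 -> 0 < gam ->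
  drift1 q (u ^+ q * (gam%:C)%C) -> eps ^+ q = -1 -> (forall z, J z <-> J (eps * z)) ->
  exists r : R, forall X, r <= X -> J (u * (X%:C)%C).
Proof.
move=> q0 hq u1 un gam0 hd heps hJ; apply: ray_in_julia => // al al0.
have [X0 hX0] := long_drift n2 h1 q0 u1 gam0 hd heps hJ (exprn_gt0 q al0).
exists (Num.max 1 X0) => X; rewrite ge_max => /andP[X1 hX].
have Xq1 : 1 <= X ^+ q by rewrite exprn_ege1.
have XqX : X <= X ^+ q by rewrite -[leLHS]expr1 ler_weXn2l.
have [z Jz hz] := hX0 (X ^+ q) (le_trans hX XqX).
pose P : {poly C} := 'X^q - ((u * (X%:C)%C) ^+ q)%:P.
have sP : size P = q.+1 by rewrite size_XnsubC.
have [r rr hr] := @root_near R P z ltac:(by rewrite sP).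
rewrite sP lead_coefXnsubC // cmod1 mul1r /= in hr.
have rE : r ^+ q = (u * (X%:C)%C) ^+ q.
  by move: rr; rewrite rootE !hornerE subr_eq0 => /eqP.
have Xp : 0 < X by lra.
have uX : u * (X%:C)%C != 0.
  by rewrite -cmod_gt0 cmodM u1 mul1r cmod_real gtr0_norm.
have [c cE] : exists c, r = c * (u * (X%:C)%C).
  by exists (r / (u * (X%:C)%C)); rewrite divfK.
have cq : c ^+ q = 1.
  have uXq : (u * (X%:C)%C) ^+ q != 0 by rewrite expf_neq0.
  by apply: (mulIf uXq); rewrite mul1r -exprMn -cE.
have c1 := unity_root_cmod q0 cq.
have c0 : c != 0 by rewrite -cmod_gt0 c1.
exists (z / c); first by apply: (newton_rot m n2 h1 (hq c cq) _).2; rewrite mulrC divfK.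
have -> : z / c - u * (X%:C)%C = (z - r) / c by rewrite cE; field.
rewrite cmod_div c1 divr1 -(@ler_pXn2r _ q) ?nnegrE ?cmod_ge0 ?mulr_ge0 ?(ltW al0) ?(ltW Xp) //.
apply: le_trans hr _.
have -> : P.[z] = z ^+ q - u ^+ q * ((X ^+ q)%:C)%C.
  by rewrite /P hornerD hornerN hornerXn hornerC exprMn rmorphXn.
by rewrite exprMn.
Qed.

End Rays.

(** * The imaginary axis for n = 2, m > 0 and real h *)

Section Quadratic.
Variable R : realType.
Local Notation C := R[i].
Variables (m : nat) (h : C).
Hypothesis h1 : cmod (h - 1) < 1.
Hypothesis hreal : im h = 0.
Local Notation N := (relaxed_newton h (pmn R m 2)).
Local Notation J := (fun z : C => julia N (Some z)).
Local Notation nden := (@newton_den R m 2).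
Local Notation nval := (@newton_val R m 2 h).
Implicit Types (z w : C).

Let n2 : (2 <= 2)%N := isT.

(** On the axis N multiplies x by 1 - hr (x^2 + 1)/(D x^2 + M), a number between 1 - hr/M and 1 -
    hr/D, so orbits tend to the attracting fixed point 0. *)
Lemma imaginary_axis_fatou (y : R) : (0 < m)%N -> fatou N (Some (Complex 0 y)).
Proof.
move=> m0; have [r r0 hat] := newton_attracts0 n2 h1 m0.
apply: (basin_fatou r0 (newton_cont m n2 h1) hat).
have [hE /andP[hp hl2]] := h_real_bounds h1 hreal.
set hr := re h in hE hp hl2; set M : R := m%:R; set D : R := M + 2.
have M1 : 1 <= M by rewrite /M ler1n.
pose th := Num.max `|1 - hr / M| `|1 - hr / D|.
have hM : 0 < hr / M < 2.
  by rewrite divr_gt0 /= ?ltr_pdivrMr //; lra.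
have hD : 0 < hr / D < 2.
  by rewrite divr_gt0 /= ?ltr_pdivrMr //; rewrite /D; lra.
have [hM1 hM2] := andP hM; have [hD1 hD2] := andP hD.
have th1 : th < 1 by rewrite gt_max !ltr_norml; apply/andP; split; apply/andP; split; lra.
have th0 : 0 <= th by rewrite le_max normr_ge0.
have step (x : R) : exists2 x' : R, N (Some (Complex 0 x)) = Some (Complex 0 x') & `|x'| <= th * `|x|.
  set q := D * x ^+ 2 + M; have x20 := sqr_ge0 x.
  have q0 : 0 < q by rewrite /q; have := mulr_ge0 (_ : 0 <= D) x20; rewrite /D; nra.
  have ndE : nden (Complex 0 x) = - (q%:C)%C.
    rewrite /newton_den /q /D natrD.
    by apply: complex_eq; rewrite !ReImE -!(rmorph_nat (real_complex R)) /=; ring.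
  have nd0 : nden (Complex 0 x) != 0.
    by rewrite ndE oppr_eq0 -cmod_gt0 cmod_real normr_gt0 gt_eqF.
  pose nu := 1 - hr * (x ^+ 2 + 1) / q.
  exists (x * nu).
    rewrite newton_Some // nd0; congr Some; rewrite nval_factor // ndE {1}hE.
    have e1 : Complex 0 x ^+ 2 = (- ((x ^+ 2)%:C)%C : C).
      by apply: complex_eq; rewrite !ReImE /=; ring.
    have -> : 1 - (hr%:C)%C * (Complex 0 x ^+ 2 - 1) / - (q%:C)%C = (nu%:C)%C.
      rewrite e1 /nu; move: q0; move: (q) (x ^+ 2) => q' X' q'0.
      rewrite !(rmorphM, rmorphB, rmorphD, rmorph1, fmorphV) /=.
      by field; rewrite -cmod_gt0 cmod_real normr_gt0 gt_eqF.
    by apply: complex_eq; rewrite !ReImE /=; ring.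
  rewrite normrM mulrC ler_wpM2r //.
  have lo : hr / D <= hr * (x ^+ 2 + 1) / q.
    rewrite -mulrA ler_pM2l // ler_pdivlMr // mulrC ler_pdivrMr; last by rewrite /D; lra.
    by rewrite /q /D; lra.
  have hi : hr * (x ^+ 2 + 1) / q <= hr / M.
    rewrite -mulrA ler_pM2l // ler_pdivrMr // mulrC ler_pdivlMr; last by lra.
    by rewrite /q /D; lra.
  rewrite /th le_max; have [pos|neg] := leP 0 nu.
    apply/orP; right; rewrite (ger0_norm pos) /nu ger0_norm; first by lra.
    by rewrite /nu in pos; lra.
  by apply/orP; left; rewrite (ltr0_norm neg) ler0_norm /nu; rewrite /nu in neg; lra.
have walk k : exists2 x : R, iter k N (Some (Complex 0 y)) = Some (Complex 0 x) & `|x| <= th ^+ k * `|y|.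
  elim: k => [|k [x hx hl]]; first by exists y; rewrite ?expr0 ?mul1r.
  have [x' fx hx'] := step x; exists x'; first by rewrite iterS hx.
  by apply: le_trans hx' _; rewrite exprS -mulrA ler_wpM2l.
move=> e e0; have thI : 0 <= th < 1 by rewrite th0.
have y1 : 0 < 2 * (`|y| + 1) by rewrite mulr_gt0 // ltr_wpDl.
have [K hK] := pow_small thI (divr_gt0 e0 y1).
exists K => k /hK; rewrite ltr_pdivlMr // => hk.
have [x -> hx] := walk k; apply: le_lt_trans (chord_Some_le _ _) _.
have -> : cmod (0 - Complex 0 x) = `|x|.
  by rewrite sub0r cmodN /cmod /= expr0n add0r sqrtr_sqr.
have := exprn_ge0 k th0; nra.
Qed.

End Quadratic.

(** * The Julia set for n = 2, m = 0 and real h *)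

Section QuadraticLine.
Variable R : realType.
Local Notation C := R[i].
Variable h : C.
Hypothesis h1 : cmod (h - 1) < 1.
Hypothesis hreal : im h = 0.
Local Notation N := (relaxed_newton h (pmn R 0 2)).
Local Notation J := (fun z : C => julia N (Some z)).
Local Notation nden := (@newton_den R 0 2).
Local Notation nval := (@newton_val R 0 2 h).
Implicit Types (z w : C).

Let n2 : (2 <= 2)%N := isT.
Let hr := re h.

Lemma nval_quadratic z : z != 0 ->
  nden z != 0 /\ nval z = (((2 - hr)%:C)%C * z + (hr%:C)%C / z) / 2.
Proof.
move=> z0; have [hE _] := h_real_bounds h1 hreal.
have nz : nden z != 0.
  by rewrite /newton_den subr0 add0n mulf_neq0 ?expf_neq0 // pnatr_eq0.
split=> //; rewrite nval_factor // {1}hE -/hr /newton_den subr0 add0n rmorphB /=.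
have -> : ((2 : R)%:C)%C = 2 :> C by rewrite (rmorph_nat (real_complex R) 2).
by field; rewrite z0.
Qed.

Lemma Re_inv z : re z^-1 = re z / cmod z ^+ 2.
Proof.
case: (eqVneq z 0) => [->|z0]; first by rewrite invr0 mul0r.
have -> : z^-1 = conjc z * (((cmod z ^+ 2)^-1)%:C)%C.
  apply: (mulfI z0); rewrite mulfV // mulrA mulJ_cmod -rmorphM mulfV //.
  by rewrite expf_neq0 // cmod_eq0.
by rewrite reM reJ /= mulr0 subr0.
Qed.

Lemma Re_nval z : z != 0 ->
  re (nval z) = re z * ((2 - hr) + hr / cmod z ^+ 2) / 2.
Proof.
move=> z0; have [_ ->] := nval_quadratic z0.
have -> : (2 : C)^-1 = ((2^-1)%:C)%C by rewrite fmorphV (rmorph_nat (real_complex R) 2).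
by rewrite reM reD !reM Re_inv /=; ring.
Qed.

(* In the coordinate (z-1)/(z+1) the right half-plane is the unit disc and N
   is a Blaschke product vanishing at 0. *)
Lemma right_half_plane_basin z : 0 < re z -> basin N (Some 1) (Some z).
Proof.
have [hE /andP[hp hl2]] := h_real_bounds h1 hreal; rewrite -/hr in hE hp hl2.
pose s w := cmod ((w - 1) / (w + 1)) ^+ 2.
have pos w : 0 < re w -> w != 0 /\ w + 1 != 0.
  move=> hw; split; apply/eqP => e.
    by move: hw; rewrite e ltxx.
  by have := congr1 (@complex.Re R) e; rewrite reD /=; lra.
have sE w : 0 < re w -> 1 - s w = 4 * re w / cmod (w + 1) ^+ 2.
  move=> hw; have [_ w1] := pos w hw.
  have cp : cmod (w + 1) ^+ 2 != 0 by rewrite expf_neq0 // cmod_eq0.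
  rewrite /s cmod_div expr_div_n; apply: (mulIf cp); rewrite mulrBl !divfK // mul1r.
  by rewrite !cmod_sq !ReImE /=; ring.
pose a := 2 - hr; have a0 : 0 < a by rewrite /a; lra.
have step w : 0 < re w -> exists w', [/\ N (Some w) = Some w', 0 < re w' &
    s w' <= s w * (1 - a * hr / 4 * (1 - s w))].
  move=> hw; have [w0 w1] := pos w hw; have [nz nv] := nval_quadratic w0.
  exists (nval w); split.
  - by rewrite newton_Some // nz.
  - rewrite Re_nval // divr_gt0 // mulr_gt0 // addr_gt0 // divr_gt0 // exprn_gt0 //.
    by rewrite cmod_gt0.
  have two : (2 : C) != 0 by rewrite pnatr_eq0.
  set aC := ((2 - hr)%:C)%C in nv; set bC := (hr%:C)%C in nv.
  have ab : bC = 2 - aC.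
    by rewrite /aC rmorphB /= (rmorph_nat (real_complex R) 2) /bC; ring.
  have ew1 : nval w - 1 = (w - 1) * (aC * w - bC) / (2 * w).
    by rewrite nv ab; field; rewrite w0.
  have ew2 : nval w + 1 = (w + 1) * (aC * w + bC) / (2 * w).
    by rewrite nv ab; field; rewrite w0.
  have den0 : aC * w + bC != 0.
    apply/eqP => e; have := congr1 (@complex.Re R) e.
    rewrite reD reM /= mul0r subr0; have := mulr_gt0 a0 hw; rewrite /a; lra.
  have -> : s (nval w) = s w * (cmod (aC * w - bC) ^+ 2 / cmod (aC * w + bC) ^+ 2).
    rewrite /s -expr_div_n -cmod_div -exprMn -cmodM; congr (cmod _ ^+ 2).
    rewrite ew1 ew2; move: den0; move: (aC) (bC) => A B den0.
    by field; rewrite w0 w1 den0.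
  rewrite ler_wpM2l ?sqr_ge0 //.
  have dp : 0 < cmod (aC * w + bC) ^+ 2 by rewrite exprn_gt0 // cmod_gt0.
  rewrite ler_pdivrMr //.
  have e3 : cmod (aC * w - bC) ^+ 2 = cmod (aC * w + bC) ^+ 2 - 4 * a * hr * re w.
    by rewrite !cmod_sq !ReImE /= /a; ring.
  rewrite e3 mulrBl mul1r lerB // sE //.
  have wp : 0 < cmod (w + 1) ^+ 2 by rewrite exprn_gt0 // cmod_gt0.
  (* Both a and hr lie between 0 and 2, which bounds 4 a hr re w / |a w + hr|^2 below by (a hr /
     4)(1 - s w). *)
  have bd : cmod (aC * w + bC) ^+ 2 <= 4 * cmod (w + 1) ^+ 2.
    rewrite !cmod_sq !ReImE /=.
    have x1 : a * re w + hr <= 2 * (re w + 1) by rewrite /a; nra.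
    have x2 : 0 <= a * re w + hr by rewrite addr_ge0 ?mulr_ge0 // ltW.
    have x3 : (a * re w + hr) ^+ 2 <= (2 * (re w + 1)) ^+ 2.
      by rewrite lerXn2r ?nnegrE //; lra.
    have x4 : (a * im w) ^+ 2 <= (2 * im w) ^+ 2.
      rewrite !exprMn ler_wpM2r ?sqr_ge0 // lerXn2r ?nnegrE ?ltW //; rewrite /a; lra.
    have -> : ((2 - hr) * re w - 0 * im w + hr) ^+ 2 + ((2 - hr) * im w + 0 * re w + 0) ^+ 2 =
      (a * re w + hr) ^+ 2 + (a * im w) ^+ 2 by rewrite /a; ring.
    have -> : 4 * ((re w + 1) ^+ 2 + (im w + 0) ^+ 2) = (2 * (re w + 1)) ^+ 2 + (2 * im w) ^+ 2.
      by ring.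
    lra.
  have k0 : 0 <= a * hr * re w / cmod (w + 1) ^+ 2.
    by rewrite divr_ge0 ?(ltW wp) // !mulr_ge0 // ltW.
  have -> : a * hr / 4 * (4 * re w / cmod (w + 1) ^+ 2) * cmod (aC * w + bC) ^+ 2 =
     a * hr * re w / cmod (w + 1) ^+ 2 * cmod (aC * w + bC) ^+ 2.
    by move: (cmod (aC * w + bC)) => X; field; rewrite cmod_eq0.
  apply: le_trans (ler_wpM2l k0 bd) _.
  rewrite le_eqVlt; apply/orP; left; apply/eqP; field.
  by rewrite cmod_eq0.
move=> hz; set s0 := s z.
have s01 : s0 < 1.
  have [_ z1] := pos z hz; have zp : 0 < cmod (z + 1) ^+ 2 by rewrite exprn_gt0 // cmod_gt0.
  by rewrite -subr_gt0 sE //; apply: divr_gt0 => //; apply: mulr_gt0.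
have s00 : 0 <= s0 by apply: sqr_ge0.
have ah : 0 < a * hr / 4 by rewrite divr_gt0 // mulr_gt0.
have ah1 : a * hr / 4 <= 1 by rewrite /a; nra.
(* Since s decreases along the orbit, the contraction factor at the starting point serves for all
   later steps. *)
pose ka := 1 - a * hr / 4 * (1 - s0).
have ka1 : ka < 1 by rewrite /ka; have := mulr_gt0 ah (_ : 0 < 1 - s0); rewrite subr_gt0 => /(_ s01); lra.
have ka0 : 0 <= ka.
  have : a * hr / 4 * (1 - s0) <= 1 * 1 by rewrite ler_pM //; lra.
  rewrite /ka; lra.
have walk k : exists w, [/\ iter k N (Some z) = Some w, 0 < re w & s w <= ka ^+ k * s0].
  elim: k => [|k [w [hw1 hw2 hw3]]]; first by exists z; rewrite expr0 mul1r.
  have [w' [Nw' rw' sw']] := step w hw2; exists w'; rewrite iterS hw1; split=> //.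
  have sw0 : s w <= s0.
    by apply: le_trans hw3 _; rewrite ler_piMl // exprn_ile1 // ltW.
  have swp : 0 <= s w by apply: sqr_ge0.
  apply: le_trans sw' _; rewrite mulrC exprS -[ka * _ * s0]mulrA; apply: ler_pM => //.
  - have : a * hr / 4 * (1 - s w) <= 1 * 1 by rewrite ler_pM //; lra.
    lra.
  - by apply: lerB => //; rewrite ler_pM2l //; lra.
move=> e e0; have kaI : 0 <= ka < 1 by rewrite ka0.
have e20 : 0 < (e / 2) ^+ 2 by rewrite exprn_gt0 // divr_gt0.
have [K hK] := pow_small kaI e20; exists K => k /hK hk.
have [w [-> rw sw]] := walk k.
have [w0 w1] := pos w rw.
set xi := (w - 1) / (w + 1).
have xb : cmod xi < e / 2.
  rewrite -(@ltr_pXn2r _ 2) ?nnegrE ?cmod_ge0 ?divr_ge0 ?(ltW e0) //.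
  apply: le_lt_trans hk; apply: le_trans sw _.
  by rewrite ler_piMr ?exprn_ge0 // ltW.
rewrite chordE /= !mulr1 ltr_pdivrMr ?mulr_gt0 ?hnorm_gt0 //.
(* Cauchy-Schwarz bounds |w + 1| by the product of the two norms, so the chordal distance from w to
   1 is at most 2 |xi|. *)
have := @hinner_le R (Some w) (Some 1); rewrite /hnum /hden conjc1 !mulr1 => hw.
have -> : cmod (1 - w) = cmod xi * cmod (w + 1) by rewrite -cmodM /xi divfK // cmodBC.
rewrite [hnorm (Some 1) * _]mulrC; set H := hnorm _ * _ in hw *.
have w1p : 0 < cmod (w + 1) by rewrite cmod_gt0.
have := cmod_ge0 xi; nra.
Qed.

(** The imaginary axis together with infinity is forward invariant, hence outside the basin of 1,
    yet it borders that basin; by [basin_closed] its points are in J. The left half-plane follows by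
    the symmetry z |-> -z. *)
Lemma quadratic_julia_line : julia_is_line N.
Proof.
have J0 z : re z = 0 -> J z.
  move=> rz Fz.
  have [r r0 hat] := newton_attracts1 0 n2 h1.
  have bz : basin N (Some 1) (Some z).
    apply: (basin_closed r0 (newton_cont 0 n2 h1) hat Fz) => e e0.
    exists (Some (z + ((e / 4)%:C)%C)).
      apply: le_lt_trans (chord_Some_le _ _) _.
      by rewrite opprD addrA subrr sub0r cmodN cmod_real gtr0_norm; lra.
    by apply: right_half_plane_basin; rewrite reD rz /=; lra.
  have axis k : iter k N (Some z) = None \/ exists2 w, iter k N (Some z) = Some w & re w = 0.
    elim: k => [|k IH]; first by right; exists z.
    rewrite iterS; case: IH => [->|[w -> rw]]; first by left; rewrite newton_None.
    rewrite newton_Some //; case: (eqVneq w 0) => [w0|w0].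
      by left; rewrite w0 /newton_den expr0n /= mulr0 subr0 eqxx.
    have [nz _] := nval_quadratic w0; right; rewrite nz; exists (nval w) => //.
    by rewrite Re_nval // rw !mul0r.
  have [e e0 he] := @chord_Some_near R 1 (1 / 2) ltac:(lra).
  have [K /(_ K (leqnn _)) /he[w ew hw]] := bz e e0.
  case: (axis K) => [e1|[w' e1 rw']]; first by rewrite e1 in ew.
  rewrite e1 in ew; case: ew => ew; rewrite -ew in hw.
  have := Re_le_cmod (w' - 1); rewrite reD reN rw' /= sub0r normrN normr1; lra.
have Fp z : 0 < re z -> fatou N (Some z).
  move=> /right_half_plane_basin; have [r r0 hat] := newton_attracts1 0 n2 h1.
  exact: (basin_fatou r0 (newton_cont 0 n2 h1) hat).
have m1 : (-1) ^+ 2 = 1 :> C by rewrite sqrrN expr1n.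
exists 0, 'i%C; split.
  by apply/eqP => /(congr1 (@complex.Im R)) /= /eqP; rewrite oner_eq0.
move=> z; split=> [Jz|[t ->]]; last first.
  by apply: J0; rewrite add0r reM /= mulr0 mul0r subr0.
exists (im z); rewrite add0r; apply: complex_eq; rewrite ?reM ?imM /=; last by ring.
have [rp|rn|<-] := ltgtP 0 (re z); last by ring.
  by case: Jz; apply: Fp.
have Jz' := (newton_rot 0 n2 h1 m1 z).1 Jz.
by case: Jz'; apply: Fp; rewrite mulN1r reN oppr_gt0.
Qed.

End QuadraticLine.

(** * Symmetries of the Julia set of the Newton map *)

Section NewtonSymmetries.
Variable R : realType.
Local Notation C := R[i].
Variables (m n : nat) (h : C).
Hypothesis n2 : (2 <= n)%N.
Hypothesis h1 : cmod (h - 1) < 1.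
Local Notation N := (relaxed_newton h (pmn R m n)).
Local Notation d := ((m + n)%:R : C).
Local Notation J := (fun z : C => julia N (Some z)).
Local Notation lam := (@newton_mult R m n h).
Local Notation drift := (@drift R m n h).
Local Notation drift1 := (@drift1 R m n h).
Implicit Types (z w a b g : C).

Let n0 : (0 < n)%N := leq_trans (isT : (0 < 2)%N) n2.

Lemma drift_translation be : (forall z, J z <-> J (z + be)) -> drift1 1 be /\ drift1 1 (- be).
Proof.
move=> ht; split; apply: drift1_translation => z Jz; first exact: (ht z).1.
by apply: (ht _).2; rewrite subrK.
Qed.

Lemma newton_no_translation be : ~ julia_is_line N -> be != 0 ->
  (forall z, J z <-> J (z + be)) -> False.
Proof.
move=> nl be0 ht.
have [d1 d2] := drift_translation ht.
have q1 : (0 < 1)%N by [].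
have D1 := drift_of_drift1 n2 h1 q1 d1; have D2 := drift_of_drift1 n2 h1 q1 d2.
(* For n >= 3 a nonreal n-th root of unity supplies the second direction; for n = 2 the nonreal lam
   does. *)
have [n3|n3] := leqP 3 n.
  have [w [wn w1 wi]] := @unity_root_exists R n n2.
  have rot := newton_rot m n2 h1 wn; have cw := unity_root_cmod n0 wn.
  have D3 := drift_rot rot cw D1; have D4 := drift_rot rot cw D2.
  rewrite !expr1 in D3 D4; rewrite mulrN in D4.
  exact: (no_transverse_drift n2 h1 q1 be0 (wi n3) D1 D2 D3 D4).
have [im0|imn] := eqVneq (im lam) 0; last first.
  have D3 := drift_lam D1; have D4 := drift_lam D2.
  rewrite !expr1 in D3 D4; rewrite mulrN in D4.
  exact: (no_transverse_drift n2 h1 q1 be0 imn D1 D2 D3 D4).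
have nE : n = 2%N by apply/eqP; rewrite eqn_leq n2 -ltnS n3.
have hi : im h = 0.
  apply: (lam_pow_real n2 h1).
  have sq (x : C) k : k = 2%N -> im x = 0 -> im (x ^+ k) = 0.
    by move=> -> x0; rewrite expr2 imM x0 mulr0 mul0r addr0.
  exact: sq nE im0.
have mp : (0 < m)%N.
  rewrite lt0n; apply/eqP => m0; apply: nl; rewrite m0 nE.
  exact: quadratic_julia_line.
(* With h real, J is symmetric under conjugation, so conj be is a period as well; it is a second
   direction unless be is real or purely imaginary. *)
have htc z : J z <-> J (z + conjc be).
  have e : conjc (conjc z + be) = z + conjc be by rewrite rmorphD /= conjcK.
  apply: iff_trans (newton_conj m n2 h1 hi z) _.
  by apply: iff_trans (ht _) _; rewrite -e; apply: newton_conj.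
have [d3 d4] := drift_translation htc.
have D3 := drift_of_drift1 n2 h1 q1 d3; have D4 := drift_of_drift1 n2 h1 q1 d4.
have [ki|kn] := eqVneq (im (conjc be / be)) 0; last first.
  have e : conjc be = conjc be / be * be by rewrite divfK.
  rewrite e in D3 D4; exact: (no_transverse_drift n2 h1 q1 be0 kn D1 D2 D3 D4).
have m1 : (-1) ^+ n = 1 :> C by rewrite nE sqrrN expr1n.
have rot := newton_rot m n2 h1 m1.
have ray u (x : R) : cmod u = 1 -> (u ^+ 2) ^+ n = 1 -> 0 < x -> drift1 1 (u * (x%:C)%C) ->
    exists r : R, forall X, r <= X -> J (u * (X%:C)%C).
  move=> u1 un x0 hd; apply: (@drift_ray R m n h n2 h1 hi 1 u x (-1)) => //.
  by move=> c; rewrite expr1 => ->; rewrite expr1n.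
(* The quotient conj be / be is (conj be)^2 / |be|^2, whose imaginary part is -2 re be im be /
   |be|^2. *)
have reim : re be * im be = 0.
  have e : conjc be / be = conjc be * conjc be * (((cmod be ^+ 2)^-1)%:C)%C.
    have cb : ((cmod be ^+ 2)%:C)%C != 0 :> C.
      by rewrite -cmod_gt0 cmod_real normr_gt0 expf_neq0 // cmod_eq0.
    have cj0 : conjc be != 0 by rewrite conjc_eq0.
    rewrite fmorphV /= -mulJ_cmod; field; by rewrite be0 cj0.
  move: ki; rewrite e imM /= mulr0 add0r => /eqP; rewrite mulf_eq0 invr_eq0 expf_eq0 /= cmod_eq0.
  rewrite (negPf be0) orbF !ReImE => /eqP e2; lra.
move/eqP: reim; rewrite mulf_eq0 => /orP[] /eqP b0.
  have iy0 : im be != 0.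
    by apply: contra be0 => /eqP i0; apply/eqP; apply: complex_eq.
  have beE : be = 'i%C * ((im be)%:C)%C by apply: complex_eq; rewrite ?reM ?imM /= ?b0; ring.
  have [x x0 dx] : exists2 x : R, 0 < x & drift1 1 ('i%C * (x%:C)%C).
    have [ip|ineg|i0] := ltgtP 0 (im be).
    - by exists (im be); rewrite -?beE.
    - exists (- im be); first by rewrite oppr_gt0.
      by rewrite rmorphN mulrN /= -beE.
    - by move: iy0; rewrite -i0 eqxx.
  have ci : cmod ('i%C : C) = 1 by rewrite /cmod /= expr0n expr1n add0r sqrtr1.
  have ii : ('i%C ^+ 2) ^+ n = 1 :> C by rewrite sqr_i.
  have [r hr] := ray 'i%C x ci ii x0 dx.
  have := hr r (lexx r); apply.
  have -> : 'i%C * (r%:C)%C = Complex 0 r by apply: complex_eq; rewrite ?reM ?imM /=; ring.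
  rewrite nE; exact: imaginary_axis_fatou.
have x0 : re be != 0.
  by apply: contra be0 => /eqP i0; apply/eqP; apply: complex_eq.
have beE : be = 1 * ((re be)%:C)%C by rewrite mul1r; apply: complex_eq.
have [x xp dx] : exists2 x : R, 0 < x & drift1 1 (1 * (x%:C)%C).
  have [ip|ineg|i0] := ltgtP 0 (re be).
  - by exists (re be); rewrite -?beE.
  - exists (- re be); first by rewrite oppr_gt0.
    by rewrite rmorphN mulrN /= -beE.
  - by move: x0; rewrite -i0 eqxx.
have [r hr] := ray 1 x (@cmod1 R) ltac:(by rewrite !expr1n) xp dx.
apply: (real_ray_not_julia n2 h1 hi); exists r => X /hr.
have -> : 1 * (X%:C)%C = (X%:C)%C :> C by rewrite mul1r.
exact.
Qed.

Lemma newton_rotation_order a : cmod a = 1 -> (forall z, J z <-> J (a * z)) -> a ^+ n = 1.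
Proof.
move=> a1 ha; apply/eqP; apply: contraT => an.
have a0 : a != 0 by rewrite -cmod_gt0 a1.
have dn0 := d_neq0 R m n2; have ln0 := lam_neq0 m n2 h1.
set c := h * n%:R / d ^+ 2 * lam ^+ n.-1.
have c0 : c != 0.
  by rewrite !mulf_neq0 ?invr_eq0 ?expf_neq0 ?(h_neq0 h1) ?(nC_neq0 R n2).
pose g := c * (a ^+ n - 1).
have g0 : g != 0 by rewrite mulf_neq0 // subr_eq0.
have d1 : drift1 n g := drift1_rotation n2 h1 ha a1.
have haV z : J z <-> J (a^-1 * z) by rewrite (ha (a^-1 * z)) mulVKf.
have aV1 : cmod a^-1 = 1 by rewrite cmodV a1 invr1.
have D1 := drift_of_drift1 n2 h1 n0 d1.
(* The inverse rotation has coefficient c (a^(-n) - 1), and rotating its drift by a multiplies this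
   by a^n, giving c (1 - a^n). *)
have D2 : drift n (- g).
  have := drift_rot ha a1 (drift_of_drift1 n2 h1 n0 (drift1_rotation n2 h1 haV aV1)).
  have -> // : a ^+ n * (h * n%:R / d ^+ 2 * lam ^+ n.-1 * (a^-1 ^+ n - 1)) = - g.
  by rewrite -/c exprVn mulrCA mulrBr mulfV ?expf_neq0 // /g mulr1; ring.
exfalso.
have [il|iln] := eqVneq (im (lam ^+ n)) 0; last first.
  have D3 := drift_lam D1; have D4 := drift_lam D2; rewrite mulrN in D4.
  exact: (no_transverse_drift n2 h1 n0 g0 iln D1 D2 D3 D4).
have hi := lam_pow_real n2 h1 il.
have [ia|ian] := eqVneq (im (a ^+ n)) 0; last first.
  have D3 := drift_rot ha a1 D1; have D4 := drift_rot ha a1 D2; rewrite mulrN in D4.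
  exact: (no_transverse_drift n2 h1 n0 g0 ian D1 D2 D3 D4).
(* Now a^n is real, of modulus 1 and not 1, so g = -2c = a^n gam with gam = 2c > 0: the constant
   drift of z^n points along a^n. *)
have am : a ^+ n = -1.
  have ca : cmod (a ^+ n) = 1 by rewrite cmodX a1 expr1n.
  have := cmod_sq (a ^+ n); rewrite ca ia expr1n expr0n addr0 => /esym/eqP.
  rewrite sqrf_eq1 => /orP[] /eqP e; last by apply: complex_eq; rewrite ?ReImE ?e ?ia /= ?oppr0.
  by move/eqP: an; case; apply: complex_eq; rewrite ?e ?ia.
have [hE /andP[hp _]] := h_real_bounds h1 hi.
have [l lE /andP[l0 l1]] := lam_real m n2 h1 hi.
pose gam : R := 2 * (re h * n%:R / (m + n)%:R ^+ 2 * l ^+ n.-1).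
have gam0 : 0 < gam.
  have D0 : 0 < (m + n)%:R :> R by rewrite (lt_le_trans _ (d_ge2 R m n2)).
  have nR : 0 < n%:R :> R by rewrite ltr0n.
  apply: mulr_gt0 => //; apply: mulr_gt0; last exact: exprn_gt0.
  by apply: divr_gt0; [exact: mulr_gt0 | exact: exprn_gt0].
have dg : drift1 n (a ^+ n * (gam%:C)%C).
  have -> // : a ^+ n * (gam%:C)%C = g.
  rewrite /g am /gam /c lE {2}hE.
  rewrite !(rmorphM, fmorphV, rmorphXn) /= !(rmorph_nat (real_complex R)).
  by move: (_ / _ * _) => t; ring.
(* The rotation a also serves as the sign change [eps], since a^n = -1; the ray in direction a is
   then rotated back to the real axis. *)
have [r hr] : exists r : R, forall X, r <= X -> J (a * (X%:C)%C).
  apply: (@drift_ray R m n h n2 h1 hi n a gam a) => //.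
  by rewrite -exprM mulnC exprM am sqrrN expr1n.
apply: (real_ray_not_julia n2 h1 hi); exists r => X /hr.
exact: (ha _).2.
Qed.

Lemma newton_symgroup a b : ~ julia_is_line N ->
  symgroup N (a, b) <-> a ^+ n = 1 /\ b = 0.
Proof.
move=> nl; split=> [/symgroup_elim[a1 ha]|[an ->]]; last first.
  apply: symgroup_intro; first exact: unity_root_cmod n0 an.
  by move=> z; rewrite addr0; apply: newton_rot.
have a0 : a != 0 by rewrite -cmod_gt0 a1.
have b0 : b = 0.
  apply/eqP; apply: contraT => bn; exfalso.
  have [w [wn w1 _]] := @unity_root_exists R n n2.
  have w0 : w != 0 by rewrite -cmod_gt0 (unity_root_cmod n0 wn).
  have ht := commutator_translation a0 w0 ha (newton_rot m n2 h1 wn).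
  apply: newton_no_translation nl _ ht.
  by rewrite mulf_neq0 // subr_eq0 eq_sym.
split=> //; apply: newton_rotation_order => // z.
by have := ha z; rewrite b0 addr0.
Qed.

End NewtonSymmetries.

Theorem theoremD (R : realType) (m n : nat) (h : R[i]) :
  (2 <= n)%N ->
  cmod (h - 1) < 1 ->
  ~ julia_is_line (relaxed_newton h (pmn R m n)) ->
  symgroup (polymap (pmn R m n)) = symgroup (relaxed_newton h (pmn R m n)).
Proof.
move=> n2 h1 nl; apply: funext => -[a b]; apply: propext.
by rewrite polymap_symgroup // newton_symgroup.
Qed.
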